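(* Let $Z(t)=X_1+\dots+X_t$, $t\in\mathbb{N}$ (with $Z(0)=0$), be a random walk whose increments are i.i.d. copies of a real random variable $X$ that is not almost surely constant and takes both positive and negative values with positive probability. Let $\varphi(\lambda)=\mathbb{E}[e^{\lambda X}]$, $\psi=\log\varphi$, $\Lambda=\{\lambda\in\mathbb{R}:\varphi(\lambda)<+\infty\}$ and $\Lambda_+=(0,+\infty)\cap\operatorname{int}(\Lambda)$. Assume that $\Lambda_+$ is non-empty, that $\varphi$ is at least twice differentiable in $\Lambda_+$, and that there exists $\lambda^*\in\Lambda_+$ with $\psi(\lambda^* )=0$. Let $B\in L(\lambda)$ for some $\lambda\in\Lambda_+$ with $\psi'(\lambda)>0$. If $\psi'(\lambda)<\psi'(\lambda^* )$, then the asymptotically optimal number of particles is $$N^*=\max\{N\ge 1: N\psi'(\lambda)<\psi'(\lambda^* )\}=\left\lceil\frac{\psi'(\lambda^* )}{\psi'(\lambda)}\right\rceil-1;$$ otherwise, the asymptotically optimal number of particles is $N^*=1$.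
   Context: $\tau(x)=\inf\{t\ge 0: Z(t)\ge x\}$. $\tau^{(N)}(x)=\min\{\tau_1(x),\dots,\tau_N(x)\}$, where $\tau_1(x),\dots,\tau_N(x)$ are independent random times each distributed as $\tau(x)$. For $\lambda\in\Lambda_+$, $L(\lambda)$ is the set of functions $f:\mathbb{R}\to\mathbb{R}$ such that $x=\psi'(\lambda)\,f(x)+o\left(\sqrt{f(x)}\right)$ as $x\to+\infty$. For an integer $N\ge1$ put $R_N(x)=\mathbb{P}(\tau^{(N)}(x)\le B(x)/N)\,/\,\mathbb{P}(\tau(x)\le B(x))$. A number of particles $N^*\ge 1$ is called asymptotically optimal if $\lim_{x\to+\infty}R_{N^*}(x)$ exists and $\limsup_{x\to+\infty}R_N(x)\le\lim_{x\to+\infty}R_{N^*}(x)$ for every integer $N\ge1$. $\lceil\cdot\rceil$ is the ceiling function. *)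

(* Defs.v *)
From HB Require Import structures.
From mathcomp Require Export all_boot all_order all_algebra.
From mathcomp Require Export all_classical all_reals all_analysis measurable_realfun.
Export Order.TTheory GRing.Theory Num.Theory.
Export numFieldNormedType.Exports.

Set Implicit Arguments.
Unset Strict Implicit.
Unset Printing Implicit Defensive.

Local Open Scope classical_set_scope.
Local Open Scope ring_scope.

(* Only measurable [A] are tested: a measure has no meaning on other sets. *)
Definition same_law d d' (T : measurableType d) (S : measurableType d')
    (R : realType) (P : probability T R) (Y Y' : T -> S) : Prop :=
  forall A : set S, measurable A -> P (Y @^-1` A) = P (Y' @^-1` A).

Definition mutually_independent d d' (T : measurableType d)
    (S : measurableType d') (R : realType) (P : probability T R)
    (I : eqType) (Y : I -> T -> S) : Prop :=
  forall (s : seq I) (A : I -> set S), uniq s ->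
    (forall i, measurable (A i)) ->
    P (\bigcap_(i in [set` s]) (Y i @^-1` A i))
      = (\prod_(i <- s) P (Y i @^-1` A i))%E.

Definition iid_copies d d' (T : measurableType d) (S : measurableType d')
    (R : realType) (P : probability T R) (I : eqType) (Y : I -> T -> S)
    (X : T -> S) : Prop :=
  mutually_independent P Y /\ forall i, same_law P (Y i) X.

Section RandomWalk.
Context {d : measure_display} {T : measurableType d} {R : realType}.

(* [Xs i] is the increment usually written X_{i+1}. *)
Definition walk (Xs : nat -> T -> R) (t : nat) (w : T) : R :=
  \sum_(i < t) Xs i w.

(* Equals [+oo] when the level [x] is never reached. *)
Definition hitting_time (Z : nat -> T -> R) (x : R) (w : T) : \bar R :=
  ereal_inf [set (t%:R)%:E | t in [set t : nat | x <= Z t w]].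

Definition first_time (N : nat) (tau : 'I_N -> T -> \bar R) (w : T) : \bar R :=
  \big[Order.min/+oo%E]_(k < N) tau k w.

End RandomWalk.

Canonical pinfty_filterType (R : numFieldType) :=
  FilterType (pinfty_nbhs R) _.

Section LogLaplace.
Context {d : measure_display} {T : measurableType d} {R : realType}.
Variables (P : probability T R) (X : T -> R).

Definition Lambda : set R := [set l | ('M_P X l < +oo)%E].

Definition Lambda_plus : set R := `]0, +oo[ `&` interior Lambda.

(* [fine] sends the value [+oo], taken off [Lambda], to 0; [phi] and [psi] are
   only meaningful on [Lambda], and [derive1 psi] on its interior. *)
Definition phi (l : R) : R := fine ('M_P X l).

Definition psi (l : R) : R := ln (phi l).

Definition Lset (l : R) : set (R -> R) :=
  [set f : R -> R | (fun x : R => x - derive1 psi l * f x)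
                      =o_ (pinfty_nbhs R) (fun x : R => Num.sqrt (f x))].

End LogLaplace.

(* [tau N x] is the family of the N random times of the N particles for the
   level [x]; no relation is imposed between distinct [N] or [x]. *)
Definition prob_ratio d (T : measurableType d) (R : realType)
    (P : probability T R) (Z : nat -> T -> R)
    (tau : forall N : nat, R -> 'I_N -> T -> \bar R) (B : R -> R)
    (N : nat) (x : R) : R :=
  fine (P [set w | (first_time (tau N x) w <= (B x / N%:R)%:E)%E])
  / fine (P [set w | (hitting_time Z x w <= (B x)%:E)%E]).

Definition asymptotically_optimal (R : realType) (RN : nat -> R -> R)
    (Nstar : nat) : Prop :=
  [/\ (1 <= Nstar)%N,
      cvg (RN Nstar x @[x --> +oo%R]) &
      forall N : nat, (1 <= N)%N ->
        (limf_esup (EFin \o RN N) (pinfty_nbhs R)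
           <= (lim (RN Nstar x @[x --> +oo%R]))%:E)%E].

(* Main.v *)
From HB Require Import structures.
Require Import Defs.
From mathcomp Require Import ring lra zify.

Set Implicit Arguments.
Unset Strict Implicit.
Unset Printing Implicit Defensive.

Local Open Scope classical_set_scope.
Local Open Scope ring_scope.

(* Let [v = psi' l] and [v* = psi' lstar].  Fubini turns the walk into the operator
   [killop]: [P (tau x <= n)] is its n-th iterate applied to the indicator of
   [(-oo, 0]].  Tilting by [expR (lstar * z)], a probability weight since
   [psi lstar = 0], gives [P (tau x <= n) = expR (- lstar * x) * G n x], where [G n x]
   increases to a function [g] bounded away from 0 on [(0, +oo)]: under the tilt the
   walk has mean [v* > 0] and a tight overshoot.

   If [N * v < v*] (resp. [N * v > v*]), Chernoff's bound with an exponent just below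
   (resp. above) [lstar] shows that [G] at the deadline [B x / N] is equivalent to
   [g x] (resp. negligible before it), so [R_N] tends to [N] (resp. to 0).  If
   [N * v = v*] the deadline falls at the median of [tau x] under the tilt.  As
   [limsup R_N <= N / 2] is then needed although [g] need not converge (the increments
   may be lattice), one shows that [g] is asymptotically constant on a subgroup of full
   measure: its mean square increment tends to 0 by a bounded-energy argument, as in
   the Choquet-Deny theorem.  Hence hitting [x] before the deadline decorrelates from
   the residual factor at [x - H], and the central limit theorem gives the factor 1/2.

   If [v >= v*], a single particle beats the deadline with a probability that the tilt
   by [l] estimates from below, and Chernoff's bound makes [N >= 2] particles with a
   deadline [N] times shorter exponentially worse. *)

(** * Weighted expectations and bounded measurable functions *)

Definition bmeas (R : realType) (f : R -> R) :=
  measurable_fun setT f /\ exists C : R, forall u, `|f u| <= C.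

Section Expectation.
Context (R : realType) (mu : probability R R) (w : R -> R).

(** Expectations carry a density [w] against a fixed law [mu], so that the law itself ([w = one])
    and all its tilts are covered by the same lemmas. *)
Definition intw (f : R -> R) := mu.-integrable setT (EFin \o (f \* w)).
Definition Ew (f : R -> R) : R := \int[mu]_z (f z * w z).
Definition stepop (f : R -> R) (u : R) : R := Ew (fun z => f (u - z)).

Record weight := Weight {
  weight_gt0 : forall z, 0 < w z ;
  weight_meas : measurable_fun setT w ;
  weight_int : mu.-integrable setT (EFin \o w) ;
  weight_1 : \int[mu]_z w z = 1 }.

Lemma intwD f g : intw f -> intw g -> intw (fun z => f z + g z).
Proof.
move=> hf hg; rewrite /intw (_ : EFin \o _ = (fun z => (f z * w z)%:E + (g z * w z)%:E)%E).
  exact: integrableD.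
by apply/funext => z /=; rewrite mulrDl.
Qed.

Lemma intwZ c f : intw f -> intw (fun z => c * f z).
Proof.
move=> hf; rewrite /intw (_ : EFin \o _ = (fun z => c%:E * (f z * w z)%:E)%E).
  exact: integrableZl.
by apply/funext => z /=; rewrite -EFinM mulrA.
Qed.

Lemma intwB f g : intw f -> intw g -> intw (fun z => f z - g z).
Proof.
move=> hf hg; rewrite (_ : (fun z => _) = (fun z => f z + (-1) * g z)).
  by apply: intwD => //; exact: intwZ.
by apply/funext => z; rewrite mulN1r.
Qed.

Lemma EwD f g : intw f -> intw g -> Ew (fun z => f z + g z) = Ew f + Ew g.
Proof.
move=> hf hg; rewrite /Ew -RintegralD//.
by apply: eq_Rintegral => z _; rewrite mulrDl.
Qed.

Lemma EwZ c f : intw f -> Ew (fun z => c * f z) = c * Ew f.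
Proof.
move=> hf; rewrite /Ew -RintegralZl//.
by apply: eq_Rintegral => z _; rewrite mulrA.
Qed.

Lemma EwB f g : intw f -> intw g -> Ew (fun z => f z - g z) = Ew f - Ew g.
Proof.
move=> hf hg; rewrite /Ew -RintegralB//.
by apply: eq_Rintegral => z _; rewrite mulrBl.
Qed.

Lemma eq_Ew f g : f =1 g -> Ew f = Ew g.
Proof. by move=> fg; apply: eq_Rintegral => z _; rewrite fg. Qed.

Hypothesis W : weight.

Lemma Ew_cst c : Ew (fun=> c) = c.
Proof.
have [_ _ iw w1] := W.
by rewrite /Ew RintegralZl// w1 mulr1.
Qed.

Lemma le_Ew f g : intw f -> intw g -> (forall z, f z <= g z) -> Ew f <= Ew g.
Proof.
move=> hf hg fg; apply: le_Rintegral => // z _.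
by rewrite ler_pM2r// (weight_gt0 W).
Qed.

Lemma Ew_ge0 f : (forall z, 0 <= f z) -> 0 <= Ew f.
Proof.
by move=> f0; apply: Rintegral_ge0 => z _; rewrite mulr_ge0// ltW// (weight_gt0 W).
Qed.

Lemma intw_le (f g : R -> R) : measurable_fun setT f -> intw g ->
  (forall z, `|f z| <= g z) -> intw f.
Proof.
move=> mf ig fg; have [w0 mw _ _] := W.
apply: (le_integrable _ _ _ ig) => //.
  by apply/measurable_EFinP; exact: measurable_funM.
move=> z _ /=; rewrite lee_fin !normrM ler_pM2r ?normr_gt0 ?gt_eqF//.
by rewrite (le_trans (fg z))// ler_norm.
Qed.

Lemma intw_cst c : intw (fun=> c).
Proof.
have [_ _ iw _] := W.
rewrite /intw (_ : EFin \o _ = (fun z => c%:E * (w z)%:E)%E); last exact/funext.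
exact: integrableZl.
Qed.

Lemma intw_bmeas f : bmeas f -> intw f.
Proof. by move=> [mf [C fC]]; apply: (intw_le mf (intw_cst C)). Qed.

Lemma ler_norm_Ew f : intw f -> `|Ew f| <= Ew (fun z => `|f z|).
Proof.
move=> hf; apply: (le_trans (le_normr_Rintegral _ hf)) => //.
rewrite le_eqVlt; apply/orP; left; apply/eqP; apply: eq_Rintegral => z _ /=.
by rewrite normrM (@gtr0_norm _ (w z))// (weight_gt0 W).
Qed.

End Expectation.

Section BoundedMeasurable.
Context (R : realType).
Implicit Types f g : R -> R.

Lemma bmeas_cst c : bmeas (fun _ : R => c : R).
Proof. by split=> //; exists `|c|. Qed.

Lemma bmeasD f g : bmeas f -> bmeas g -> bmeas (fun u => f u + g u).
Proof.
move=> [mf [A fA]] [mg [B gB]]; split; first exact: measurable_funD.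
by exists (A + B) => u; rewrite (le_trans (ler_normD _ _))// lerD.
Qed.

Lemma bmeasM f g : bmeas f -> bmeas g -> bmeas (fun u => f u * g u).
Proof.
move=> [mf [A fA]] [mg [B gB]]; split; first exact: measurable_funM.
by exists (A * B) => u; rewrite normrM ler_pM.
Qed.

Lemma bmeasZ c f : bmeas f -> bmeas (fun u => c * f u).
Proof. by move=> bf; apply: bmeasM => //; exact: bmeas_cst. Qed.

Lemma bmeasB f g : bmeas f -> bmeas g -> bmeas (fun u => f u - g u).
Proof.
move=> bf bg; rewrite (_ : (fun _ => _) = (fun u => f u + (-1) * g u)).
  by apply: bmeasD => //; exact: bmeasZ.
by apply/funext => u; rewrite mulN1r.
Qed.

Lemma bmeasX f n : bmeas f -> bmeas (fun u => f u ^+ n).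
Proof.
move=> bf; elim: n => [|n ih]; first exact: bmeas_cst.
by under [fun _ => _]funext do rewrite exprS; exact: bmeasM.
Qed.

Lemma bmeas_comp f (h : R -> R) : measurable_fun setT h -> bmeas f ->
  bmeas (fun u => f (h u)).
Proof.
move=> mh [mf [A fA]]; split; first exact: measurableT_comp.
by exists A => u; exact: fA.
Qed.

Lemma bmeas_refl f u : bmeas f -> bmeas (fun z => f (u - z)).
Proof. by apply: bmeas_comp; exact: measurable_funB. Qed.

Lemma bmeas_shift f h : bmeas f -> bmeas (fun u => f (h + u)).
Proof. by apply: bmeas_comp; exact: measurable_funD. Qed.

Lemma bmeas_indic (A : set R) : measurable A -> bmeas (\1_A : R -> R).
Proof.
move=> mA; split; first exact: measurable_indic.
exists 1 => u; rewrite indicE; case: (u \in A); rewrite ?normr1 ?normr0//.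
Qed.

Lemma bmeas_if (p : R -> bool) f g : measurable_fun setT p -> bmeas f -> bmeas g ->
  bmeas (fun u => if p u then f u else g u).
Proof.
move=> mp [mf [A fA]] [mg [B gB]]; split.
  apply: measurable_fun_ifT => //.
exists (Num.max A B) => u; rewrite le_max; case: ifP => _; rewrite ?fA ?gB ?orbT//.
Qed.

End BoundedMeasurable.

Section Iteration.
Context (R : realType) (mu : probability R R) (w : R -> R).
Hypothesis W : weight mu w.
Notation Ew := (Ew mu w).
Notation K := (stepop mu w).

(** The first density is left free: [v = w] serves the exchange of two steps, [v = 1] the
    measurability of an expectation in its parameter. *)
Lemma integrable_weight2 (v : R -> R) (F : R * R -> R) (C : R) :
  (forall x, 0 <= v x) -> measurable_fun setT v ->
  mu.-integrable setT (EFin \o v) ->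
  measurable_fun setT F -> (forall p, `|F p| <= C) ->
  (mu \x mu)%E.-integrable setT (EFin \o (fun p => F p * v p.1 * w p.2)).
Proof.
have [w0 mw iw w1] := W.
move=> v0 mv iv mF FC.
have mwp : measurable_fun setT (fun p : R * R => F p * v p.1 * w p.2).
  apply: measurable_funM; [apply: measurable_funM => //|].
    exact: (measurableT_comp mv measurable_fst).
  exact: (measurableT_comp mw measurable_snd).
apply/integrable12ltyP; first exact/measurable_EFinP.
rewrite /=.
have C0 : 0 <= C by rewrite (le_trans _ (FC (0, 0))).
have ew : (\int[mu]_y (w y)%:E = 1)%E.
  by rewrite -[LHS]fineK ?(integrable_fin_num _ iw)//; congr EFin.
apply: (@le_lt_trans _ _ (\int[mu]_x (C%:E * (v x)%:E))%E); last first.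
  by rewrite integralZl// -[X in (_ * X)%E]fineK ?(integrable_fin_num _ iv)// -EFinM ltry.
apply: ge0_le_integral => //.
- by move=> x _; exact: integral_ge0.
- apply: (@measurable_fun_fubini_tonelli_F _ _ _ _ _ mu
    (fun p => `|(F p * v p.1 * w p.2)%:E|%E)) => //.
  by apply: measurableT_comp => //; exact/measurable_EFinP.
- by apply: measurable_funeM; exact/measurable_EFinP.
- move=> x _.
  apply: (@le_trans _ _ (\int[mu]_y ((C * v x)%:E * (w y)%:E))%E); last first.
    by rewrite integralZl// ew mule1 -EFinM.
  apply: ge0_le_integral => //.
  + apply: measurableT_comp => //; apply: measurableT_comp => //.
    by apply: (measurableT_comp mwp); exact: measurable_pair1.
  + by apply: measurable_funeM; exact/measurable_EFinP.
  + move=> y _; rewrite -EFinM lee_fin !normrM.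
    by rewrite (ger0_norm (v0 x)) (gtr0_norm (w0 y)) ler_pM2r// ler_wpM2r.
Qed.

Lemma Ew_swap (F : R * R -> R) (C : R) : measurable_fun setT F ->
  (forall p, `|F p| <= C) ->
  Ew (fun x => Ew (fun y => F (x, y))) = Ew (fun y => Ew (fun x => F (x, y))).
Proof.
have [w0 mw iw w1] := W.
move=> mF FC; have iF := integrable_weight2 (fun z => ltW (w0 z)) mw iw mF FC.
have Fx x : measurable_fun setT (fun y => F (x, y)).
  by apply: (measurableT_comp mF); exact: measurable_pair1.
have Fy y : measurable_fun setT (fun x => F (x, y)).
  by apply: (measurableT_comp mF); exact: measurable_pair2.
have i1 x : intw mu w (fun y => F (x, y)).
  by apply: (intw_bmeas W); split=> //; exists C.
have i2 y : intw mu w (fun x => F (x, y)).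
  by apply: (intw_bmeas W); split=> //; exists C.
have := Fubini iF.
rewrite /Ew /Rintegral => h; congr fine.
under eq_integral => x _.
  rewrite EFinM fineK; last exact: (integrable_fin_num _ (i1 x)).
  rewrite muleC -integralZl//; last exact: i1.
  under eq_integral => y _ do rewrite -EFinM mulrCA mulrA -/(F (x,y)).
  over.
rewrite /=.
under [RHS]eq_integral => y _.
  rewrite EFinM fineK; last exact: (integrable_fin_num _ (i2 y)).
  rewrite muleC -integralZl//; last exact: i2.
  under eq_integral => x _ do rewrite -EFinM mulrC.
  over.
exact: h.
Qed.

Lemma bmeas_Ew (F : R * R -> R) (C : R) : measurable_fun setT F ->
  (forall p, `|F p| <= C) -> bmeas (fun u => Ew (fun z => F (u, z))).
Proof.
have [w0 mw iw w1] := W; move=> mF FC.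
have bF u : bmeas (fun z => F (u, z)).
  split; last by exists C => z.
  by apply: (measurableT_comp mF); exact: measurable_pair1.
split; last first.
  exists C => u; apply: (le_trans (ler_norm_Ew W _)); first exact: (intw_bmeas W).
  rewrite -[leRHS](Ew_cst W); apply: (le_Ew W) => //; last exact: (intw_cst W).
  apply: (intw_bmeas W); split; last by exists C => z; rewrite normr_id.
  by apply: measurableT_comp => //; case: (bF u).
have iF : (mu \x mu)%E.-integrable setT (EFin \o (fun p : R * R => F p * 1 * w p.2)).
  apply: (integrable_weight2 (v := fun=> 1) (C := C) _ _ _ mF) => //.
  exact: finite_measure_integrable_cst.
rewrite (_ : (fun u => _) = fine \o fubini_F mu
    (EFin \o (fun p : R * R => F p * 1 * w p.2))); last first.
  apply/funext => u; rewrite /Ew /fubini_F /= -[RHS]/(Rintegral mu setT _).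
  by apply: eq_Rintegral => z _; rewrite mulr1.
by apply: measurableT_comp => //; exact: (measurable_fubini_F iF).
Qed.

Lemma bmeas_K f : bmeas f -> bmeas (K f).
Proof.
move=> [mf [C fC]].
apply: (@bmeas_Ew (fun p => f (p.1 - p.2)) C) => // .
by apply: measurableT_comp => //; exact: measurable_funB.
Qed.

(** The variance is nonnegative. *)
Lemma sqr_Ew_le f : bmeas f -> Ew f ^+ 2 <= Ew (fun z => f z ^+ 2).
Proof.
move=> bf; rewrite -subr_ge0.
have i1 := intw_bmeas W bf; have i2 := intw_bmeas W (bmeasX 2 bf).
rewrite (_ : _ - _ = Ew (fun z => (f z - Ew f) ^+ 2)).
  by apply: (Ew_ge0 W) => z; exact: sqr_ge0.
transitivity (Ew (fun z => (f z ^+ 2 - 2 * Ew f * f z) + Ew f ^+ 2)).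
  rewrite EwD; [|by apply: intwB => //; exact: intwZ|exact: (intw_cst W)].
  by rewrite EwB//; [rewrite EwZ// (Ew_cst W); ring|exact: intwZ].
by apply: eq_Ew => z; ring.
Qed.

End Iteration.

(** * Free and stopped transition operators *)

Section Kernel.
Context (R : realType) (mu : probability R R) (w : R -> R).
Hypothesis W : weight mu w.
Notation Ew := (Ew mu w).
Notation K := (stepop mu w).
Notation intw := (intw mu w).
Implicit Types f g : R -> R.

Lemma bmeas_ind (p : R -> bool) : measurable_fun setT p ->
  bmeas (fun u => (p u)%:R : R).
Proof.
move=> mp; rewrite (_ : (fun u => _) = (fun u => if p u then 1 else 0)).
  by apply: bmeas_if => //; exact: bmeas_cst.
by apply/funext => u; case: (p u).
Qed.

Lemma bmeas_le0 : bmeas (fun u : R => (u <= 0)%R%:R : R).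
Proof. by apply: bmeas_ind; exact: measurable_fun_ler. Qed.

Lemma le_K f g u : bmeas f -> bmeas g -> (forall z, f z <= g z) -> K f u <= K g u.
Proof.
move=> bf bg fg; apply: (le_Ew W) => // ; apply/(intw_bmeas W)/bmeas_refl => //.
Qed.

Lemma K_cst c u : K (fun=> c) u = c.
Proof. exact: Ew_cst. Qed.

Lemma KD f g u : bmeas f -> bmeas g -> K (fun v => f v + g v) u = K f u + K g u.
Proof. by move=> bf bg; apply: EwD; apply/(intw_bmeas W)/bmeas_refl. Qed.

Lemma KZ c f u : bmeas f -> K (fun v => c * f v) u = c * K f u.
Proof. by move=> bf; apply: EwZ; apply/(intw_bmeas W)/bmeas_refl. Qed.

Lemma K_ge0 f u : (forall z, 0 <= f z) -> 0 <= K f u.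
Proof. by move=> f0; exact: Ew_ge0. Qed.

(* One step of the walk started at [u], going down by [z] with weight [w z], and frozen
   once it has entered [(-oo, 0]]. *)
Definition killop f (u : R) : R := if u <= 0 then f u else K f u.
Local Notation L := killop.

Lemma bmeas_L f : bmeas f -> bmeas (L f).
Proof.
move=> bf; apply: bmeas_if => //; last exact: bmeas_K.
exact: measurable_fun_ler.
Qed.

Lemma bmeas_iterL n f : bmeas f -> bmeas (iter n L f).
Proof. by move=> bf; elim: n => //= n; exact: bmeas_L. Qed.

Lemma bmeas_iterK n f : bmeas f -> bmeas (iter n K f).
Proof. by move=> bf; elim: n => //= n; exact: bmeas_K. Qed.

Lemma iterL_le0 n f u : u <= 0 -> iter n L f u = f u.
Proof. by move=> u0; elim: n => //= n ih; rewrite /killop u0. Qed.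

Lemma le_L f g u : bmeas f -> bmeas g -> (forall z, f z <= g z) -> L f u <= L g u.
Proof. by move=> bf bg fg; rewrite /killop; case: ifP => _ //; exact: le_K. Qed.

Lemma le_iterL n f g u : bmeas f -> bmeas g -> (forall z, f z <= g z) ->
  iter n L f u <= iter n L g u.
Proof.
move=> bf bg fg; elim: n u => //= n ih u.
by apply: le_L => //; exact: bmeas_iterL.
Qed.

Lemma le_iterK n f g u : bmeas f -> bmeas g -> (forall z, f z <= g z) ->
  iter n K f u <= iter n K g u.
Proof.
move=> bf bg fg; elim: n u => //= n ih u.
by apply: le_K => //; exact: bmeas_iterK.
Qed.

Lemma iterL_cst n c u : iter n L (fun=> c) u = c.
Proof.
elim: n u => //= n ih u; rewrite /killop; case: ifP => _ //.
by rewrite (_ : iter n _ _ = fun=> c) ?K_cst//; exact/funext.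
Qed.

Lemma iterK_cst n c u : iter n K (fun=> c) u = c.
Proof.
elim: n u => //= n ih u.
by rewrite (_ : iter n _ _ = fun=> c) ?K_cst//; exact/funext.
Qed.

Lemma iterLD n f g u : bmeas f -> bmeas g ->
  iter n L (fun v => f v + g v) u = iter n L f u + iter n L g u.
Proof.
move=> bf bg; elim: n u => //= n ih u; rewrite /killop; case: ifP => u0.
  by rewrite !iterL_le0.
by rewrite (funext ih) KD//; exact: bmeas_iterL.
Qed.

Lemma iterLZ n c f u : bmeas f ->
  iter n L (fun v => c * f v) u = c * iter n L f u.
Proof.
move=> bf; elim: n u => //= n ih u; rewrite /killop; case: ifP => u0.
  by rewrite !iterL_le0.
by rewrite (funext ih) KZ//; exact: bmeas_iterL.
Qed.

Lemma iterKD n f g u : bmeas f -> bmeas g ->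
  iter n K (fun v => f v + g v) u = iter n K f u + iter n K g u.
Proof.
move=> bf bg; elim: n u => //= n ih u.
by rewrite (funext ih) KD//; exact: bmeas_iterK.
Qed.

Lemma iterKZ n c f u : bmeas f ->
  iter n K (fun v => c * f v) u = c * iter n K f u.
Proof.
move=> bf; elim: n u => //= n ih u.
by rewrite (funext ih) KZ//; exact: bmeas_iterK.
Qed.

Lemma iterL_itv n f (a b u : R) : bmeas f -> (forall z, a <= f z <= b) ->
  a <= iter n L f u <= b.
Proof.
move=> bf fab; apply/andP; split.
  rewrite -[leLHS](iterL_cst n a u) le_iterL//; first exact: bmeas_cst.
  by move=> z; have /andP[] := fab z.
rewrite -[leRHS](iterL_cst n b u) le_iterL//; first exact: bmeas_cst.
by move=> z; have /andP[] := fab z.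
Qed.

Lemma iterK_itv n f (a b u : R) : bmeas f -> (forall z, a <= f z <= b) ->
  a <= iter n K f u <= b.
Proof.
move=> bf fab; apply/andP; split.
  rewrite -[leLHS](iterK_cst n a u) le_iterK//; first exact: bmeas_cst.
  by move=> z; have /andP[] := fab z.
rewrite -[leRHS](iterK_cst n b u) le_iterK//; first exact: bmeas_cst.
by move=> z; have /andP[] := fab z.
Qed.

Definition mgf (t : R) : R := Ew (fun z => expR (t * z)).

Lemma mgf_ge0 t : 0 <= mgf t.
Proof. by apply: (Ew_ge0 W) => z; exact: expR_ge0. Qed.

(** [expR (b * u)] is an eigenfunction of the step operator with eigenvalue [mgf (- b)]. *)
Lemma K_le_exp f (b c u : R) : bmeas f -> intw (fun z => expR (- b * z)) ->
  (forall v, f v <= c * expR (b * v)) -> K f u <= c * mgf (- b) * expR (b * u).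
Proof.
move=> bf ib fc.
apply: (@le_trans _ _ (Ew (fun z => (c * expR (b * u)) * expR (- b * z)))).
  apply: (le_Ew W); [exact/(intw_bmeas W)/bmeas_refl|exact: intwZ|move=> z].
  by rewrite -mulrA -expRD (_ : b * u + - b * z = b * (u - z))//; ring.
by rewrite EwZ// /mgf mulrAC.
Qed.

Lemma iterK_le_exp n f (b c u : R) : bmeas f -> intw (fun z => expR (- b * z)) ->
  (forall v, f v <= c * expR (b * v)) ->
  iter n K f u <= c * mgf (- b) ^+ n * expR (b * u).
Proof.
move=> bf ib fc; elim: n u => [|n ih] u /=; first by rewrite mulr1.
by rewrite exprSr mulrA; apply: K_le_exp => //; exact: bmeas_iterK.
Qed.

Lemma iterL_le_exp n f (b c u : R) : 0 <= c -> bmeas f ->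
  intw (fun z => expR (- b * z)) ->
  (forall v, f v <= c * expR (b * v)) -> (forall v, v <= 0 -> f v <= 0) ->
  iter n L f u <= c * mgf (- b) ^+ n * expR (b * u).
Proof.
move=> c0 bf ib fc f0; elim: n u => [|n ih] u /=; first by rewrite mulr1.
rewrite /killop; case: ifPn => u0.
  rewrite iterL_le0//; apply: (le_trans (f0 _ u0)).
  by rewrite !mulr_ge0 ?exprn_ge0 ?mgf_ge0 ?expR_ge0.
by rewrite exprSr mulrA; apply: K_le_exp => //; exact: bmeas_iterL.
Qed.

Lemma Ew_dcvg (f_ : nat -> R -> R) f g : intw g ->
  (forall n, measurable_fun setT (f_ n)) -> (forall n z, `|f_ n z| <= g z) ->
  (forall z, f_ n z @[n --> \oo] --> f z) -> Ew (f_ n) @[n --> \oo] --> Ew f.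
Proof.
have [w0 mw iw w1] := W.
move=> ig mf fC fcv.
have mf' : measurable_fun setT f by exact: (@measurable_fun_cvg _ _ _ setT f_ f).
have [fi _ h] : [/\ mu.-integrable setT (fun z => (f z * w z)%:E),
    [sequence \int[mu]_z `|(f_ n z * w z)%:E - (f z * w z)%:E|]_n @ \oo --> 0 &
    [sequence \int[mu]_z (f_ n z * w z)%:E]_n @ \oo --> \int[mu]_z (f z * w z)%:E]%E.
  apply: (dominated_convergence _ _ _ _ ig) => //.
  - by move=> n; apply/measurable_EFinP; exact: measurable_funM.
  - by apply/measurable_EFinP; exact: measurable_funM.
  - by apply: aeW => z _; apply: cvg_EFin; [exact: nearW|exact: cvgMr_tmp].
  - apply: aeW => z n _; rewrite /= lee_fin normrM (gtr0_norm (w0 z)).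
    by rewrite ler_pM2r.
apply: fine_cvg; rewrite fineK//; exact: (integrable_fin_num _ fi).
Qed.

Lemma K_dcvg (f_ : nat -> R -> R) f (C : R) u :
  (forall n, measurable_fun setT (f_ n)) -> (forall n z, `|f_ n z| <= C) ->
  (forall z, f_ n z @[n --> \oo] --> f z) -> K (f_ n) u @[n --> \oo] --> K f u.
Proof.
move=> mf fC fcv; apply: (Ew_dcvg (intw_cst W C)) => // n.
by apply: measurableT_comp => //; exact: measurable_funB.
Qed.

(** * Exponential bounds for the stopped walk *)

Section Hitting.
Variables b : R.
Hypotheses (b0 : 0 <= b) (ib : intw (fun z => expR (- b * z))).

(** The indicator of [(0, +oo)] lies below [expR (b * v)]. Once [mgf (- b) < 1], this makes hitting
    certain. *)
Lemma escape n (u : R) : iter n L (fun v => (0 < v)%R%:R) u <= mgf (- b) ^+ n * expR (b * u).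
Proof.
rewrite -[X in X * expR _]mul1r; apply: iterL_le_exp => //.
- by apply: bmeas_ind; exact: measurable_fun_ltr.
- move=> v; rewrite mul1r; case: ltP => v0; last exact: expR_ge0.
  by rewrite -expR0 ler_expR mulr_ge0// ltW.
- by move=> v; case: ltP.
Qed.

Lemma iterK_gt_exp n (a u : R) :
  iter n K (fun v => (a < v)%R%:R) u <= mgf (- b) ^+ n * expR (b * (u - a)).
Proof.
rewrite (_ : _ * _ = expR (- b * a) * mgf (- b) ^+ n * expR (b * u)); last first.
  by rewrite mulrAC -expRD mulrC; congr (_ * _); congr expR; ring.
apply: iterK_le_exp => //.
- by apply: bmeas_ind; exact: measurable_fun_ltr.
- move=> v; rewrite -expRD; case: ltP => v0; last exact: expR_ge0.
  by rewrite -expR0 ler_expR mulNr addrC -mulrBr mulr_ge0// subr_ge0 ltW.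
Qed.

Hypothesis m1 : mgf (- b) <= 1.

(** Passes from the stopped walk to the free one, which the central limit theorem handles. After a
    hit, the free walk ends above [a] with probability at most [expR (- (b * a))], whatever the
    number of remaining steps, because [mgf (- b) <= 1]. *)
Lemma hit_le_end m (a u : R) :
  iter m L (fun v => (v <= 0)%R%:R) u <=
  iter m K (fun v => (v <= a)%R%:R) u + expR (- (b * a)).
Proof.
have bl a' : bmeas (fun v : R => (v <= a')%R%:R : R).
  by apply: bmeas_ind; exact: measurable_fun_ler.
have bg a' : bmeas (fun v : R => (a' < v)%R%:R : R).
  by apply: bmeas_ind; exact: measurable_fun_ltr.
have neg n (v : R) : v <= 0 ->
    1 <= iter n K (fun v => (v <= a)%R%:R) v + expR (- (b * a)).
  move=> v0.
  have e1 : iter n K (fun v => (v <= a)%R%:R) v + iter n K (fun v => (a < v)%R%:R) v = 1.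
    rewrite -iterKD// -[RHS](iterK_cst n 1 v); congr (iter n K _ v).
    by apply/funext => z; case: leP; rewrite ?addr0 ?add0r.
  rewrite -[leLHS]e1 lerD2l (le_trans (iterK_gt_exp _ _ _))//.
  rewrite -[leRHS]mul1r ler_pM ?exprn_ge0 ?mgf_ge0 ?expR_ge0//.
    by rewrite exprn_ile1// mgf_ge0.
  by rewrite ler_expR mulrBr gerDr mulr_ge0_le0.
elim: m u => [|m ih] u.
  rewrite /=; case: (leP u 0) => u0; first exact: (neg 0%N u u0).
  by rewrite addr_ge0 ?expR_ge0// ler0n.
rewrite /= {1}/killop; case: ifPn => u0.
  by rewrite iterL_le0// u0; exact: (neg m.+1).
rewrite -(K_cst (expR _) u) -KD; [|exact: bmeas_iterK|exact: bmeas_cst].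
apply: le_K => //; first exact: bmeas_iterL.
by apply: bmeasD; [exact: bmeas_iterK|exact: bmeas_cst].
Qed.

End Hitting.

Lemma norm_indM_le (p : bool) (x : R) : 0 <= x -> `|p%:R * x| <= x.
Proof. by case: p => x0; rewrite ?mul1r ?mul0r ?normr0 ?ger0_norm. Qed.

Lemma exp_tail (a : R) : intw (fun z => expR (a * z)) ->
  Ew (fun z => (n%:R <= z)%R%:R * expR (a * z)) @[n --> \oo] --> 0.
Proof.
move=> ia; rewrite -(Ew_cst W 0); apply: (Ew_dcvg ia).
- move=> n; apply: measurable_funM.
    by case: (@bmeas_ind (fun z => n%:R <= z)) => //; exact: measurable_fun_ler.
  by apply: measurableT_comp => //; exact: measurable_funM.
- by move=> n z; apply: norm_indM_le; exact: expR_ge0.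
- move=> z; apply: cvg_near_cst; near=> n.
  rewrite leNgt (_ : (z < n%:R)%R)//= ?mul0r//.
  near: n; exists (Num.truncn `|z|).+1 => // n /= nz.
  apply: (le_lt_trans (ler_norm z)); apply: (lt_le_trans (truncnS_gt _)).
  by rewrite ler_nat.
Unshelve. all: by end_near. Qed.

(* [h] is a supersolution: the term [- expR (- a * u)] has negative generator
   because [1 < mgf a], and this pays for the overshoots from small [u]. *)
Lemma overshoot (a : R) : 0 < a -> intw (fun z => expR (a * z)) -> 1 < mgf a ->
  exists2 A : R, 0 < A & forall (M : R) n (u : R), 0 <= M -> 0 < u ->
    iter n L (fun v => (v < - M)%R%:R) u <= A * expR (- (a * M)).
Proof.
move=> a0 ia ma.
pose T n (z : R) : R := (n%:R <= z)%R%:R * expR (a * z).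
(* Jumps of size at least [N] are charged to the gain [mgf a - 1]. A smaller jump [z] from [v > 0]
   has [expR (a * (z - v)) <= expR (a * N)], whence the value of [A], twice the latter. *)
have [N hN] : exists N : nat, 2 * Ew (T N) <= mgf a - 1.
  have e0 : 0 < (mgf a - 1) / 2 by rewrite divr_gt0// subr_gt0.
  have /cvgrPdist_le /(_ _ e0) [N _ /(_ N (leqnn N))] := exp_tail ia.
  rewrite sub0r normrN => h; exists N; rewrite mulrC -ler_pdivlMr//.
  exact: (le_trans (ler_norm _)).
have T0 z : 0 <= T N z by rewrite mulr_ge0// expR_ge0.
have iT : intw (T N).
  apply: (intw_le W _ ia).
    apply: measurable_funM.
      by case: (@bmeas_ind (fun z => N%:R <= z)) => //; exact: measurable_fun_ler.
    by apply: measurableT_comp => //; exact: measurable_funM.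
  by move=> z; apply: norm_indM_le; exact: expR_ge0.
pose A := 2 * expR (a * N%:R).
have A0 : 0 < A by rewrite mulr_gt0// expR_gt0.
exists A => // M n u M0 u0.
pose k := expR (- (a * M)).
have k0 : 0 < k by exact: expR_gt0.
pose h (v : R) : R := if v <= 0 then (v < - M)%R%:R else k * (A - expR (- a * v)).
have bf : bmeas (fun v : R => (v < - M)%R%:R : R).
  by apply: bmeas_ind; exact: measurable_fun_ltr.
have A2 (v : R) : 0 < v -> expR (- a * v) <= A.
  move=> v0; apply: (@le_trans _ _ 1).
    by rewrite -expR0 ler_expR mulNr oppr_le0 mulr_ge0// ltW.
  have : 1 <= expR (a * N%:R) by rewrite -expR0 ler_expR mulr_ge0// ltW.
  by rewrite /A; lra.
suff H m (v : R) : iter m L (fun v => (v < - M)%R%:R) v <= h v.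
  apply: (le_trans (H n u)); rewrite /h ifN -?ltNge//.
  by rewrite [leRHS]mulrC -/k ler_pM2l// gerBl expR_ge0.
elim: m v => [|m ih] v.
  rewrite /h /=; case: ifPn => //; rewrite -ltNge => v0.
  case: ltP => [vM|_]; last by rewrite mulr_ge0 ?subr_ge0 ?A2// ltW.
  by have := lt_trans v0 vM; rewrite oppr_gt0 ltNge M0.
rewrite /= {1}/killop; case: ifPn => v0.
  by rewrite iterL_le0// /h v0.
rewrite {1}/h (negbTE v0); rewrite -ltNge in v0.
have iR : intw (fun z => (A - expR (- a * v) * expR (a * z)) +
    2 * expR (- a * v) * T N z).
  apply: intwD; [apply: intwB|]; [exact: (intw_cst W)|exact: intwZ|exact: intwZ].
apply: (@le_trans _ _ (Ew (fun z => k * ((A - expR (- a * v) * expR (a * z)) +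
    2 * expR (- a * v) * T N z)))).
  apply: (le_Ew W).
  - exact/(intw_bmeas W)/bmeas_refl/bmeas_iterL.
  - exact: intwZ.
  - move=> z; apply: (le_trans (ih _)).
    have e : expR (- a * (v - z)) = expR (- a * v) * expR (a * z).
      by rewrite -expRD; congr expR; ring.
    rewrite /h e; case: ifPn => vz; last first.
      by rewrite ler_pM2l// lerDl mulr_ge0// mulr_ge0// expR_ge0.
    apply: (@le_trans _ _ (k * (expR (- a * v) * expR (a * z)))).
      case: ltP => vM; last by rewrite !mulr_ge0// ?expR_ge0// ltW.
      by rewrite -e -expRD -expR0 ler_expR; nra.
    rewrite ler_pM2l// -lerBlDl opprB addrC addrAC -lerBrDr opprK.
    rewrite /T; case: (leP N%:R z) => zN; first by rewrite mulr1n; lra.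
    rewrite mul0r mulr0 add0r /A mulr_natl mulr2n lerD// -expRD ler_expR; nra.
rewrite EwZ// EwD//; [|by apply: intwB; [exact: (intw_cst W)|exact: intwZ]|exact: intwZ].
rewrite EwB//; [|exact: (intw_cst W)|exact: intwZ].
rewrite Ew_cst// !EwZ// ler_pM2l// -/(mgf a).
have := expR_gt0 (- a * v); nra.
Qed.

End Kernel.

(** * The Cramer-Lundberg function *)

Section LundbergFunction.
Context (R : realType) (mu : probability R R) (w : R -> R).
Hypothesis W : weight mu w.
Notation Ew := (Ew mu w).
Notation K := (stepop mu w).
Notation L := (killop mu w).
Notation intw := (intw mu w).
Notation mgf := (mgf mu w).

Variable l : R.
Hypothesis l0 : 0 < l.

(** After tilting by [l], landing at [u <= 0] counts for [expR (l * u)], the discount of the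
    overshoot. [cramern n] is the expected discount collected within [n] steps; its limit governs
    the Cramer-Lundberg asymptotics. *)
Definition cramer0 (u : R) : R := (u <= 0)%R%:R * expR (l * u).
Definition cramern n := iter n L cramer0.
Definition cramer (u : R) : R := lim (cramern n u @[n --> \oo]).
Local Notation G := cramern.
Local Notation g := cramer.

Lemma cramer0_itv u : 0 <= cramer0 u <= 1.
Proof.
rewrite /cramer0; case: (leP u 0) => u0; last by rewrite mul0r lexx ler01.
by rewrite mul1r expR_ge0/= -expR0 ler_expR mulr_ge0_le0// ltW.
Qed.

Lemma bmeas_cramer0 : bmeas cramer0.
Proof.
split.
  apply: measurable_funM; first by case: (@bmeas_le0 R).
  by apply: measurableT_comp => //; exact: measurable_funM.
by exists 1 => u; have /andP[? ?] := cramer0_itv u; rewrite ger0_norm.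
Qed.

Lemma bmeas_cramern n : bmeas (G n).
Proof. by apply: (bmeas_iterL W); exact: bmeas_cramer0. Qed.

Lemma cramern_itv n u : 0 <= G n u <= 1.
Proof. by apply: (iterL_itv W) => //; [exact: bmeas_cramer0|exact: cramer0_itv]. Qed.

Lemma cramern_le0 n u : u <= 0 -> G n u = expR (l * u).
Proof. by move=> u0; rewrite /cramern iterL_le0// /cramer0 u0 mul1r. Qed.

Lemma cramern_nd n u : G n u <= G n.+1 u.
Proof.
elim: n u => [|n ih] u.
  rewrite /cramern /= /killop; case: ifPn => // u0.
  rewrite /cramer0 (negbTE u0) mul0r; apply: (K_ge0 W) => z.
  by have /andP[] := cramer0_itv z.
exact: (@le_L _ _ _ W (G n) (G n.+1) u (bmeas_cramern n) (bmeas_cramern n.+1) ih).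
Qed.

Lemma cramer_cvg u : G n u @[n --> \oo] --> g u.
Proof.
apply: nondecreasing_is_cvgn; first by apply/nondecreasing_seqP => n; exact: cramern_nd.
by exists 1 => _ [n _ <-]; have /andP[] := cramern_itv n u.
Qed.

Lemma cramern_le n u : G n u <= g u.
Proof.
apply: (nondecreasing_cvgn_le (u_ := fun n => G n u)); last exact: cramer_cvg.
by apply/nondecreasing_seqP => m; exact: cramern_nd.
Qed.

Lemma cramer_itv u : 0 <= g u <= 1.
Proof.
apply/andP; split.
  by apply: limr_ge; [exact: cramer_cvg|apply: nearW => n; have /andP[] := cramern_itv n u].
by apply: limr_le; [exact: cramer_cvg|apply: nearW => n; have /andP[] := cramern_itv n u].
Qed.

Lemma bmeas_cramer : bmeas g.
Proof.
split; last by exists 1 => u; have /andP[? ?] := cramer_itv u; rewrite ger0_norm.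
apply: (@measurable_fun_cvg _ _ _ setT (fun n => G n)) => //.
  by move=> n; case: (bmeas_cramern n).
by move=> u _; exact: cramer_cvg.
Qed.

Lemma cramer_harmonic u : 0 < u -> K g u = g u.
Proof.
move=> u0; apply: (@cvg_unique _ _ (K (G n) u @[n --> \oo])) => //.
  apply: (K_dcvg W (C := 1)).
  - by move=> n; case: (bmeas_cramern n).
  - by move=> n z; have /andP[? ?] := cramern_itv n z; rewrite ger0_norm.
  - by move=> z; exact: cramer_cvg.
rewrite (_ : (fun n => _) = (fun n => G n.+1 u)).
  by have := @cramer_cvg u; rewrite -(cvg_shiftS (fun n => G n u)).
by apply/funext => n; rewrite /cramern /= {2}/killop leNgt u0.
Qed.

(** Translation commutes with a step; the case [u <= 0 < u + a] is absorbed by [G <= 1]. This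
    one-sided modulus of continuity is all the regularity used later: [g] may still jump down. *)
Lemma cramern_shift n (u a : R) : 0 <= a -> G n (u + a) <= expR (l * a) * G n u.
Proof.
move=> a0; elim: n u => [|n ih] u.
  rewrite /cramern /= /cramer0; case: (leP u 0) => u0.
    case: (leP (u + a) 0) => ua; last by rewrite mul0r mulr_ge0// ?mulr_ge0// expR_ge0.
    by rewrite !mul1r -expRD ler_expR; lra.
  by rewrite (leNgt (u + a)) (ltr_wpDr a0 u0)/= !mul0r mulr0.
case: (leP u 0) => u0.
  rewrite (cramern_le0 _ u0) -expRD.
  case: (leP (u + a) 0) => ua; first by rewrite cramern_le0// ler_expR; lra.
  apply: (@le_trans _ _ 1); first by have /andP[] := cramern_itv n.+1 (u + a).
  by rewrite -expR0 ler_expR -mulrDr mulr_ge0 ?ltW// addrC.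
rewrite /cramern /= /killop !ifN -?ltNge ?ltr_wpDr// -(KZ W); last exact: bmeas_cramern.
rewrite /stepop; apply: (le_Ew W).
- exact/(intw_bmeas W)/bmeas_refl/bmeas_cramern.
- exact/(intw_bmeas W)/bmeasZ/bmeas_refl/bmeas_cramern.
- by move=> z; rewrite addrAC; exact: ih.
Qed.

Lemma cramer_shift (u a : R) : 0 <= a -> g (u + a) <= expR (l * a) * g u.
Proof.
move=> a0; apply: (@ler_cvg_to _ \oo _ _ (fun n => G n (u + a)) (fun n => expR (l * a) * G n u)).
- exact: cramer_cvg.
- by apply: cvgMl_tmp; exact: cramer_cvg.
- by apply: nearW => n; exact: cramern_shift.
Qed.

(** Strong Markov property at the first passage below [H]: until it is frozen, the shifted walk
    stays where [g] is harmonic. *)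
Lemma iterL_cramer n (H u : R) : 0 <= H -> iter n L (fun v => g (H + v)) u = g (H + u).
Proof.
move=> H0; elim: n u => //= n ih u; rewrite (funext ih) /killop.
case: (leP u 0) => // u0; rewrite -[RHS]cramer_harmonic ?ltr_wpDl//.
by apply: eq_Rintegral => z _; rewrite addrA.
Qed.

Variables a b : R.
Hypotheses (b0 : 0 < b) (ib : intw (fun z => expR (- b * z))) (mb : mgf (- b) < 1).
Hypotheses (a0 : 0 < a) (ia : intw (fun z => expR (a * z))) (ma : 1 < mgf a).

Lemma escape_cvg (u : R) : iter n L (fun v => (0 < v)%R%:R) u @[n --> \oo] --> 0.
Proof.
apply: (@squeeze_cvgr _ _ _ _ (fun=> 0) (fun n => mgf (- b) ^+ n * expR (b * u))).
- apply: nearW => n; rewrite (escape W) ?(ltW b0)// andbT.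
  have bl : bmeas (fun v : R => (0 < v)%R%:R : R).
    by apply: bmeas_ind; exact: measurable_fun_ltr.
  have h (z : R) : 0 <= ((0 < z)%R%:R : R) <= 1 by case: (ltP 0 z); rewrite ler01 lexx.
  by have /andP[] := iterL_itv W n u bl h.
- exact: cvg_cst.
- rewrite -(mul0r (expR (b * u))); apply: cvgMr_tmp; apply: cvg_expr.
  by rewrite ger0_norm ?(mgf_ge0 W).
Qed.

(** Three exclusive cases: still above 0, landed more than [M] below 0, landed in the window. The
    overshoot term is uniform in [u] and [n]. *)
Lemma hit_window : exists2 A : R, 0 < A & forall (M u : R), 0 <= M -> 0 < u ->
  forall n, 1 - iter n L (fun v => (0 < v)%R%:R) u - A * expR (- (a * M)) <=
    iter n L (fun v => (- M <= v <= 0)%R%:R) u.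
Proof.
have [A A0 hA] := overshoot W a0 ia ma; exists A => // M u M0 u0 n.
have b1 : bmeas (fun v : R => (0 < v)%R%:R : R).
  by apply: bmeas_ind; exact: measurable_fun_ltr.
have b2 : bmeas (fun v : R => (v < - M)%R%:R : R).
  by apply: bmeas_ind; exact: measurable_fun_ltr.
have b3 : bmeas (fun v : R => (- M <= v <= 0)%R%:R : R).
  by apply: bmeas_ind; apply: measurable_and; exact: measurable_fun_ler.
have : 1 <= iter n L (fun v => (0 < v)%R%:R) u + iter n L (fun v => (v < - M)%R%:R) u
    + iter n L (fun v => (- M <= v <= 0)%R%:R) u.
  rewrite -!(iterLD W)//; last exact: bmeasD.
  rewrite -[leLHS](iterL_cst W n 1 u); apply: (le_iterL W) => //.
  - exact: bmeas_cst.
  - by apply: bmeasD => //; exact: bmeasD.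
  - by move=> z; case: (ltP 0 z); case: (ltP z (- M)) => /=; rewrite ?mulr0n ?addr0 ?add0r// => *; rewrite lerDl.
have := hA M n u M0 u0; lra.
Qed.

(** In the limit of many steps the walk lands within [M] of 0 with probability at least 1/2, where
    the discount is at least [expR (- (l * M))]. *)
Lemma cramer_lb : exists2 c : R, 0 < c & forall u, 0 < u -> c <= g u.
Proof.
have [A A0 hA] := hit_window.
pose M : R := Num.max 0 (ln (2 * A) / a).
have M0 : 0 <= M by rewrite le_max lexx.
have hM : A * expR (- (a * M)) <= 1 / 2.
  have : 2 * A <= expR (a * M).
    apply: (@le_trans _ _ (expR (ln (2 * A)))); first by rewrite lnK// posrE mulr_gt0.
    by rewrite ler_expR [leRHS]mulrC -ler_pdivrMr// le_max lexx orbT.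
  rewrite expRN => h; rewrite ler_pdivrMr ?expR_gt0//; lra.
exists (expR (- (l * M)) * (1 / 2)); first by rewrite mulr_gt0 ?expR_gt0.
move=> u u0.
have b3 : bmeas (fun v : R => (- M <= v <= 0)%R%:R : R).
  by apply: bmeas_ind; apply: measurable_and; exact: measurable_fun_ler.
have h n : expR (- (l * M)) * (1 / 2 - iter n L (fun v => (0 < v)%R%:R) u) <= g u.
  apply: (le_trans _ (cramern_le n u)).
  apply: (@le_trans _ _ (expR (- (l * M)) * iter n L (fun v => (- M <= v <= 0)%R%:R) u)).
    by rewrite ler_pM2l ?expR_gt0//; have := hA M u M0 u0 n; lra.
  rewrite -(iterLZ W)//; apply: (le_iterL W); [exact: bmeasZ|exact: bmeas_cramer0|].
  move=> z; rewrite /cramer0; case: (leP z 0) => z0; last by rewrite andbF mulr0 mul0r.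
  rewrite andbT mul1r; case: (leP (- M) z) => zM; last by rewrite mulr0 expR_ge0.
  by rewrite mulr1 ler_expR -mulrN ler_pM2l.
apply: (@ler_cvg_to _ \oo _ _ (fun n => expR (- (l * M)) * (1 / 2 - iter n L (fun v => (0 < v)%R%:R) u)) (fun=> g u)).
- have -> : expR (- (l * M)) * (1 / 2) = expR (- (l * M)) * (1 / 2 - 0) by rewrite subr0.
  apply: cvgMl_tmp; apply: cvgB; first exact: cvg_cst.
  exact: escape_cvg.
- exact: cvg_cst.
- exact: nearW.
Qed.

(** The energy density (carre du champ) of [g]: where [g] is harmonic it equals
    [K (g ^+ 2) - g ^+ 2], whose iterates telescope. *)
Definition increment2 (u : R) : R := Ew (fun z => (g (u - z) - g u) ^+ 2).
Local Notation Gam := increment2.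

Definition defect (u : R) : R := (u <= 0)%R%:R.

Lemma bmeas_defect : bmeas defect. Proof. exact: bmeas_le0. Qed.

Lemma defect_exp u : defect u <= 1 * expR (- a * u).
Proof.
rewrite /defect mul1r; case: (leP u 0) => u0; last exact: expR_ge0.
by rewrite -expR0 ler_expR mulNr -mulrN mulr_ge0 ?oppr_ge0// ltW.
Qed.

Lemma norm_subK_cramer u : `|g u - K g u| <= defect u.
Proof.
rewrite /defect; case: (leP u 0) => u0; last by rewrite cramer_harmonic// subrr normr0.
have /andP[g0 g1] := cramer_itv u.
have /andP[k0 k1] : 0 <= iter 1 K g u <= 1.
  by apply: (iterK_itv W); [exact: bmeas_cramer|exact: cramer_itv].
by rewrite ler_norml mulr1n /=; apply/andP; split; rewrite /= in k0 k1; lra.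
Qed.

Lemma increment2E u : Gam u = K (fun v => g v ^+ 2) u - g u ^+ 2 + 2 * g u * (g u - K g u).
Proof.
have bg := bmeas_cramer.
rewrite /increment2 (_ : (fun z => _) =
  (fun z => (g (u - z) ^+ 2 - 2 * g u * g (u - z)) + g u ^+ 2)); last first.
  by apply/funext => z; ring.
have i1 : intw (fun z => g (u - z)) by exact/(intw_bmeas W)/bmeas_refl.
have i2 : intw (fun z => g (u - z) ^+ 2).
  by apply: (intw_bmeas W); exact: (bmeas_refl u (bmeasX 2 bg)).
rewrite EwD//; [|by apply: intwB => //; exact: intwZ|exact: (intw_cst W)].
rewrite EwB//; last exact: intwZ.
by rewrite EwZ// (Ew_cst W) /stepop; ring.
Qed.

Lemma bmeas_increment2 : bmeas Gam.
Proof.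
have bg := bmeas_cramer; rewrite (funext increment2E).
apply: bmeasD; first by apply: bmeasB; [apply: (bmeas_K W)|]; exact: bmeasX.
apply: bmeasM; first exact: bmeasZ.
by apply: bmeasB => //; exact: (bmeas_K W).
Qed.

Lemma increment2_le u : Gam u <= K (fun v => g v ^+ 2) u - g u ^+ 2 + 2 * defect u.
Proof.
rewrite increment2E lerD2l -mulrA ler_pM2l//.
have := norm_subK_cramer u; have /andP[g0 g1] := cramer_itv u => h.
apply: (le_trans (ler_norm _)); rewrite normrM (ger0_norm g0).
by rewrite -[leRHS]mul1r ler_pM.
Qed.

(* Jensen, after exchanging the two independent steps *)
Lemma increment2_K u : Gam u <= K Gam u + 2 * (K defect u + defect u).
Proof.
have bg := bmeas_cramer.
have bd := bmeas_defect.
pose F (p : R * R) := (g (u - p.1 - p.2) - g (u - p.1)) ^+ 2.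
have mF : measurable_fun setT F.
  have m1 : measurable_fun setT (fun p : R * R => g (u - p.1)).
    by apply: (measurableT_comp bg.1); exact: measurable_funB.
  have m2 : measurable_fun setT (fun p : R * R => g (u - p.1 - p.2)).
    apply: (measurableT_comp bg.1); apply: measurable_funB => //.
    exact: measurable_funB.
  by apply: measurable_funX; exact: measurable_funB.
have FC p : `|F p| <= 1.
  rewrite /F ger0_norm ?sqr_ge0//.
  have /andP[? ?] := cramer_itv (u - p.1 - p.2).
  have /andP[? ?] := cramer_itv (u - p.1); nra.
have -> : K Gam u = Ew (fun z => Ew (fun y => F (y, z))).
  exact: (Ew_swap W mF FC).
have i1 : intw (fun z => defect (u - z) + defect u).
  by apply/(intw_bmeas W)/bmeasD; [exact: bmeas_refl|exact: bmeas_cst].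
have i2 : intw (fun z => Ew (fun y => F (y, z))).
  apply: (intw_bmeas W); apply: (bmeas_Ew W (F := fun p => F (p.2, p.1)) (C := 1)) => //.
  by apply: (measurableT_comp mF); apply: measurable_fun_pair.
have -> : K defect u + defect u = Ew (fun z => defect (u - z) + defect u).
  rewrite EwD ?(Ew_cst W)//; [exact/(intw_bmeas W)/bmeas_refl|exact: (intw_cst W)].
rewrite -EwZ// -EwD//; last exact: intwZ.
apply: (le_Ew W).
- by apply/(intw_bmeas W)/bmeasX/bmeasB; [exact: bmeas_refl|exact: bmeas_cst].
- by apply: intwD => //; exact: intwZ.
move=> z.
have ig v : intw (fun y => g (v - y)) by exact/(intw_bmeas W)/bmeas_refl.
have sq : (K g (u - z) - K g u) ^+ 2 <= Ew (fun y => F (y, z)).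
  have -> : K g (u - z) - K g u = Ew (fun y => g (u - y - z) - g (u - y)).
    by rewrite /stepop -EwB//; apply: eq_Rintegral => y _; rewrite addrAC.
  apply: (sqr_Ew_le W); apply: bmeasB; last exact: bmeas_refl.
  by under [fun _ => _]funext do rewrite addrAC; exact: bmeas_refl.
apply: (le_trans _ (lerD sq (lexx _))).
have h1 := norm_subK_cramer u; have h2 := norm_subK_cramer (u - z).
have := cramer_itv u; have := cramer_itv (u - z).
move: h1 h2; rewrite !ler_norml.
move: (g u) (g (u - z)) (K g u) (K g (u - z)) (defect u) (defect (u - z)).
move=> x y x' y' p q /andP[? ?] /andP[? ?] /andP[? ?] /andP[? ?].
have ? : 0 <= (p + q - (y - y' - (x - x'))) * (1 + (y - x)) by apply: mulr_ge0; lra.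
have ? : 0 <= (p + q + (y - y' - (x - x'))) * (1 - (y - x)) by apply: mulr_ge0; lra.
have ? := sqr_ge0 (y - y' - (x - x')).
nra.
Qed.

(** The energy density is subharmonic up to [defect], itself below [expR (- a * u)], an exponential
    that each step multiplies by [mgf a]. For fixed [n] the total error is thus negligible far from
    0. *)
Lemma increment2_iterK n : exists C : R, forall u,
  Gam u <= iter n K Gam u + C * expR (- a * u).
Proof.
have bG := bmeas_increment2; have bd := bmeas_defect.
have ia' : intw (fun z => expR (- - a * z)) by rewrite opprK.
elim: n => [|n [C ih]].
  by exists 0 => u; rewrite mul0r addr0.
pose s u := 2 * (K defect u + defect u).
have bs : bmeas s by apply/bmeasZ/bmeasD => //; exact: (bmeas_K W).
have hs u : s u <= 2 * (mgf a + 1) * expR (- a * u).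
  rewrite /s -mulrA ler_pM2l// mulrDl; apply: lerD; last exact: defect_exp.
  have := K_le_exp W u bd ia' defect_exp; rewrite opprK mul1r; exact.
exists (C + 2 * (mgf a + 1) * mgf a ^+ n) => u.
have := iterK_le_exp W n u bs ia' hs; rewrite opprK => h.
have h2 : iter n K Gam u <= iter n.+1 K Gam u + iter n K s u.
  rewrite iterSr -(iterKD W)//; last exact: (bmeas_K W).
  by apply: (le_iterK W) => //; [apply: bmeasD => //; exact: (bmeas_K W)|exact: increment2_K].
have := ih u; lra.
Qed.

(** Summing the energy over [n] steps telescopes to [K^n (g ^+ 2) - g ^+ 2], while subharmonicity
    bounds each term below by the energy at [u]. *)
Lemma increment2_sum n : exists C : R, forall u,
  n%:R * Gam u <= iter n K (fun v => g v ^+ 2) u - g u ^+ 2 + C * expR (- a * u).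
Proof.
have bG := bmeas_increment2; have bd := bmeas_defect; have bg2 := bmeasX 2 bmeas_cramer.
have ia' : intw (fun z => expR (- - a * z)) by rewrite opprK.
elim: n => [|n [C ih]]; first by exists 0 => u; rewrite !mul0r addr0 subrr.
have [D hD] := increment2_iterK n.
exists (C + D + 2 * mgf a ^+ n) => u.
have := ih u; have := hD u.
have h : iter n K Gam u <= iter n.+1 K (fun v => g v ^+ 2) u - iter n K (fun v => g v ^+ 2) u
    + 2 * (mgf a ^+ n * expR (- a * u)).
  have hd := iterK_le_exp W n u bd ia' defect_exp; rewrite opprK mul1r in hd.
  apply: (@le_trans _ _ (iter n K (fun v => (K (fun v => g v ^+ 2) v + (- 1) * g v ^+ 2) + 2 * defect v) u)).
    apply: (le_iterK W) => //.
      by apply: bmeasD; [apply: bmeasD; [exact: (bmeas_K W)|exact: bmeasZ]|exact: bmeasZ].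
    by move=> z; rewrite mulN1r; exact: increment2_le.
  rewrite !(iterKD W) ?(iterKZ W)//; try exact: bmeasZ; try exact: (bmeas_K W).
    by rewrite -iterSr mulN1r lerD2l ler_pM2l.
  by apply: bmeasD; [exact: (bmeas_K W)|exact: bmeasZ].
rewrite -natr1 !mulrDl mul1r; lra.
Qed.

Lemma increment2_cvg0 (eps : R) : 0 < eps -> exists U : R, forall u, U <= u -> Gam u <= eps.
Proof.
move=> e0.
(* The 2 is a total energy of at most 1 plus a boundary error of at most 1 once [u >= |C| / a]. *)
pose n := (Num.truncn (2 / eps)).+1.
have n0 : (0 : R) < n%:R by rewrite ltr0n.
have hn : 2 <= n%:R * eps by rewrite -ler_pdivrMr// ltW// truncnS_gt.
have [C hC] := increment2_sum n.
exists (`|C| / a) => u hu.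
rewrite -(ler_pM2l n0); apply: le_trans hn; apply: (le_trans (hC u)).
have : iter n K (fun v => g v ^+ 2) u <= 1.
  have h z : 0 <= g z ^+ 2 <= 1.
    by have /andP[z0 z1] := cramer_itv z; rewrite sqr_ge0/= expr_le1.
  by have /andP[] := iterK_itv W n u (bmeasX 2 bmeas_cramer) h.
have : C * expR (- a * u) <= 1.
  apply: (@le_trans _ _ (`|C| * expR (- a * u))).
    by rewrite ler_pM2r ?expR_gt0// ler_norm.
  rewrite mulNr expRN ler_pdivrMr ?expR_gt0// mul1r.
  apply: (le_trans _ (expR_ge1Dx _)); rewrite mulrC.
  by move: hu; rewrite ler_pdivrMr// => hu; lra.
have := sqr_ge0 (g u); lra.
Qed.

End LundbergFunction.

(** * Slow variation and decorrelation *)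

Section Mass.
Context (R : realType) (mu : probability R R) (w : R -> R).
Hypothesis W : weight mu w.
Notation Ew := (Ew mu w).

Lemma intw_indic (A : set R) : measurable A -> intw mu w (\1_A).
Proof. by move=> mA; apply: (intw_bmeas W); exact: bmeas_indic. Qed.

(** The density is positive everywhere, so a zero integral would force [f] to vanish [mu]-almost
    everywhere. *)
Lemma Ew_gt0 (A : set R) f : measurable A -> (0 < mu A)%E -> intw mu w f ->
  (forall z, 0 <= f z) -> (forall z, A z -> 0 < f z) -> 0 < Ew f.
Proof.
move=> mA muA fi f0 fA; have [w0 mw _ _] := W.
rewrite lt_neqAle (Ew_ge0 W)// andbT; apply/eqP => e.
have h : (\int[mu]_z `|(f z * w z)%:E|)%E = 0%E.
  under eq_integral => z _ do rewrite gee0_abs ?lee_fin ?mulr_ge0 ?f0 ?(ltW (w0 z))//.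
  rewrite -[LHS]fineK; last exact: (integrable_fin_num _ fi).
  by congr EFin; rewrite -[RHS]/0 e.
have mf := measurable_int _ fi.
have [N [mN N0 sub]] := (ae_eq_integral_abs _ measurableT mf).1 h.
have : (mu A <= mu N)%E.
  apply: le_measure; rewrite ?inE// => z Az; apply: sub => /=.
  by move=> /(_ I) [] /eqP; rewrite gt_eqF// mulr_gt0// fA.
by rewrite [X in (_ <= X)%E -> _]N0 leNgt muA.
Qed.

Lemma Ew_indic_gt0 (A : set R) : measurable A -> (0 < mu A)%E -> 0 < Ew \1_A.
Proof.
move=> mA muA; apply: (Ew_gt0 mA muA (intw_indic mA)) => z; rewrite indicE//.
by move=> Az; rewrite mem_set.
Qed.

Lemma eq_Ew_ae (C : set R) f h : measurable C -> mu (~` C) = 0%E ->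
  bmeas f -> bmeas h -> (forall z, C z -> f z = h z) -> Ew f = Ew h.
Proof.
move=> mC C0 bf bh fh; congr fine; apply: ae_eq_integral => //.
- exact: (measurable_int _ (intw_bmeas W bf)).
- exact: (measurable_int _ (intw_bmeas W bh)).
exists (~` C); split => //; first exact: measurableC.
by move=> z /= nfh Cz; apply: nfh => _; rewrite fh.
Qed.

Definition msupport : set R :=
  [set s | forall e : R, 0 < e -> (0 < mu `](s - e)%R, (s + e)%R[%classic)%E].

(** Every point outside the support lies in a null interval with rational endpoints, and these are
    countably many. *)
Lemma negligible_support : mu.-negligible (~` msupport).
Proof.
pose J (p : rat * rat) : set R := `]ratr p.1, ratr p.2[%classic.
pose F n : set R := if unpickle n is Some p then
  if mu (J p) == 0%E then J p else set0 else set0.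
have : mu.-negligible (\bigcup_k F k).
  apply: negligible_bigcup => k; rewrite /F.
  case: (unpickle k) => [p|]; last exact: negligible_set0.
  by case: eqP => h; [apply/negligibleP => //; exact: measurable_itv|exact: negligible_set0].
apply: negligibleS => s /= /existsNP[e] /not_implyP[e0 /negP].
rewrite -leNgt => me.
have [|p] := @rat_in_itvoo R (s - e) s; first by lra.
rewrite in_itv/= => /andP[p1 p2].
have [|q] := @rat_in_itvoo R s (s + e); first by lra.
rewrite in_itv/= => /andP[q1 q2].
exists (pickle (p, q)); first exact: I.
rewrite /F pickleK.
have h : mu (J (p, q)) = 0%E.
  apply/eqP; rewrite -measure_le0; apply: le_trans me; apply: le_measure.
  - by rewrite inE; exact: measurable_itv.
  - by rewrite inE; exact: measurable_itv.
  - by move=> z; rewrite /J /= !in_itv/= => /andP[z1 z2]; apply/andP; split; lra.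
by rewrite h eqxx /J /= in_itv/= p2 q1.
Qed.

End Mass.

(** * Almost-periods and slow variation *)

Section SlowVariation.
Context (R : realType) (mu : probability R R) (w : R -> R).
Hypothesis W : weight mu w.
Notation Ew := (Ew mu w).
Notation msupport := (msupport mu).
Variables (g : R -> R) (l : R).
Hypotheses (l0 : 0 < l) (bg : bmeas g) (g_itv : forall u, 0 <= g u <= 1).
Hypothesis g_shift : forall u a : R, 0 <= a -> g (u + a) <= expR (l * a) * g u.
Hypothesis g_inc : forall eps : R, 0 < eps ->
  exists U : R, forall u, U <= u -> Ew (fun z => (g (u - z) - g u) ^+ 2) <= eps.

Lemma small_shift (e : R) : 0 < e ->
  exists2 r : R, 0 < r & forall u a, 0 <= a -> a <= r -> g (u + a) <= g u + e.
Proof.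
move=> e0; exists (ln (1 + e) / l); first by rewrite divr_gt0// ln_gt0; lra.
move=> u a a0 ar; apply: (le_trans (g_shift u a0)).
have h : expR (l * a) <= 1 + e.
  rewrite -[leRHS]lnK ?posrE; last by lra.
  by rewrite ler_expR mulrC -ler_pdivlMr.
have /andP[? ?] := g_itv u.
have : expR (l * a) * g u <= (1 + e) * g u by rewrite ler_wpM2r.
nra.
Qed.

(** Chebyshev: if all jumps near [s] moved [g] by more than [e], the mean square increment would be
    at least [e ^+ 2] times the positive mass near [s]. *)
Lemma support_step s (h e : R) : msupport s -> 0 < h -> 0 < e ->
  exists U : R, forall u, U <= u ->
    exists2 s', `|s' - s| < h & `|g (u - s') - g u| <= e.
Proof.
move=> Ss h0 e0; pose I : set R := `]s - h, s + h[%classic.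
have mI : measurable I by exact: measurable_itv.
have m0 : 0 < Ew \1_I by apply: (Ew_indic_gt0 W) => //; exact: Ss.
have [|U hU] := @g_inc (e ^+ 2 * Ew \1_I / 2) _.
  by rewrite divr_gt0// mulr_gt0// exprn_gt0.
exists U => u uU; apply: contrapT => hn.
have : e ^+ 2 * Ew \1_I <= e ^+ 2 * Ew \1_I / 2.
  apply: le_trans (hU u uU); rewrite -EwZ; last exact: intw_indic.
  apply: (le_Ew W).
  - by apply: intwZ; exact: intw_indic.
  - by apply: (intw_bmeas W); apply/bmeasX/bmeasB; [exact: bmeas_refl|exact: bmeas_cst].
  - move=> z; rewrite indicE; case: (boolP (z \in I)) => zI; last by rewrite mulr0 sqr_ge0.
    rewrite mulr1 -[leRHS](real_normK (num_real _)) lerXn2r ?nnegrE ?(ltW e0)//.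
    rewrite leNgt; apply/negP => lt; apply: hn; exists z; last exact: ltW.
    by move: zI; rewrite inE /I /= in_itv/= ltr_norml => /andP[? ?]; apply/andP; split; lra.
have : 0 < e ^+ 2 * Ew \1_I by rewrite mulr_gt0// exprn_gt0.
lra.
Qed.

(* One-sided almost-periods of [g]: the positive slack [h] absorbs the fact that a
   point of the support is only approximated by jumps, and that [g] may jump down. *)
Definition blur (t : R) := forall e : R, 0 < e -> exists h, [/\ 0 < h, h < e &
  exists U : R, forall u, U <= u -> g (u + t + h) <= g u + e].

Lemma blurD t1 t2 : blur t1 -> blur t2 -> blur (t1 + t2).
Proof.
move=> b1 b2 e e0; have e2 : 0 < e / 2 by lra.
have [h1 [p1 q1 [U1 H1]]] := b1 _ e2; have [h2 [p2 q2 [U2 H2]]] := b2 _ e2.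
exists (h1 + h2); split; [lra|lra|].
exists (Num.max U2 (U1 - t2 - h2)) => u; rewrite ge_max => /andP[u1 u2].
have := H2 u u1; have := H1 (u + t2 + h2) ltac:(lra).
rewrite (_ : u + t2 + h2 + t1 + h1 = u + (t1 + t2) + (h1 + h2)); last by ring.
lra.
Qed.

(** For [s], a jump [s'] near [s] brings [u + s + h] to a point between [u] and [u + 2 * h], since
    [|s' - s| < h], and [g] rises little over that distance. For [- s], the jump is made from [u]
    and [u - s + h] is reached by a small rise. The quarter in [h] keeps [2 * h] below [r] and [h]
    below [e]. *)
Lemma blur_support s : msupport s -> blur s /\ blur (- s).
Proof.
move=> Ss; split=> e e0.
  have e2 : 0 < e / 2 by lra.
  have [r r0 hr] := small_shift e2.
  pose h := Num.min r e / 4.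
  have [hr4 he4] : h <= r / 4 /\ h <= e / 4.
    by rewrite /h !ler_pM2r ?invr_gt0// !ge_min !lexx orbT.
  have h0 : 0 < h by rewrite divr_gt0// lt_min r0.
  have [U HU] := support_step Ss h0 e2.
  exists h; split; [by []|lra|exists (U - s - h) => u uU].
  have [s'] := HU (u + s + h) ltac:(lra).
  rewrite ltr_norml => /andP[? ?]; rewrite ler_norml => /andP[? ?].
  have := hr u (s - s' + h) ltac:(lra) ltac:(lra).
  rewrite (_ : u + (s - s' + h) = u + s + h - s'); last by ring.
  lra.
have e2 : 0 < e / 2 by lra.
have [r r0 hr] := small_shift e2.
pose h := Num.min r e / 4.
have [hr4 he4] : h <= r / 4 /\ h <= e / 4.
  by rewrite /h !ler_pM2r ?invr_gt0// !ge_min !lexx orbT.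
have h0 : 0 < h by rewrite divr_gt0// lt_min r0.
have [U HU] := support_step Ss h0 e2.
exists h; split; [by []|lra|exists U => u uU].
have [s'] := HU u uU.
rewrite ltr_norml => /andP[? ?]; rewrite ler_norml => /andP[? ?].
have := hr (u - s') (s' - s + h) ltac:(lra) ltac:(lra).
rewrite (_ : u - s' + (s' - s + h) = u - s + h); last by ring.
lra.
Qed.

Definition period (t : R) := blur t /\ blur (- t).

Lemma period0 : period 0.
Proof.
suff b0 : blur 0 by rewrite /period oppr0.
move=> e e0; have [r r0 hr] := small_shift e0.
exists (Num.min r e / 2); have hm : 0 < Num.min r e by rewrite lt_min r0.
have [h1 h2] : Num.min r e <= r /\ Num.min r e <= e by rewrite !ge_min !lexx orbT.
split; [lra|lra|exists 0 => u _; rewrite addr0; apply: hr; lra].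
Qed.

Lemma periodD t1 t2 : period t1 -> period t2 -> period (t1 + t2).
Proof. by move=> [? ?] [? ?]; split; rewrite ?opprD; exact: blurD. Qed.

Lemma periodN t : period t -> period (- t).
Proof. by move=> [? ?]; split; rewrite ?opprK. Qed.

Lemma periodMn t n : period t -> period (n%:R * t).
Proof.
move=> pt; elim: n => [|n ih]; first by rewrite mul0r; exact: period0.
by rewrite -natr1 mulrDl mul1r; exact: periodD.
Qed.

Lemma periodMz t (k : int) : period t -> period (k%:~R * t).
Proof.
move=> pt; case: k => n; first exact: periodMn.
by rewrite NegzE mulrNz mulNr; apply: periodN; exact: periodMn.
Qed.

(** Almost-periods without the slack of [blur], for the lattice case: there [g] need not vary slowly
    between lattice points. *)
Definition exact_period (t : R) := forall e : R, 0 < e ->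
  exists U : R, forall u, U <= u -> `|g (u + t) - g u| <= e.

Lemma exact_periodD t1 t2 : exact_period t1 -> exact_period t2 -> exact_period (t1 + t2).
Proof.
move=> b1 b2 e e0; have e2 : 0 < e / 2 by lra.
have [U1 H1] := b1 _ e2; have [U2 H2] := b2 _ e2.
exists (Num.max U2 (U1 - t2)) => u; rewrite ge_max => /andP[u1 u2].
have := H2 u u1; have := H1 (u + t2) ltac:(lra).
rewrite (_ : u + t2 + t1 = u + (t1 + t2)); last by ring.
by rewrite !ler_norml => /andP[? ?] /andP[? ?]; apply/andP; split; lra.
Qed.

Lemma exact_periodN t : exact_period t -> exact_period (- t).
Proof.
move=> b1 e e0; have [U1 H1] := b1 _ e0.
exists (U1 + t) => u u1; have := H1 (u - t) ltac:(lra).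
by rewrite subrK distrC.
Qed.

Lemma exact_period0 : exact_period 0.
Proof. by move=> e e0; exists 0 => u _; rewrite addr0 subrr normr0 ltW. Qed.

(** The jump of size exactly [s] has positive weight, so Chebyshev applies to it alone. The double
    opposite is there because a jump [s] moves the walk by [- s]. *)
Lemma atom_exact_period s : (0 < mu [set s])%E -> exact_period s.
Proof.
move=> ms; rewrite -[s]opprK; apply: exact_periodN => e e0.
have m0 : 0 < Ew \1_[set s] by exact: (Ew_indic_gt0 W).
have [|U hU] := @g_inc (e ^+ 2 * Ew \1_[set s]) _; first by rewrite mulr_gt0// exprn_gt0.
exists U => u /hU h; rewrite -(@ler_pXn2r _ 2) ?nnegrE ?(ltW e0)// real_normK ?num_real//.
rewrite -(ler_pM2r m0); apply: le_trans h; rewrite -EwZ; last exact: intw_indic.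
apply: (le_Ew W).
- by apply: intwZ; exact: intw_indic.
- by apply: (intw_bmeas W); apply/bmeasX/bmeasB; [exact: bmeas_refl|exact: bmeas_cst].
- move=> z; rewrite indicE; case: (boolP (z \in [set s])) => zI; last by rewrite mulr0 sqr_ge0.
  by move: zI; rewrite inE /= => ->; rewrite mulr1.
Qed.

Lemma finite_eventually (Q : nat -> R -> Prop) :
  (forall i, exists U : R, forall u, U <= u -> Q i u) ->
  forall n, exists U : R, forall u, U <= u -> forall i, (i < n)%N -> Q i u.
Proof.
move=> H; elim=> [|n [U HU]]; first by exists 0.
have [V HV] := H n; exists (Num.max U V) => u; rewrite ge_max => /andP[uU uV] i.
by rewrite ltnS leq_eqVlt => /predU1P[->|]; [exact: HV|exact: HU].
Qed.

(** A multiple of a small period approximates [t] from below and the remainder is a small rise.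
    Doing this for [t] and [- t] gives both inequalities at a fixed [t]; a finite grid then gives
    uniformity. *)
Lemma slow_dense : (forall e : R, 0 < e -> exists2 t, period t & 0 < t < e) ->
  forall e M : R, 0 < e -> exists U : R, forall u, U <= u -> forall t, `|t| <= M ->
    `|g (u + t) - g u| <= e.
Proof.
move=> dense.
have P t (e : R) : 0 < e -> exists U : R, forall u, U <= u -> g (u + t) <= g u + e.
  move=> e0; have e2 : 0 < e / 2 by lra.
  have [r r0 hr] := small_shift e2.
  have [|t1 pt1 /andP[t10 t1r]] := dense (r / 2); first by lra.
  (* One period less than the floor leaves room for the slack [h < t1] below [t]. *)
  pose k := Num.floor (t / t1) - 1.
  have [k1 k2] : k%:~R * t1 <= t - t1 /\ t - 2 * t1 <= k%:~R * t1.
    have := Num.Theory.floor_le (t / t1); have := Num.Theory.floorD1_gt (t / t1).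
    rewrite /k intrB !intrD !mulr1z => a b.
    have {}a : t < ((Num.floor (t / t1))%:~R + 1) * t1 by rewrite -ltr_pdivrMr.
    have {}b : (Num.floor (t / t1))%:~R * t1 <= t by rewrite -ler_pdivlMr.
    by split; lra.
  have [bk _] := periodMz k pt1.
  have [|h [h0 he [U HU]]] := bk (Num.min (e / 2) t1); first by rewrite lt_min e2.
  move: he; rewrite lt_min => /andP[he ht].
  exists U => u /HU hu.
  have := hr (u + k%:~R * t1 + h) (t - k%:~R * t1 - h) ltac:(lra) ltac:(lra).
  rewrite (_ : u + k%:~R * t1 + h + (t - k%:~R * t1 - h) = u + t); last by ring.
  have := ge_min (e / 2) (e / 2) t1; rewrite lexx => /=.
  lra.
move=> e M e0; have e2 : 0 < e / 2 by lra.
have [r r0 hr] := small_shift e2.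
(* Grid of mesh [r]: since [g] rises by at most [e / 2] over one mesh, its values at the two
   neighbouring grid points bracket [g (u + t)]. *)
pose t_ i : R := - M - r + i%:R * r.
have [] := @finite_eventually (fun i u => `|g (u + t_ i) - g u| <= e / 2) _
  (Num.truncn ((2 * M + 2 * r) / r)).+2.
  move=> i; have [U HU] := P (t_ i) _ e2; have [V HV] := P (- t_ i) _ e2.
  exists (Num.max U (V - t_ i)) => u; rewrite ge_max => /andP[uU uV].
  have := HU u uU; have := HV (u + t_ i) ltac:(lra); rewrite addrK => ? ?.
  by rewrite ler_norml; apply/andP; split; lra.
move=> U HU; exists U => u uU t; rewrite ler_norml => /andP[t1 t2].
pose i := Num.truncn ((t + M + r) / r).
have q0 : 0 <= (t + M + r) / r by rewrite divr_ge0//; lra.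
have [i1 i2] : t_ i <= t /\ t <= t_ i.+1.
  have := Num.Theory.truncn_le ((t + M + r) / r); rewrite q0; have := Num.Theory.truncnS_gt ((t + M + r) / r).
  rewrite -/i ler_pdivlMr// ltr_pdivrMr// /t_ -natr1 => a b.
  by split; lra.
have iN : (i <= Num.truncn ((2 * M + 2 * r) / r))%N.
  by apply: Num.Theory.le_truncn; rewrite ler_pM2r ?invr_gt0//; lra.
have := HU u uU i (leqW iN); have := HU u uU i.+1 iN.
have ei : t_ i.+1 = t_ i + r by rewrite /t_ -natr1; ring.
have := hr (u + t_ i) (t - t_ i) ltac:(lra) ltac:(lra).
have := hr (u + t) (t_ i.+1 - t) ltac:(lra) ltac:(lra).
rewrite (_ : u + t_ i + (t - t_ i) = u + t); last by ring.
rewrite (_ : u + t + (t_ i.+1 - t) = u + t_ i.+1); last by ring.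
rewrite !ler_norml => ? ? /andP[? ?] /andP[? ?]; apply/andP; split; lra.
Qed.

(** A subgroup of the reals without elements in [(0, e)] is cyclic. Two positive periods differ by
    at least [e], so their infimum is attained and generates; if there is none, any [d] will do. *)
Lemma period_lattice (e : R) : 0 < e -> (forall t, period t -> ~ (0 < t < e)) ->
  exists2 d : R, 0 < d & forall t, period t -> exists k : int, t = k%:~R * d.
Proof.
move=> e0 sep; pose E := [set t | period t /\ 0 < t].
have [[t0 [pt0 t00]]|none] := pselect (exists t, E t); last first.
  exists 1 => // t pt; exists 0; rewrite mul0r; apply/eqP; rewrite -[_ == _]negbK.
  apply/negP; rewrite neq_lt => /orP[t0|t0]; apply: none.
    by exists (- t); split; [exact: periodN|rewrite oppr_gt0].
  by exists t.
have E0 : E !=set0 by exists t0.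
have lbE : has_inf E by split => //; exists 0 => t [_ /ltW].
have ge_inf t : E t -> inf E <= t by move=> Et; apply: inf_lbound => //; exact: lbE.2.
have sepE t t' : E t -> E t' -> t' < t -> t' + e <= t.
  move=> [pt _] [pt' _] tt; rewrite leNgt; apply/negP => lt.
  by apply: (sep (t - t')); [apply: periodD => //; exact: periodN|apply/andP; split; lra].
have [t1 Et1 lt1] := inf_adherent e0 lbE.
have e1 : inf E = t1.
  apply/eqP; rewrite eq_le ge_inf//=; apply: lb_le_inf => // t Et.
  rewrite leNgt; apply/negP => tt1; have := sepE _ _ Et1 Et tt1; have := ge_inf _ Et; lra.
have t10 := Et1.2.
exists t1 => // t pt; exists (Num.floor (t / t1)).
set k := Num.floor _; apply/eqP; rewrite -subr_eq0; apply/negPn/negP => ne.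
have [k1 k2] : k%:~R * t1 <= t /\ t < k%:~R * t1 + t1.
  have := Num.Theory.floor_le (t / t1); have := Num.Theory.floorD1_gt (t / t1).
  rewrite -/k intrD mulr1z ler_pdivlMr// ltr_pdivrMr// mulrDl mul1r => a b.
  by split.
have Er : E (t - k%:~R * t1).
  split; first by apply: periodD => //; apply: periodN; exact: periodMz Et1.1.
  by rewrite lt_neqAle eq_sym ne subr_ge0.
have := ge_inf _ Er; rewrite e1; lra.
Qed.

(** If periods are arbitrarily small, the whole line works. Otherwise the support lies in a lattice,
    its points are atoms, hence exact periods, and the exact periods in the lattice form a countable
    subgroup of full measure. *)
Lemma slow_variation : exists C : set R, [/\ measurable C, mu (~` C) = 0%E,
  forall x y, C x -> C y -> C (x - y), C 0 &
  forall e M : R, 0 < e -> exists U : R, forall u, U <= u ->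
    forall t, C t -> `|t| <= M -> `|g (u + t) - g u| <= e].
Proof.
have [dense|] := pselect (forall e : R, 0 < e -> exists2 t, period t & 0 < t < e).
  exists setT; split => //; first by rewrite setCT measure0.
  move=> e M e0; have [U HU] := slow_dense dense M e0.
  by exists U => u uU t _; exact: HU.
move=> /existsNP[e1] /not_implyP[e10 sep].
have [t pt te|d d0 lat] := period_lattice e10.
  by apply: sep; exists t.
exists [set t | exact_period t /\ exists k : int, t = k%:~R * d].
have cC : countable [set t : R | exact_period t /\ exists k : int, t = k%:~R * d].
  apply: (@sub_countable _ _ _ ((fun k : int => k%:~R * d) @` setT)).
    by apply: subset_card_le => t [_ [k ->]]; exists k.
  exact: sub_countable (card_image_le _ _) (countableP _).
split.
- exact: countable_measurable.
- apply/negligibleP; first by apply: measurableC; exact: countable_measurable.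
  have [N [mN N0 sub]] := @negligible_support _ mu.
  exists N; split => // t /= nC; apply: sub => St; apply: nC.
  have [k ek] := lat _ (blur_support St); split; last by exists k.
  apply: atom_exact_period.
  (* Support points are multiples of [d], so the interval of radius [d] around [t] carries no mass
     apart from [t]. *)
  have nI : mu.-negligible (`]t - d, t + d[%classic `\ t).
    apply: (negligibleS _ (@negligible_support _ mu)) => s [/=]; rewrite in_itv/= => ts st Ss.
    have [j ej] := lat _ (blur_support Ss); apply: st; rewrite ek ej in ts *.
    have : (`|j - k| < 1)%R.
      have : `|(j%:~R - k%:~R) * d| < d by rewrite mulrBl ltr_norml; lra.
      rewrite normrM (gtr0_norm d0) gtr_pMl// -intrB -intr_norm.
      by rewrite -(ltr_int R).
    by move=> h; have -> : j = k by lia.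
  have mI : measurable (`]t - d, t + d[%classic `\ t) by exact: measurableD.
  have It : `]t - d, t + d[%classic t by rewrite /= in_itv/=; apply/andP; split; lra.
  have := St d d0; rewrite -(setD1K It) measureU0//.
  exact: measure_negligible.
- move=> x y [ex [i xi]] [ey [j yj]]; split.
    by apply: exact_periodD => //; exact: exact_periodN.
  by exists (i - j); rewrite xi yj intrB mulrBl.
- by split; [exact: exact_period0|exists 0; rewrite mul0r].
move=> e M e0.
(* Only finitely many multiples of [d] are bounded by [M]; shifting by [N] indexes them by naturals,
   as [finite_eventually] requires. *)
pose N := (Num.truncn (M / d)).+1.
pose Q i u := exact_period ((i%:Z - N%:Z)%:~R * d) ->
  `|g (u + (i%:Z - N%:Z)%:~R * d) - g u| <= e.
have [] := @finite_eventually Q _ (2 * N).+1.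
  move=> i; have [ex|nex] := pselect (exact_period ((i%:Z - N%:Z)%:~R * d)).
    by have [U HU] := ex e e0; exists U => u uU _; exact: HU.
  by exists 0 => u _ /nex.
move=> U HU; exists U => u uU t [ex [k ek]] tM.
have kN : (`|k| < N%:Z)%R.
  have : `|k%:~R : R| < N%:R.
    apply: (le_lt_trans _ (Num.Theory.truncnS_gt (M / d))).
    by rewrite ler_pdivlMr// -[X in _ * X](gtr0_norm d0) -normrM -ek.
  by rewrite -intr_norm -[N%:R]/(N%:Z%:~R) ltr_int.
have h : ((absz (k + N%:Z))%:Z - N%:Z = k)%R by lia.
have := HU u uU (absz (k + N%:Z)); rewrite /Q h -ek; apply => //; lia.
Qed.

End SlowVariation.

(** * Decorrelation at an intermediate level *)

Section Decorrelation.
Context (R : realType) (mu : probability R R) (w : R -> R).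
Hypothesis W : weight mu w.
Notation Ew := (Ew mu w).
Notation K := (stepop mu w).
Notation L := (killop mu w).
Notation intw := (intw mu w).
Notation mgf := (mgf mu w).

Variables l a b : R.
Hypothesis l0 : 0 < l.
Hypotheses (b0 : 0 < b) (ib : intw (fun z => expR (- b * z))) (mb : mgf (- b) < 1).
Hypotheses (a0 : 0 < a) (ia : intw (fun z => expR (a * z))) (ma : 1 < mgf a).
Notation G := (cramern mu w l).
Notation g := (cramer mu w l).

(** To collect anything within [m] steps the walk must first pass below [H]; what follows that
    passage is bounded by the unrestricted [g]. *)
Lemma cramern_level m (H u : R) : 0 <= H ->
  G m (H + u) <= iter m L (fun v => (v <= 0)%R%:R * g (H + v)) u.
Proof.
move=> H0; have bg := bmeas_cramer W l0.
have bh : bmeas (fun v => (v <= 0)%R%:R * g (H + v)).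
  by apply: bmeasM; [exact: bmeas_le0|exact: bmeas_shift].
elim: m u => [|m ih] u; (have [u0|u0] := leP u 0);
  try by rewrite iterL_le0// u0 mul1r cramern_le.
- by rewrite /cramern /= /cramer0 (leNgt u) (leNgt (H + u)) u0 (ltr_wpDl H0 u0) /= !mul0r.
- rewrite /cramern /= /killop !ifN -?ltNge ?(ltr_wpDl H0 u0)//.
  apply: (@le_trans _ _ (K (fun v => G m (H + v)) u)).
    by rewrite /stepop le_eqVlt; apply/orP; left; apply/eqP; apply: eq_Rintegral => z _; rewrite addrA.
  apply: (le_K W) => //; last exact: (bmeas_iterL W).
  by apply: bmeas_shift; exact: bmeas_cramern.
Qed.

(** At the passage below [H] the residual factor [g (H + v)] is within [e] of one constant [g0] at
    all likely landing points [v]. Both [G m x] and [g x] are compared with [g0], which then drops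
    out. *)
Lemma decorrelation (eps : R) : 0 < eps ->
  exists2 H : R, 0 < H & forall x : R, H < x -> forall m,
    G m x <= g x * iter m L (fun v => (v <= 0)%R%:R) (x - H) + eps.
Proof.
move=> eps0; have bg := bmeas_cramer W l0.
(* The final error is [4 * e]: three for replacing [g0 + e] by [g x], one for large overshoots. The
   bound [e <= 1 / 4] guarantees that a likely landing point exists. *)
pose e : R := Num.min eps 1 / 4.
have [e1 e2] : e <= eps / 4 /\ e <= 1 / 4.
  by rewrite /e !ler_pM2r ?invr_gt0// !ge_min !lexx orbT.
have e0 : 0 < e by rewrite divr_gt0// lt_min eps0 ltr01.
have [A A0 hA] := overshoot W a0 ia ma.
pose M : R := Num.max 0 (ln (A / e) / a).
have M0 : 0 <= M by rewrite le_max lexx.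
have hM : A * expR (- (a * M)) <= e.
  have : A / e <= expR (a * M).
    apply: (@le_trans _ _ (expR (ln (A / e)))); first by rewrite lnK// posrE divr_gt0.
    by rewrite ler_expR [leRHS]mulrC -ler_pdivrMr// le_max lexx orbT.
  by rewrite ler_pdivrMr// mulrC expRN ler_pdivrMr ?expR_gt0.
have [C [mC C0 CB C00 slow]] := slow_variation W l0 bg (cramer_itv W l0)
  (cramer_shift W l0) (increment2_cvg0 W l0 a0 ia).
have [U HU] := slow e M e0.
(* High enough for slow variation to hold on the whole window from [H - M] to [H]. *)
pose H : R := Num.max U 0 + M + 1.
have [UH H0] : U + M < H /\ M < H.
  have : U <= Num.max U 0 /\ 0 <= Num.max U 0 by rewrite !le_max !lexx orbT.
  by rewrite /H => -[? ?]; split; lra.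
exists H; first by lra.
move=> x Hx m; set y := x - H.
have y0 : 0 < y by rewrite subr_gt0.
(* Almost every jump lies in the subgroup [C], so the walk from [y] stays in the coset [y + C] and
   [f] is invariant ([fE]). *)
pose f (v : R) : R := \1_C (v - y).
have bf : bmeas f.
  rewrite /f; under [fun v => _]funext do rewrite addrC.
  by apply: bmeas_shift; exact: bmeas_indic.
have CN c : C c -> C (- c) by move=> Cc; rewrite -[- c]add0r; exact: CB.
have fE n : iter n L f = f.
  elim: n => //= n ->; apply/funext => v; rewrite /killop; case: ifP => // _.
  rewrite -[RHS](Ew_cst W); apply: (eq_Ew_ae W mC C0).
  - exact: bmeas_refl.
  - exact: bmeas_cst.
  - move=> z Cz; rewrite /f !indicE; congr (_%:R); apply: congr1.
    apply/idP/idP; rewrite !inE => h.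
      by have := CB _ _ h (CN _ Cz); rewrite (_ : v - z - y - - z = v - y)//; ring.
    by have := CB _ _ h Cz; rewrite (_ : v - y - z = v - z - y)//; ring.
have fy : f y = 1 by rewrite /f subrr indicE mem_set.
(* The likely landing points: in the window and in the coset, so that two of them differ by an
   element of [C] of size at most [M]. *)
pose J (v : R) : R := (- M <= v <= 0)%R%:R * f v.
have bw : bmeas (fun v : R => (- M <= v <= 0)%R%:R : R).
  by apply: bmeas_ind; apply: measurable_and; exact: measurable_fun_ler.
have bm : bmeas (fun v : R => (v < - M)%R%:R : R).
  by apply: bmeas_ind; exact: measurable_fun_ltr.
have bJ : bmeas J by exact: bmeasM.
pose esc n := iter n L (fun v => (0 < v)%R%:R) y.
have escv : esc n @[n --> \oo] --> 0 by exact: (escape_cvg W b0 ib mb).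
have J_lb n : 1 - esc n - e <= iter n L J y.
  have : 1 <= esc n + iter n L (fun v => (v < - M)%R%:R) y + iter n L (fun v => J v + (1 + - 1 * f v)) y.
    have b1 : bmeas (fun v : R => (0 < v)%R%:R : R).
      by apply: bmeas_ind; exact: measurable_fun_ltr.
    have b2 : bmeas (fun v => J v + (1 + - 1 * f v)).
      by apply: bmeasD => //; apply: bmeasD; [exact: bmeas_cst|exact: bmeasZ].
    rewrite -!(iterLD W)//; last exact: bmeasD.
    rewrite -[leLHS](iterL_cst W n 1 y); apply: (le_iterL W) => //.
    - exact: bmeas_cst.
    - by apply: bmeasD => //; exact: bmeasD.
    - move=> z; rewrite /J /f indicE; case: (z - y \in C);
        case: (ltP 0 z); case: (ltP z (- M)) => //= ? ?; rewrite ?mulr1n ?mulr0n; lra.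
  rewrite (iterLD W)//; last by apply: bmeasD; [exact: bmeas_cst|exact: bmeasZ].
  rewrite (iterLD W)//; [|exact: bmeas_cst|exact: bmeasZ].
  rewrite (iterL_cst W) (iterLZ W)// fE fy.
  have := hA M n y M0 y0; lra.
have [u0 Ju0] : exists u0, J u0 != 0.
  apply: contrapT => /forallNP nJ.
  have J0 : J = fun=> 0 by apply/funext => v; apply/eqP; have := nJ v; case: eqP.
  have /cvgrPdist_le/(_ (1 / 4) ltac:(lra))[n _ /(_ n (leqnn n))] := escv.
  rewrite sub0r normrN ler_norml => /andP[_ hn].
  by have := J_lb n; rewrite J0 (iterL_cst W); lra.
have JE v : J v != 0 -> [/\ - M <= v, v <= 0 & C (v - y)].
  rewrite /J /f indicE; case: (leP (- M) v) => ?; last by rewrite mul0r eqxx.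
  case: (leP v 0) => ?; last by rewrite mul0r eqxx.
  by case: (boolP (v - y \in C)); rewrite ?mulr0 ?eqxx// inE.
have J1 v : J v != 0 -> J v = 1.
  rewrite /J /f indicE; case: (_ && _); case: (_ \in _); rewrite ?mulr0 ?mul0r ?eqxx ?mul1r//.
have [u1 u2 u3] := JE _ Ju0.
set g0 := g (H + u0).
have near0 v : J v != 0 -> `|g (H + v) - g0| <= e.
  move=> /JE[v1 v2 v3].
  have Ct : C (v - u0) by have := CB _ _ v3 u3; rewrite (_ : v - y - (u0 - y) = v - u0)//; ring.
  have := HU (H + u0) ltac:(lra) _ Ct.
  rewrite (_ : H + u0 + (v - u0) = H + v); last by ring.
  by apply; rewrite ler_norml; apply/andP; split; lra.
have /andP[g00 g01] := cramer_itv W l0 (H + u0).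
(* [J v + (g0 - e - 1)] lies below [g (H + v)]: on [J] by nearness to [g0], elsewhere because it is
   nonpositive. One [e] is this nearness, the other the overshoot. *)
have den : g0 - 2 * e <= g x.
  have h n : g0 - 2 * e - esc n <= g x.
    have : iter n L (fun v => J v + (g0 - e - 1)) y <= iter n L (fun v => g (H + v)) y.
      apply: (le_iterL W).
      - by apply: bmeasD => //; exact: bmeas_cst.
      - exact: bmeas_shift.
      - move=> v; have [Jv|/[dup] Jv /near0] := eqVneq (J v) 0.
          by rewrite Jv; have /andP[] := cramer_itv W l0 (H + v); rewrite -/g0 in g00 g01 *; lra.
        by rewrite ler_norml (J1 _ Jv); lra.
    rewrite (iterL_cramer W l0); last by lra.
    rewrite (_ : H + y = x); last by rewrite /y; ring.
    rewrite (iterLD W)//; last exact: bmeas_cst.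
    by rewrite (iterL_cst W); have := J_lb n; lra.
  rewrite -[leLHS]subr0.
  apply: (@ler_cvg_to _ \oo _ _ (fun n => g0 - 2 * e - esc n) (fun n => g x)).
  - by apply: cvgB; [exact: cvg_cst|exact: escv].
  - exact: cvg_cst.
  - exact: nearW.
set p := iter m L (fun v => (v <= 0)%R%:R) y.
(* Off the window or off the coset, [g] is bounded by 1; only the overshoot contributes, as leaving
   the coset has probability 0. *)
have num : G m x <= (g0 + e) * p + e.
  rewrite (_ : x = H + y); last by rewrite /y; ring.
  apply: (le_trans (cramern_level m y _)); first by lra.
  have bl := bmeas_le0 R.
  have : iter m L (fun v => (v <= 0)%R%:R * g (H + v)) y <=
      iter m L (fun v => ((g0 + e) * (v <= 0)%R%:R + (v < - M)%R%:R) + (1 + - 1 * f v)) y.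
    apply: (le_iterL W).
    - by apply: bmeasM => //; exact: bmeas_shift.
    - by apply: bmeasD; apply: bmeasD => //; [exact: bmeasZ|exact: bmeas_cst|exact: bmeasZ].
    - move=> v; have /andP[? ?] := cramer_itv W l0 (H + v).
      have := near0 v; have := @J1 v; rewrite /J /f indicE -/g0 in g00 g01 *.
      case: (leP v 0) => ?; case: (leP (- M) v) => ? /=; case: (v - y \in C);
        rewrite ?mulr1n ?mulr0n ?mulr1 ?mulr0 ?mul0r ?mul1r ?eqxx ?oner_eq0 /= => h1 h2; try lra.
      by have := h2 isT; rewrite ler_norml; lra.
  rewrite (iterLD W); [|by apply: bmeasD => //; exact: bmeasZ|
    by apply: bmeasD; [exact: bmeas_cst|exact: bmeasZ]].
  rewrite (iterLD W)//; last exact: bmeasZ.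
  rewrite (iterLD W)//; [|exact: bmeas_cst|exact: bmeasZ].
  rewrite (iterL_cst W) !(iterLZ W)// fE fy -/p.
  have := hA M m y M0 y0; lra.
have /andP[p0 p1] : 0 <= p <= 1.
  apply: (iterL_itv W); first exact: bmeas_le0.
  by move=> z; case: (leP z 0); rewrite ler01 lexx.
nra.
Qed.

End Decorrelation.

(** * A central limit theorem at the median *)

Section Binomial.
Local Open Scope nat_scope.

Lemma central_binS m : 'C(m.+1.*2, m.+1) * m.+1 = 2 * m.*2.+1 * 'C(m.*2, m).
Proof.
have e1 : 'C(m.*2.+1, m) = 'C(m.*2.+1, m.+1).
  by rewrite -[RHS]bin_sub; [congr 'C(_, _); lia|lia].
have e2 : 'C(m.+1.*2, m.+1) = 2 * 'C(m.*2.+1, m) by rewrite doubleS binS -e1 mul2n addnn.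
have := mul_bin_diag m.*2.+1 m; rewrite /= -e1 e2; nia.
Qed.

(** Stirling-free bound of the central coefficient by [4^m / sqrt (2m + 1)]; the induction rests on
    [(2m + 1)(2m + 3) <= (2m + 2)^2]. *)
Lemma central_bin_le m : 'C(m.*2, m) ^ 2 * m.*2.+1 <= 16 ^ m.
Proof.
elim: m => [|m ih]; first by rewrite bin0.
have h := central_binS m.
rewrite -(@leq_pmul2r (m.+1 ^ 2)) ?expn_gt0//.
have -> : 'C(m.+1.*2, m.+1) ^ 2 * m.+1.*2.+1 * m.+1 ^ 2 =
   4 * (m.*2.+1 * m.*2.+3) * ('C(m.*2, m) ^ 2 * m.*2.+1).
  rewrite mulnAC -expnMn h !expnMn doubleS; lia.
have h4 : 4 * (m.*2.+1 * m.*2.+3) <= 16 * m.+1 ^ 2 by rewrite -mulnn -mul2n; nia.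
by rewrite [16 ^ _]expnS [leqRHS]mulnAC; exact: leq_mul h4 ih.
Qed.

Lemma bin_le_central m k : 'C(m.*2, k) <= 'C(m.*2, m).
Proof.
have step j : j < m -> 'C(m.*2, j) <= 'C(m.*2, j.+1).
  move=> jm; rewrite -(@leq_pmul2l j.+1)// mul_bin_left leq_mul2r; apply/orP; right; lia.
have low i : i <= m -> 'C(m.*2, m - i) <= 'C(m.*2, m).
  elim: i => [|i ih] im; first by rewrite subn0.
  apply: leq_trans (ih (ltnW im)); rewrite (_ : m - i = (m - i.+1).+1); last by lia.
  by apply: step; lia.
have [km|mk] := leqP k m; first by rewrite -(subKn km); apply: low; lia.
have [k2|k2] := leqP k m.*2; last by rewrite bin_small.
by rewrite -bin_sub// (_ : m.*2 - k = m - (k - m)); [apply: low|]; lia.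
Qed.

(** Anti-concentration: every binomial probability is [O(1 / sqrt n)]. The factor 2 absorbs the odd
    case, obtained from the even one by Pascal's rule. *)
Lemma bin_sqr_le n k : 'C(n, k) ^ 2 * n.+1 <= 2 * 4 ^ n.
Proof.
have e16 m : 16 ^ m = 4 ^ m.*2 by rewrite -mul2n expnM.
rewrite -(odd_double_half n); case: (odd n); rewrite ?add0n ?add1n; set m := n./2.
  have hk : 'C(m.*2.+1, k) <= 2 * 'C(m.*2, m).
    case: k => [|k]; first by rewrite bin0 muln_gt0/= bin_gt0; lia.
    rewrite binS mul2n -[leqRHS]addnn; apply: leq_add; exact: bin_le_central.
  have := central_bin_le m; rewrite e16 => h.
  apply: (@leq_trans ((2 * 'C(m.*2, m)) ^ 2 * m.*2.+2)); first by rewrite leq_mul// leq_exp2r.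
  rewrite expnMn [4 ^ _.+1]expnS; move: h; set X := 4 ^ _.
  by set c := 'C(_, _) ^ 2; rewrite -!mul2n -[2 ^ 2]/4; nia.
have := central_bin_le m; rewrite e16 => h.
apply: (@leq_trans ('C(m.*2, m) ^ 2 * m.*2.+1)).
  by rewrite leq_mul// leq_exp2r// bin_le_central.
by rewrite (leq_trans h)// leq_pmull.
Qed.

End Binomial.

(** The second bound strengthens the induction: it gives the first one as long as the last index
    counted is at most [hi]. *)
Lemma count_itv (R : realType) (lo hi : R) n : lo <= hi ->
  \sum_(k < n) ((lo <= k%:R <= hi)%R%:R : R) <= hi - lo + 1 /\
  \sum_(k < n) ((lo <= k%:R <= hi)%R%:R : R) <= Num.max 0 (n%:R - lo).
Proof.
move=> lohi; elim: n => [|n [ih1 ih2]].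
  by rewrite !big_ord0 le_max lexx; split=> //; lra.
rewrite !big_ord_recr /=; case: (leP lo n%:R) => h1; last first.
  by rewrite mulr0n !addr0; split=> //; apply: (le_trans ih2); rewrite ge_max !le_max lexx -natr1; lra.
have {}ih2 : \sum_(k < n) ((lo <= k%:R <= hi)%R%:R : R) <= n%:R - lo.
  by apply: (le_trans ih2); rewrite ge_max lexx; lra.
rewrite le_max -natr1 /=; case: (leP n%:R hi) => h2; rewrite ?mulr1n ?mulr0n.
  by split; [lra|apply/orP; right; lra].
by split; [lra|apply/orP; right; lra].
Qed.

Lemma sum_binS (R : realType) n (f : nat -> R) :
  \sum_(k < n.+2) 'C(n.+1, k)%:R * f k = \sum_(k < n.+1) 'C(n, k)%:R * (f k + f k.+1).
Proof.
under [RHS]eq_bigr do rewrite mulrDr.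
rewrite big_split/= big_ord_recl/= [in RHS]big_ord_recl/= !bin0 -addrA; congr (_ + _).
under eq_bigr do rewrite binS natrD mulrDl.
rewrite big_split/=; congr (_ + _).
by rewrite big_ord_recr/= bin_small// mul0r addr0.
Qed.

(** * The comparison walk with two-point steps *)

Section Rademacher.
Context (R : realType).
Variables (v s : R).

(** One step down by [v + s] or [v - s], each with probability 1/2: the simplest law with mean [v]
    and variance [s ^+ 2]. *)
Definition KR (f : R -> R) (u : R) : R := (f (u - v - s) + f (u - v + s)) / 2.

Lemma iterKR_bin n f u : iter n KR f u =
  (\sum_(k < n.+1) 'C(n, k)%:R * f (u - n%:R * v + n%:R * s - k%:R * (2 * s))) / 2 ^+ n.
Proof.
elim: n u => [|n ih] u.
  by rewrite /= big_ord_recr big_ord0 /= add0r !mul0r subr0 addr0 subr0 bin0 mul1r divr1.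
rewrite (sum_binS n (fun k => f (u - n.+1%:R * v + n.+1%:R * s - k%:R * (2 * s)))) /= /KR !ih -mulrDl -big_split /= exprS invfM mulrA mulrAC; congr (_ / _ / _).
apply: eq_bigr => k _; rewrite -mulrDr addrC -!natr1; congr (_ * (f _ + f _)); ring.
Qed.

Hypothesis s0 : 0 < s.

(** Probability that [s] times a simple symmetric walk of [n] steps is at least [c]. *)
Definition tailR n (c : R) : R :=
  (\sum_(k < n.+1) 'C(n, k)%:R * (c <= k%:R * (2 * s) - n%:R * s)%R%:R) / 2 ^+ n.

Lemma iterKR_le0 n (h u : R) :
  iter n KR (fun z => (z <= h)%R%:R) u = tailR n (u - n%:R * v - h).
Proof.
rewrite iterKR_bin /tailR; congr (_ / _); apply: eq_bigr => k _; congr (_ * _%:R).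
by congr nat_of_bool; apply/idP/idP; lra.
Qed.

Lemma sum_bin_rev n (f : R -> R) :
  \sum_(k < n.+1) 'C(n, k)%:R * f (k%:R * (2 * s) - n%:R * s) =
  \sum_(k < n.+1) 'C(n, k)%:R * f (- (k%:R * (2 * s) - n%:R * s)).
Proof.
rewrite (reindex_inj rev_ord_inj)/=; apply: eq_bigr => k _.
have kn : (k <= n)%N by rewrite -ltnS.
by rewrite subSS bin_sub// natrB//; congr (_ * f _); ring.
Qed.

(** Pair [k] with [n - k], that is [x] with [- x]: when [|x| > |c|], exactly one of the two is at
    least [c], so only the mass with [|x| <= |c|] can deviate from 1/2. *)
Lemma tailR_half n (c : R) : `|tailR n c - 1 / 2| <=
  (\sum_(k < n.+1) 'C(n, k)%:R * (`|k%:R * (2 * s) - n%:R * s| <= `|c|)%R%:R) / 2 ^+ n.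
Proof.
have p2 : (0 : R) < 2 ^+ n by rewrite exprn_gt0.
have tot : \sum_(k < n.+1) ('C(n, k)%:R : R) = 2 ^+ n.
  rewrite -natr_sum -natrX; congr (_%:R).
  by rewrite -[2%N]/(1 + 1)%N expnDn; apply: eq_bigr => k _; rewrite !exp1n !muln1.
pose d (x : R) : R := (c <= x)%R%:R - 1 / 2.
have -> : tailR n c - 1 / 2 =
    (\sum_(k < n.+1) 'C(n, k)%:R * ((d (k%:R * (2 * s) - n%:R * s) +
      d (- (k%:R * (2 * s) - n%:R * s))) / 2)) / 2 ^+ n.
  under eq_bigr do rewrite mulrA mulrDr.
  have e2 (S : R) : (S + S) / 2 = S by lra.
  rewrite -mulr_suml big_split/= -(sum_bin_rev n d) e2.
  rewrite /d; under eq_bigr do rewrite mulrBr.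
  rewrite sumrB -mulr_suml tot mulrBl /tailR; congr (_ - _).
  by rewrite mulrAC divff ?mul1r// gt_eqF.
rewrite normrM normfV (gtr0_norm p2) ler_pM2r ?invr_gt0//.
apply: (le_trans (ler_norm_sum _ _ _)); apply: ler_sum => k _.
rewrite normrM ger0_norm// ler_wpM2l//.
move: (_ - _) => x; rewrite /d normrM [`|2^-1|]gtr0_norm ?invr_gt0// ler_pdivrMr//.
case: (leP `|x| `|c|) => [_|].
  by rewrite mulr1n mul1r; case: (leP c x); case: (leP c (- x)) => _ _; rewrite ?mulr1n ?mulr0n ler_norml; lra.
rewrite mulr0n mul0r => h; have c1 := ler_norm c.
have c2 := ler_norm (- c); rewrite normrN in c2.
have [x0|x0] := lerP 0 x; [rewrite (ger0_norm x0) in h|rewrite (ltr0_norm x0) in h].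
  have h1 : c <= x by lra.
  have h2 : (c <= - x) = false by apply/negbTE; rewrite -ltNge; lra.
  by rewrite h1 h2 mulr1n mulr0n ler_norml; apply/andP; split; lra.
have h1 : c <= - x by lra.
have h2 : (c <= x) = false by apply/negbTE; rewrite -ltNge; lra.
by rewrite h1 h2 mulr1n mulr0n ler_norml; apply/andP; split; lra.
Qed.

Lemma count_window n (r : R) : 0 <= r ->
  \sum_(k < n.+1) ((`|k%:R * (2 * s) - n%:R * s| <= r)%R%:R : R) <= r / s + 1.
Proof.
move=> r0.
have h2 : (0:R) < 2 * s by rewrite mulr_gt0.
have := @count_itv R ((n%:R * s - r) / (2 * s)) ((n%:R * s + r) / (2 * s)) n.+1.
have -> : (n%:R * s + r) / (2 * s) - (n%:R * s - r) / (2 * s) = r / s.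
  by field; rewrite gt_eqF.
rewrite ler_pM2r ?invr_gt0// => /(_ ltac:(lra)) [+ _].
apply: le_trans; apply: ler_sum => k _; rewrite ler_nat.
case: (leP `|_| r) => //; rewrite ler_norml => /andP[k1 k2].
by rewrite ler_pdivrMr// ler_pdivlMr// (_ : (_ && _) = true)//; apply/andP; split; lra.
Qed.

(** At most [|c| / s + 1] points lie within [|c|] of 0, each of mass at most [2 / sqrt (n + 1)]. *)
Lemma tailR_le n (c : R) :
  `|tailR n c - 1 / 2| <= (`|c| / s + 1) * (2 / Num.sqrt n.+1%:R).
Proof.
apply: (le_trans (tailR_half n c)).
have p2 : (0 : R) < 2 ^+ n by rewrite exprn_gt0.
have sn : 0 < Num.sqrt (n.+1%:R : R) by rewrite sqrtr_gt0.
have hb k : 'C(n, k)%:R <= 2 / Num.sqrt n.+1%:R * 2 ^+ n :> R.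
  rewrite mulrAC ler_pdivlMr// -(@ler_pXn2r _ 2) ?nnegrE ?mulr_ge0 ?exprn_ge0 ?(ltW sn)//.
  rewrite exprMn sqr_sqrtr// exprMn -exprM mulnC exprM.
  have := bin_sqr_le n k; rewrite -(ler_nat R) !natrM !natrX => h.
  have -> : 2 ^+ 2 ^+ n = 4 ^+ n :> R by congr (_ ^+ _); rewrite expr2; lra.
  by rewrite expr2; apply: (le_trans h); rewrite ler_wpM2r ?exprn_ge0//; lra.
rewrite ler_pdivrMr//.
apply: (@le_trans _ _ (\sum_(k < n.+1) (2 / Num.sqrt n.+1%:R * 2 ^+ n) *
   (`|k%:R * (2 * s) - n%:R * s| <= `|c|)%R%:R)).
  by apply: ler_sum => k _; rewrite ler_wpM2r// ler0n.
rewrite -mulr_sumr mulrC mulrA ler_pM2r// ler_wpM2r ?divr_ge0 ?(ltW sn)//.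
exact: count_window.
Qed.

End Rademacher.

(** * Smooth test functions *)

Section TaylorClass.
Context (R : realType).
Implicit Types f g : R -> R.

(** The derivatives are left as arbitrary functions [A] and [B]: only the cubic remainder is used,
    and nothing has to be differentiated. *)
Definition taylor2 (C : R) f := exists A B : R -> R, forall u h,
  `|f (u + h) - f u - h * A u - h ^+ 2 * B u| <= C * `|h| ^+ 3.

Lemma taylor2_shift C f a : taylor2 C f -> taylor2 C (fun u => f (u + a)).
Proof.
move=> [A [B H]]; exists (fun u => A (u + a)), (fun u => B (u + a)) => u h.
rewrite (_ : u + h + a = u + a + h); first exact: H.
by ring.
Qed.

Lemma taylor2_lin C D x f g : taylor2 C f -> taylor2 D g ->
  taylor2 (`|x| * C + D) (fun u => x * f u + g u).
Proof.
move=> [A [B H]] [A' [B' H']].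
exists (fun u => x * A u + A' u), (fun u => x * B u + B' u) => u h.
rewrite (_ : _ - _ = x * (f (u + h) - f u - h * A u - h ^+ 2 * B u) +
  (g (u + h) - g u - h * A' u - h ^+ 2 * B' u)); last by ring.
apply: (le_trans (ler_normD _ _)); rewrite mulrDl; apply: lerD => //.
by rewrite normrM -[leRHS]mulrA ler_wpM2l.
Qed.

Lemma taylor2_scale C f (t : R) : 0 < t -> taylor2 C f -> taylor2 (C / t ^+ 3) (fun u => f (u / t)).
Proof.
move=> t0 [A [B H]]; exists (fun u => A (u / t) / t), (fun u => B (u / t) / t ^+ 2) => u h.
have := H (u / t) (h / t); rewrite -mulrDl normrM exprMn [`|t^-1|]gtr0_norm ?invr_gt0// exprVn.
rewrite (_ : _ - _ - _ = f ((u + h) / t) - f (u / t) - h * (A (u / t) / t) -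
  h ^+ 2 * (B (u / t) / t ^+ 2)); last by field; rewrite gt_eqF.
have -> // : C / t ^+ 3 * `|h| ^+ 3 = C * (`|h| / t) ^+ 3.
by field; rewrite gt_eqF.
Qed.

Lemma taylor2_KR C f v s : taylor2 C f -> taylor2 C (KR v s f).
Proof.
move=> [A [B H]]; exists (fun u => (A (u - v - s) + A (u - v + s)) / 2),
  (fun u => (B (u - v - s) + B (u - v + s)) / 2) => u h.
have := H (u - v - s) h; have := H (u - v + s) h; rewrite /KR.
rewrite (_ : u - v + s + h = u + h - v + s); last by ring.
rewrite (_ : u - v - s + h = u + h - v - s); last by ring.
rewrite !ler_norml => /andP[? ?] /andP[? ?]; apply/andP; split; lra.
Qed.

Definition cube_pos (u : R) : R := Num.max u 0 ^+ 3.

Lemma taylor2_cube_pos : taylor2 1 cube_pos.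
Proof.
exists (fun u => 3 * Num.max u 0 ^+ 2), (fun u => 3 * Num.max u 0) => u h.
rewrite /cube_pos mul1r.
case: (leP u 0) => u0; case: (leP (u + h) 0) => uh.
- by rewrite !expr0n/= !mulr0 !subr0 normr0 exprn_ge0.
- rewrite !expr0n/= !mulr0 !subr0 ger0_norm; last by rewrite exprn_ge0// ltW.
  rewrite lerXn2r ?nnegrE ?normr_ge0 ?(ltW uh)//.
  by have := ler_norm h; lra.
- rewrite expr0n/= (_ : _ - _ - _ = - (u + h) ^+ 3 + h ^+ 3); last by ring.
  rewrite (@ler0_norm _ h); last by lra.
  have : 0 <= (- (u + h)) ^+ 3 by rewrite exprn_ge0//; lra.
  have : (- (u + h)) ^+ 3 <= (- h) ^+ 3 by rewrite lerXn2r ?nnegrE//; lra.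
  by rewrite ler_norml => ? ?; apply/andP; split; lra.
- by rewrite (_ : _ - _ - _ = h ^+ 3) ?normrX//; ring.
Qed.

(* cubic B-spline smoothing of the step from [1] on [u <= 0] to [0] on [3 <= u] *)
Definition step (u : R) : R :=
  1 - (cube_pos u - 3 * cube_pos (u - 1) + 3 * cube_pos (u - 2) - cube_pos (u - 3)) / 6.

Lemma step_itv u : 0 <= step u <= 1.
Proof.
have cub (x : R) : 0 <= x -> 0 <= x ^+ 3 by move=> x0; rewrite exprn_ge0.
rewrite /step /cube_pos.
case: (leP u 0) => u0; first by rewrite !max_r ?expr0n/=; lra.
have := cub u (ltW u0).
case: (leP (u - 1) 0) => u1.
  have : 0 <= (1 - u) * (1 + u + u ^+ 2) by rewrite mulr_ge0//; have := sqr_ge0 u; lra.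
  by rewrite !max_r ?expr0n/=; try lra; move=> *; apply/andP; split; lra.
case: (leP (u - 2) 0) => u2.
  have p0 := sqr_ge0 (u - 1).
  have p1 : 0 <= (u - 1) * (2 - u) by rewrite mulr_ge0//; lra.
  have p2 : 0 <= (u - 1) * ((u - 1) * (2 - u)) by rewrite mulr_ge0//; lra.
  have p3 : 0 <= (2 - u) * ((u - 1) * (2 - u)) by rewrite mulr_ge0//; lra.
  by rewrite max_r ?expr0n/=; try lra; move=> *; apply/andP; split; lra.
case: (leP (u - 3) 0) => u3.
  have p0 : 0 <= 3 - u by lra.
  have := cub _ p0.
  have p1 : 0 <= (u - 2) * (3 - u) by rewrite mulr_ge0//; lra.
  have p2 : 0 <= (u - 2) * ((u - 2) * (3 - u)) by rewrite mulr_ge0//; lra.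
  have p3 : 0 <= (3 - u) * ((u - 2) * (3 - u)) by rewrite mulr_ge0//; lra.
  by rewrite ?expr0n/=; move=> *; apply/andP; split; lra.
by move=> *; apply/andP; split; lra.
Qed.

Lemma step_le0 u : u <= 0 -> step u = 1.
Proof.
move=> u0; rewrite /step /cube_pos !max_r ?expr0n/=; lra.
Qed.

Lemma step_ge3 u : 3 <= u -> step u = 0.
Proof.
by move=> u0; rewrite /step /cube_pos !max_l; try lra; field.
Qed.

(** The spline coefficients 1/6, 1/2, 1/2, 1/6 add up to 4/3, rounded up to 2. *)
Lemma taylor2_step : taylor2 2 step.
Proof.
have T := taylor2_cube_pos.
have T0 : taylor2 0 (fun _ : R => 1 : R).
  by exists (fun=> 0), (fun=> 0) => u h; rewrite !mulr0 !subr0 subrr normr0 mul0r.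
have := taylor2_lin (- 1 / 6) T (taylor2_lin (1 / 2) (taylor2_shift (- 1) T)
  (taylor2_lin (- 1 / 2) (taylor2_shift (- 2) T) (taylor2_lin (1 / 6) (taylor2_shift (- 3) T) T0))).
have n1 : `|- 1 / 6 : R| = 1 / 6 by rewrite ler0_norm; lra.
have n2 : `|1 / 2 : R| = 1 / 2 by rewrite ger0_norm; lra.
have n3 : `|- 1 / 2 : R| = 1 / 2 by rewrite ler0_norm; lra.
have n4 : `|1 / 6 : R| = 1 / 6 by rewrite ger0_norm; lra.
rewrite n1 n2 n3 n4 => -[A [B H]]; exists A, B => u h.
have := H u h; rewrite /step.
rewrite (_ : _ - _ - _ - _ = (1 - (cube_pos (u + h) - 3 * cube_pos (u + h - 1) +
  3 * cube_pos (u + h - 2) - cube_pos (u + h - 3)) / 6 -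
  (1 - (cube_pos u - 3 * cube_pos (u - 1) + 3 * cube_pos (u - 2) - cube_pos (u - 3)) / 6) -
  h * A u - h ^+ 2 * B u)); last by field.
move=> /le_trans; apply; apply: ler_wpM2r; rewrite ?exprn_ge0//; lra.
Qed.

Lemma measurable_step : measurable_fun setT step.
Proof.
have mc (a : R) : measurable_fun setT (fun u : R => cube_pos (u - a)).
  rewrite /cube_pos; apply: measurable_funX; apply: measurable_maxr => //.
  exact: measurable_funB.
have mc0 : measurable_fun setT cube_pos.
  by rewrite (_ : cube_pos = fun u => cube_pos (u - 0)) //; apply/funext => u; rewrite subr0.
apply: measurable_funB => //; apply: measurable_funM => //.
apply: measurable_funB => //; apply: measurable_funD; last exact: measurable_funM.
by apply: measurable_funB => //; exact: measurable_funM.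
Qed.

End TaylorClass.

(** * Lindeberg replacement *)

Section CentralLimit.
Context (R : realType) (mu : probability R R) (w : R -> R).
Hypothesis W : weight mu w.
Notation Ew := (Ew mu w).
Notation K := (stepop mu w).
Notation intw := (intw mu w).

Hypothesis i1 : intw (fun z => z).
Hypothesis i3 : intw (fun z => `|z| ^+ 3).
Let v := Ew (fun z => z).
Let var := Ew (fun z => (z - v) ^+ 2).
Hypothesis var0 : 0 < var.
Let s := Num.sqrt var.
Let m3 := Ew (fun z => `|z - v| ^+ 3).

Let s0 : 0 < s. Proof. by rewrite sqrtr_gt0. Qed.

Let ic3 : intw (fun z => `|z - v| ^+ 3).
Proof.
apply: (@intw_le _ _ _ W _ (fun z => 4 * `|z| ^+ 3 + 4 * `|v| ^+ 3)).
- by apply: measurable_funX; apply: measurableT_comp => //; exact: measurable_funB.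
- by apply: intwD; [exact: intwZ|exact: (intw_cst W)].
- move=> z; rewrite ger0_norm ?exprn_ge0//.
  have := normr_ge0 z; have := normr_ge0 v; have := ler_normB z v; have := normr_ge0 (z - v).
  move: `|z - v| `|z| `|v| => a b c a0 ab c0 b0.
  have : a ^+ 3 <= (b + c) ^+ 3 by rewrite lerXn2r// nnegrE; lra.
  have : 0 <= (b + c) * (b - c) ^+ 2 by rewrite mulr_ge0 ?sqr_ge0//; lra.
  lra.
Qed.

Let ic2 : intw (fun z => (z - v) ^+ 2).
Proof.
apply: (@intw_le _ _ _ W _ (fun z => 1 + `|z - v| ^+ 3)).
- by apply: measurable_funX; exact: measurable_funB.
- by apply: intwD => //; exact: (intw_cst W).
- move=> z; rewrite ger0_norm ?sqr_ge0// -(real_normK (num_real _)).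
  have := normr_ge0 (z - v); move: `|z - v| => a a0.
  case: (leP a 1) => a1; first by have := exprn_ge0 3 a0; nra.
  have : 0 <= a ^+ 2 * (a - 1) by rewrite mulr_ge0 ?sqr_ge0//; lra.
  lra.
Qed.

(** Both laws have mean [v] and variance [s ^+ 2], so the second-order expansions at [u - v] agree
    and only the cubic remainders are left. *)
Lemma lindeberg_step C f u : bmeas f -> taylor2 C f ->
  `|K f u - KR v s f u| <= C * (m3 + s ^+ 3).
Proof.
move=> bf [A [B H]]; set u' := u - v.
have ic1 : intw (fun z => z - v) by apply: intwB => //; exact: (intw_cst W).
pose q z := f u' + - A u' * (z - v) + B u' * (z - v) ^+ 2.
have iq : intw q.
  apply: intwD; last exact: intwZ.
  by apply: intwD; [exact: (intw_cst W)|exact: intwZ].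
have Eq : Ew q = f u' + B u' * s ^+ 2.
  rewrite /q EwD; [|by apply: intwD; [exact: (intw_cst W)|exact: intwZ]|exact: intwZ].
  rewrite EwD; [|exact: (intw_cst W)|exact: intwZ].
  rewrite (Ew_cst W) !EwZ// EwB//; last exact: (intw_cst W).
  by rewrite (Ew_cst W) subrr mulr0 addr0 sqr_sqrtr// ltW.
have ifu : intw (fun z => f (u - z)) by exact/(intw_bmeas W)/bmeas_refl.
have hC z : `|f (u - z) - q z| <= C * `|z - v| ^+ 3.
  have := H u' (- (z - v)); rewrite normrN /q.
  rewrite (_ : u' + - (z - v) = u - z); last by rewrite /u'; ring.
  by congr (`|_| <= _); ring.
have h1 : `|K f u - Ew q| <= C * m3.
  rewrite /stepop -EwB//; apply: (le_trans (ler_norm_Ew W _)); first exact: intwB.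
  rewrite /m3 -EwZ//; apply: (le_Ew W); [|exact: intwZ|exact: hC].
  apply: (@intw_le _ _ _ W _ (fun z => C * `|z - v| ^+ 3)); [|exact: intwZ|].
    apply: measurableT_comp => //; apply: measurable_funB.
      by case: (bmeas_refl u bf).
    rewrite /q; apply: measurable_funD; [apply: measurable_funD => //; apply: measurable_funM => //|apply: measurable_funM => //].
      exact: measurable_funB.
    by apply: measurable_funX; exact: measurable_funB.
  by move=> z; rewrite normr_id.
have h2 : `|KR v s f u - Ew q| <= C * s ^+ 3.
  have := H u' s; have := H u' (- s); rewrite normrN (gtr0_norm s0) Eq /KR -/u' sqrrN.
  by rewrite !ler_norml => /andP[? ?] /andP[? ?]; apply/andP; split; lra.
move: h1 h2; rewrite !ler_norml => /andP[? ?] /andP[? ?]; apply/andP; split; lra.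
Qed.

Lemma bmeas_KR f : bmeas f -> bmeas (KR v s f).
Proof.
move=> bf; rewrite /KR; apply: bmeasM; last exact: bmeas_cst.
apply: bmeasD; apply: (bmeas_comp (h := fun u => u - v + _)) => //.
  by apply: measurable_funB => //; exact: measurable_funB.
by apply: measurable_funD => //; exact: measurable_funB.
Qed.

(** Steps are exchanged one at a time, starting with the one applied first to [f]: [KR] preserves
    the constant [C], and [stepop] contracts the uniform norm. *)
Lemma lindeberg n C f u : bmeas f -> taylor2 C f ->
  `|iter n K f u - iter n (KR v s) f u| <= n%:R * (C * (m3 + s ^+ 3)).
Proof.
elim: n f u => [|n ih] f u bf tf; first by rewrite subrr normr0 mul0r.
rewrite !iterSr; have bk := bmeas_KR bf; have bK := bmeas_K W bf.
have := ih _ u bk (taylor2_KR v s tf).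
have : `|iter n K (K f) u - iter n K (KR v s f) u| <= C * (m3 + s ^+ 3).
  rewrite (_ : _ - _ = iter n K (fun z => K f z + (- 1) * KR v s f z) u); last first.
    by rewrite (iterKD W)// ?(iterKZ W)//; [ring|exact: bmeasZ].
  rewrite ler_norml; apply: (iterK_itv W).
    by apply: bmeasD => //; exact: bmeasZ.
  by move=> z; rewrite mulN1r -ler_norml; exact: lindeberg_step.
rewrite -natr1 mulrDl mul1r !ler_norml => /andP[? ?] /andP[? ?]; apply/andP; split; lra.
Qed.

(** The indicator is squeezed between two translates of [step] at a free scale [t], each with a
    transition of width [3 * t]. The first error is anti-concentration over that width, the second
    the cost of replacing [n] steps. *)
Lemma clt_bound n (t y : R) : 0 < t ->
  `|iter n K (fun z => (z <= 0)%R%:R) y - 1 / 2| <=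
  ((`|y - n%:R * v| + 3 * t) / s + 1) * (2 / Num.sqrt n.+1%:R) +
  n%:R * (2 / t ^+ 3 * (m3 + s ^+ 3)).
Proof.
move=> t0.
have bs a : bmeas (fun u => step ((u + a) / t)).
  apply: (bmeas_comp (h := fun u => (u + a) / t)).
    by apply: measurable_funM => //; exact: measurable_funD.
  split; first exact: measurable_step.
  by exists 1 => u; have /andP[? ?] := step_itv u; rewrite ger0_norm.
have ts a : taylor2 (2 / t ^+ 3) (fun u => step ((u + a) / t)).
  by apply: (taylor2_shift a (f := fun u => step (u / t))); apply: taylor2_scale => //; exact: taylor2_step.
have b0 := bmeas_le0 R.
have sp := ltW s0.
have tail c : `|c| <= `|y - n%:R * v| + 3 * t ->
    `|tailR s n c - 1 / 2| <= ((`|y - n%:R * v| + 3 * t) / s + 1) * (2 / Num.sqrt n.+1%:R).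
  move=> hc; apply: (le_trans (tailR_le s0 n c)); rewrite ler_wpM2r ?divr_ge0 ?sqrtr_ge0//.
  by rewrite lerD2r ler_pM2r ?invr_gt0.
have iterKR_le f g u : (forall z, f z <= g z) -> iter n (KR v s) f u <= iter n (KR v s) g u.
  move=> fg; rewrite !iterKR_bin ler_pM2r ?invr_gt0 ?exprn_gt0//.
  by apply: ler_sum => k _; rewrite ler_wpM2l.
have up : iter n K (fun z => (z <= 0)%R%:R) y <= iter n K (fun u => step ((u + 0) / t)) y.
  apply: (le_iterK W) => // z; rewrite addr0; case: (leP z 0) => z0.
    by rewrite step_le0// mulr_le0_ge0// invr_ge0 ltW.
  by rewrite mulr0n; have /andP[] := step_itv (z / t).
have lo : iter n K (fun u => step ((u + 3 * t) / t)) y <= iter n K (fun z => (z <= 0)%R%:R) y.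
  apply: (le_iterK W) => // z; case: (leP z 0) => z0.
    by rewrite mulr1n; have /andP[] := step_itv ((z + 3 * t) / t).
  by rewrite step_ge3// ler_pdivlMr//; lra.
have up2 : iter n (KR v s) (fun u => step ((u + 0) / t)) y <= tailR s n (y - n%:R * v - 3 * t).
  rewrite -iterKR_le0; apply: iterKR_le => z; rewrite addr0; case: (leP z (3 * t)) => z0.
    by rewrite mulr1n; have /andP[] := step_itv (z / t).
  by rewrite step_ge3// ler_pdivlMr//; lra.
have lo2 : tailR s n (y - n%:R * v + 3 * t) <= iter n (KR v s) (fun u => step ((u + 3 * t) / t)) y.
  rewrite -[3 * t in leLHS]opprK -iterKR_le0; apply: iterKR_le => z; case: (leP z (- (3 * t))) => z0.
    by rewrite step_le0// mulr_le0_ge0 ?invr_ge0 ?(ltW t0)//; lra.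
  by rewrite mulr0n; have /andP[] := step_itv ((z + 3 * t) / t).
have := lindeberg n y (bs 0) (ts 0); have := lindeberg n y (bs (3 * t)) (ts (3 * t)).
have : `|y - n%:R * v - 3 * t| <= `|y - n%:R * v| + 3 * t.
  by apply: (le_trans (ler_normB _ _)); rewrite [`|3 * t|]ger0_norm//; lra.
have : `|y - n%:R * v + 3 * t| <= `|y - n%:R * v| + 3 * t.
  by apply: (le_trans (ler_normD _ _)); rewrite [`|3 * t|]ger0_norm//; lra.
move=> /tail + /tail; rewrite !ler_norml.
move=> /andP[? ?] /andP[? ?] /andP[? ?] /andP[? ?]; apply/andP; split; lra.
Qed.

Theorem central_limit_median (eps : R) : 0 < eps -> exists2 d : R, 0 < d &
  exists N, forall n y, (N <= n)%N -> `|y - n%:R * v| <= d * Num.sqrt n%:R ->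
    `|iter n K (fun z => (z <= 0)%R%:R) y - 1 / 2| <= eps.
Proof.
(* Smoothing at scale [d * Num.sqrt n] makes the anti-concentration error [8 * d / s = eps / 4] up
   to a term [2 / Num.sqrt n], and the replacement error [Q / Num.sqrt n]. *)
move=> e0; pose d := eps * s / 32.
have d0 : 0 < d by rewrite divr_gt0// mulr_gt0.
pose Q : R := 2 / d ^+ 3 * (m3 + s ^+ 3).
have Q0 : 0 <= Q.
  rewrite mulr_ge0 ?divr_ge0 ?exprn_ge0 ?(ltW d0)// addr_ge0 ?exprn_ge0 ?(ltW s0)//.
  by apply: (Ew_ge0 W) => z; rewrite exprn_ge0.
pose B := (2 * (2 + Q) / eps) ^+ 2.
exists d => //; exists (Num.truncn B).+1 => n y nB hy.
have n0 : (0 : R) < n%:R by rewrite ltr0n (leq_trans _ nB).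
set r := Num.sqrt n%:R in hy.
have r0 : 0 < r by rewrite sqrtr_gt0.
have r2 : r ^+ 2 = n%:R by rewrite sqr_sqrtr// ltW.
have rB : 2 * (2 + Q) / eps <= r.
  rewrite -(@ler_pXn2r _ 2) ?nnegrE ?(ltW r0) ?divr_ge0 ?mulr_ge0 ?addr_ge0 ?(ltW e0)//.
  by rewrite r2 ltW// (lt_le_trans (truncnS_gt _))// ler_nat.
have rS : r <= Num.sqrt n.+1%:R by rewrite ler_sqrt// ler_nat.
have dr : 0 < d * r by rewrite mulr_gt0.
apply: (le_trans (clt_bound n y dr)).
have t1 : ((`|y - n%:R * v| + 3 * (d * r)) / s + 1) * (2 / Num.sqrt n.+1%:R) <=
    (4 * (d * r) / s + 1) * (2 / r).
  apply: ler_pM.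
  - by rewrite addr_ge0// divr_ge0 ?(ltW s0)// addr_ge0// mulr_ge0// ltW.
  - by rewrite divr_ge0// sqrtr_ge0.
  - by rewrite lerD2r ler_pM2r ?invr_gt0//; lra.
  - by rewrite ler_pM2l// lef_pV2// posrE// (lt_le_trans r0).
apply: (le_trans (lerD t1 (lexx _))).
have -> : (4 * (d * r) / s + 1) * (2 / r) = eps / 4 + 2 / r.
  by rewrite /d; field; rewrite !gt_eqF.
have -> : n%:R * (2 / (d * r) ^+ 3 * (m3 + s ^+ 3)) = Q / r.
  by rewrite -r2 /Q; field; rewrite !gt_eqF.
have : (2 + Q) / r <= eps / 2.
  by move: rB; rewrite ler_pdivrMr// => ?; rewrite ler_pdivrMr//; lra.
rewrite mulrDl; lra.
Qed.

End CentralLimit.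

(** * Hitting times of the random walk *)

Definition one {R : realType} (z : R) : R := 1.

Lemma weight_one (R : realType) (mu : probability R R) : weight mu one.
Proof.
have i1 : mu.-integrable setT (EFin \o one) by exact: finite_measure_integrable_cst.
have e1 : \int[mu]_z one z = 1.
  rewrite /one Rintegral_cst// mul1r.
  exact: (congr1 fine (probability_setT mu)).
have g0 (z : R) : 0 < one z by rewrite /one ltr01.
have m1 : measurable_fun setT (@one R) by exact: measurable_cst.
exact: (Weight g0 m1 i1 e1).
Qed.

Section KilledWalk.
Context (R : realType) (d : measure_display) (T : measurableType d)
  (P : probability T R) (X : {RV P >-> R}) (Xs : nat -> {RV P >-> R}).
Hypothesis hXs : iid_copies P (fun i => Xs i : T -> R) X.
Notation mu := (distribution P X).
Notation L := (killop mu one).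

Let mX i : measurable_fun setT (Xs i : T -> R). Proof. exact: measurable_funPT. Qed.

Definition cylinders n : set (set T) := [set E | exists A : nat -> set R,
  (forall i, measurable (A i)) /\
  E = \bigcap_(i in [set` iota 0 n]) ((Xs i : T -> R) @^-1` A i)].

Lemma measurable_cylinders n : cylinders n `<=` measurable.
Proof.
move=> _ [A [mA ->]]; apply: fin_bigcap_measurable => // i _.
by rewrite -[X in measurable X]setTI; exact: mX.
Qed.

Lemma cylinders_setI n : setI_closed (cylinders n).
Proof.
move=> _ _ [A [mA ->]] [B [mB ->]]; exists (fun i => A i `&` B i); split.
  by move=> i; exact: measurableI.
by rewrite -bigcapI.
Qed.

Lemma cylinders_indep n (E : set T) (B : set R) : measurable B -> cylinders n E ->
  P (E `&` (Xs n : T -> R) @^-1` B) = (P E * P ((Xs n : T -> R) @^-1` B))%E.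
Proof.
move=> mB [A [mA ->]].
pose A' i := if i == n then B else A i.
have mA' i : measurable (A' i) by rewrite /A'; case: eqP.
have nin : n \notin iota 0 n by rewrite mem_iota ltnn.
have eA i : i \in iota 0 n -> A' i = A i.
  by move=> hi; rewrite /A'; case: eqP => // e; move: hi; rewrite e (negbTE nin).
have u : uniq (n :: iota 0 n) by rewrite /= nin iota_uniq.
have := hXs.1 _ _ u mA'.
have e : A' n = B by rewrite /A' eqxx.
rewrite big_cons e (_ : \bigcap_(i in _) _ =
  \bigcap_(i in [set` iota 0 n]) ((Xs i : T -> R) @^-1` A i) `&` (Xs n : T -> R) @^-1` B); last first.
  apply/seteqP; split=> w /=.
    move=> h; split; last by have := h n; rewrite /A' eqxx; apply; rewrite /= mem_head.
    by move=> i /= hi; have := h i; rewrite eA//; apply; rewrite /= in_cons hi orbT.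
  move=> [h1 h2] i /=; rewrite in_cons => /predU1P[->|hi]; first by rewrite /A' eqxx.
  by rewrite eA//; exact: h1.
move=> ->; rewrite muleC; congr (_ * _)%E.
rewrite (hXs.1 _ _ (iota_uniq 0 n) mA); apply: eq_big_seq => i hi; by rewrite eA.
Qed.

Let F n := g_sigma_algebraType (cylinders n).

(** Dynkin's theorem extends independence from cylinders to the past of time [n]. Measurability in
    [T] is carried along because the complement and union steps use it. *)
Lemma past_indep n (E : set T) (B : set R) : measurable B -> <<s cylinders n >> E ->
  measurable E /\
  P (E `&` (Xs n : T -> R) @^-1` B) = (P E * P ((Xs n : T -> R) @^-1` B))%E.
Proof.
move=> mB; have mXB : measurable ((Xs n : T -> R) @^-1` B).
  by rewrite -[X in measurable X]setTI; exact: mX.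
move: E; apply: (@dynkin_induction _ (F n) (cylinders n) (fun E => d.-measurable E /\
  P (E `&` (Xs n : T -> R) @^-1` B) = (P E * P ((Xs n : T -> R) @^-1` B))%E)) => //.
- exact: cylinders_setI.
- by split; [exact: measurableT|rewrite setTI probability_setT mul1e].
- by move=> E cE; split; [exact: measurable_cylinders cE|exact: cylinders_indep].
- move=> E _ [mE hE]; split; first exact: measurableC.
  rewrite setIC -setDE measureD//; last by rewrite ltey_eq fin_num_measure.
  have hE' : P ((Xs n : T -> R) @^-1` B `&` E) = (P E * P ((Xs n : T -> R) @^-1` B))%E by rewrite setIC.
  rewrite probability_setC// [X in (_ - X)%E]hE'.
  have [p ->] : exists p : R, P E = p%:E.
    by exists (fine (P E)); rewrite fineK ?fin_num_measure.
  have [q eq] : exists q : R, P ((Xs n : T -> R) @^-1` B) = q%:E.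
    by exists (fine (P ((Xs n : T -> R) @^-1` B))); rewrite fineK ?fin_num_measure.
  by rewrite eq [X in (X - _)%E]eq -EFinM -!EFinB -EFinM mulrBl mul1r.
- move=> G _ tG hG; have mG k := (hG k).1.
  split; first exact: bigcup_measurable.
  rewrite setI_bigcupl !measure_bigcup//; first last.
  + by apply: trivIset_setIr.
  + by move=> k _; exact: measurableI.
  have [q eq] : exists q : R, P ((Xs n : T -> R) @^-1` B) = q%:E.
    by exists (fine (P ((Xs n : T -> R) @^-1` B))); rewrite fineK ?fin_num_measure.
  rewrite eq muleC -nneseriesZl//.
  by apply: eq_eseriesr => k _; apply: (etrans (hG k).2); rewrite eq muleC.
Qed.

(** Path version of [killop]: the remaining distance to [x], frozen once it is nonpositive. *)
Fixpoint killed (x : R) n (w : T) : R :=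
  if n is m.+1 then
    (if killed x m w <= 0 then killed x m w else killed x m w - Xs m w) else x.

Lemma measurable_past n j : (j < n)%N -> measurable_fun (setT : set (F n)) (Xs j : T -> R).
Proof.
move=> jn _ B mB; rewrite setTI; apply: sub_gen_smallest.
exists (fun i => if i == j then B else setT); split; first by move=> i; case: eqP.
apply/seteqP; split=> w /=; first by move=> h i /= _; case: eqP => [->|].
by move=> /(_ j); rewrite /= eqxx; apply; rewrite mem_iota.
Qed.

Lemma measurable_killed_past x n j : (j <= n)%N ->
  measurable_fun (setT : set (F n)) (killed x j).
Proof.
elim: j => [|j ih] jn /=; first exact: measurable_cst.
have mk := ih (ltnW jn).
apply: measurable_fun_ifT => //; first exact: measurable_fun_ler.
by apply: measurable_funB => //; exact: measurable_past.
Qed.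

Lemma measurable_killed x n : measurable_fun setT (killed x n).
Proof.
elim: n => [|n ih] /=; first exact: measurable_cst.
apply: measurable_fun_ifT => //; first exact: measurable_fun_ler.
exact: measurable_funB.
Qed.

Lemma killed_indep x n (A B : set R) : measurable A -> measurable B ->
  P (killed x n @^-1` A `&` (Xs n : T -> R) @^-1` B) = (P (killed x n @^-1` A) * mu B)%E.
Proof.
move=> mA mB; have sA : <<s cylinders n >> (killed x n @^-1` A).
  by have := measurable_killed_past x (leqnn n) measurableT mA; rewrite setTI.
by rewrite (past_indep mB sA).2; congr (_ * _)%E; exact: hXs.2.
Qed.

(** By independence the state at time [n] and the next increment have a product law; Tonelli
    integrates out the latter, which is one application of [killop] to [f]. *)
Lemma integral_killed x n f : bmeas f -> (forall u, 0 <= f u) ->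
  (\int[P]_w (f (killed x n w))%:E = (iter n L f x)%:E)%E.
Proof.
have W := weight_one mu.
elim: n f => [|n ih] f bf f0.
  by rewrite /= integral_cst// [X in (_ * X)%E]probability_setT mule1.
rewrite iterSr -ih; last 2 first.
- exact: bmeas_L.
- by move=> u; rewrite /killop; case: ifP => // _; exact: (K_ge0 W).
pose V : {mfun T >-> R} := HB.pack (killed x n) (isMeasurableFun.Build _ _ _ _ _ (measurable_killed x n)).
pose VX (w : T) := (killed x n w, Xs n w).
have mVX : measurable_fun setT VX.
  by apply: measurable_fun_pair => //; exact: measurable_killed.
pose VX' : {mfun T >-> (R * R)%type} := HB.pack VX (isMeasurableFun.Build _ _ _ _ _ mVX).
pose Phi (p : R * R) : \bar R := (if p.1 <= 0 then f p.1 else f (p.1 - p.2))%:E.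
have mPhi : measurable_fun setT Phi.
  apply/measurable_EFinP; apply: measurable_fun_ifT.
  - exact: measurable_fun_ler.
  - by apply: (measurableT_comp bf.1).
  - by apply: (measurableT_comp bf.1); exact: measurable_funB.
have Phi0 p : (0 <= Phi p)%E by rewrite lee_fin; case: ifP.
transitivity (\int[distribution P VX']_p Phi p)%E.
  rewrite ge0_integral_distribution//; apply: eq_integral => w _ /=.
  by rewrite /Phi /=; case: ifP.
transitivity (\int[(distribution P V \x mu)%E]_p Phi p)%E.
  apply: eq_measure_integral => C mC _; apply/esym; apply: product_measure_unique => //.
  by move=> A B mA mB; exact: killed_indep.
rewrite (fubini_tonelli1 Phi)// /fubini_F.
transitivity (\int[distribution P V]_v (L f v)%:E)%E.
  apply: eq_integral => v _; rewrite /Phi /killop /=; case: ifP => v0.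
    by rewrite integral_cst// [X in (_ * X)%E]probability_setT mule1.
  rewrite /stepop /Ew /Rintegral fineK.
    by apply: eq_integral => y _; rewrite mulr1.
  exact: (integrable_fin_num _ (intw_bmeas W (bmeas_refl v bf))).
rewrite ge0_integral_distribution//.
- by apply/measurable_EFinP; case: (bmeas_L W bf).
- by move=> y; rewrite lee_fin /killop; case: ifP => // _; exact: (K_ge0 W).
Qed.

Notation Z := (walk (fun i => Xs i : T -> R)).

Lemma killedP x n w : (killed x n w <= 0 <-> exists2 t, (t <= n)%N & x <= Z t w) /\
  (0 < killed x n w -> killed x n w = x - Z n w).
Proof.
have ZS m : Z m.+1 w = Z m w + Xs m w by rewrite /walk big_ord_recr.
elim: n => [|n [ih1 ih2]] /=.
  split; last by rewrite /walk big_ord0 subr0.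
  split=> [x0|[t]]; first by exists 0%N => //; rewrite /walk big_ord0.
  by rewrite leqn0 => /eqP ->; rewrite /walk big_ord0.
case: ifPn => [k0|]; last rewrite -ltNge => k0.
  split; last by rewrite ltNge k0.
  split=> // _; have [t tn xt] := ih1.1 k0; by exists t => //; exact: leqW.
rewrite (ih2 k0) ZS; split; last by move=> _; ring.
split=> [h|[t tn xt]]; first by exists n.+1 => //; rewrite ZS; lra.
move: tn; rewrite leq_eqVlt => /predU1P[e|tn]; first by rewrite e ZS in xt; lra.
by have := ih1.2 (ex_intro2 _ _ t tn xt); rewrite leNgt k0.
Qed.

(** Hitting times are integers or [+oo], so a real deadline may be truncated. Comparing strictly
    with the next integer yields an actual visit from the infimum. *)
Lemma hitting_timeP x (r : R) w : 0 <= r ->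
  (hitting_time Z x w <= r%:E)%E <-> killed x (Num.truncn r) w <= 0.
Proof.
move=> r0; rewrite (killedP x _ w).1; split; last first.
  move=> [t tr xt]; apply: (@le_trans _ _ (t%:R)%:E).
    by apply: ereal_inf_lbound; exists t.
  by rewrite lee_fin (le_trans _ (_ : (Num.truncn r)%:R <= r))// ?ler_nat// truncn_le.
move=> h; have : (hitting_time Z x w < ((Num.truncn r).+1%:R)%:E)%E.
  by apply: (le_lt_trans h); rewrite lte_fin truncnS_gt.
move=> /ereal_inf_lt [_ [t xt <-]]; rewrite lte_fin ltr_nat ltnS => tr.
by exists t.
Qed.

Lemma prob_hitting_time x (r : R) : 0 <= r ->
  P [set w | (hitting_time Z x w <= r%:E)%E] =
  (iter (Num.truncn r) L (fun u => (u <= 0)%R%:R) x)%:E.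
Proof.
move=> r0; rewrite -integral_killed; [|exact: bmeas_le0|by []].
have mk : measurable [set w | killed x (Num.truncn r) w <= 0].
  have := measurable_fun_ler (measurable_killed x (Num.truncn r)) (measurable_cst (0 : R)).
  by move=> /(_ measurableT [set true]) /(_ I); rewrite setTI.
rewrite (_ : [set w | _] = [set w | killed x (Num.truncn r) w <= 0]); last first.
  by apply/seteqP; split=> w /= /(hitting_timeP _ _ r0).
rewrite -(setIT [set w | _]) -integral_indic//; apply: eq_integral => w _.
rewrite indicE; congr (_%:R%:E); apply: congr1; apply/idP/idP; by rewrite inE.
Qed.

End KilledWalk.

(** * Exponential tilting *)

Section Tilting.
Context (R : realType) (mu : probability R R).
Notation phi := (mgf mu one).
Notation fin t := (intw mu one (fun z => expR (t * z))).

Definition tilt (t z : R) : R := expR (t * z) / phi t.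

Let mexp (t : R) : measurable_fun setT (fun z : R => expR (t * z)).
Proof.
apply: measurableT_comp; first exact: measurable_expR.
exact: measurable_funM.
Qed.

Lemma phi_gt0 t : fin t -> 0 < phi t.
Proof.
move=> ft; apply: (@Ew_gt0 _ mu one (weight_one mu) setT) => //.
- by rewrite probability_setT.
- by move=> z _; exact: expR_gt0.
Qed.

Section At.
Variable t : R.
Hypothesis ft : fin t.
Let p0 := phi_gt0 ft.
Notation w := (tilt t).

Lemma intw_tilt f : intw mu one (fun z => f z * expR (t * z)) -> intw mu w f.
Proof.
move=> h; have := intwZ (phi t)^-1 h.
rewrite /intw; congr (mu.-integrable _ _); apply/funext => z /=.
by rewrite /one /tilt; congr EFin; ring.
Qed.

Lemma Ew_tilt f : intw mu one (fun z => f z * expR (t * z)) ->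
  Ew mu w f = (phi t)^-1 * Ew mu one (fun z => f z * expR (t * z)).
Proof.
move=> h; rewrite -EwZ//; apply: eq_Rintegral => z _.
by rewrite /one /tilt; ring.
Qed.

Lemma weight_tilt : weight mu w.
Proof.
have i1 : mu.-integrable setT (EFin \o w).
  have := @intw_tilt (fun=> 1).
  rewrite (_ : (fun z => _) = (fun z => expR (t * z))); last by apply/funext => z; rewrite mul1r.
  by move=> /(_ ft); rewrite /intw; congr (mu.-integrable _ _); apply/funext => z /=; rewrite mul1r.
split=> //.
- by move=> z; rewrite /tilt divr_gt0// expR_gt0.
- by apply: measurable_funM => //; exact: mexp.
- have e : (fun z => 1 * expR (t * z)) = (fun z => expR (t * z)).
    by apply/funext => z; rewrite mul1r.
  have := @Ew_tilt (fun=> 1); rewrite e => /(_ ft).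
  rewrite -/(mgf mu one t) mulVf ?gt_eqF// => <-.
  by apply: eq_Rintegral => z _; rewrite mul1r.
Qed.

Let expM (s : R) : (fun z => expR (s * z) * expR (t * z)) = (fun z => expR ((t + s) * z)).
Proof. by apply/funext => z; rewrite -expRD; congr expR; ring. Qed.

Lemma intw_tilt_exp s : fin (t + s) -> intw mu w (fun z => expR (s * z)).
Proof. by move=> h; apply: intw_tilt; rewrite expM. Qed.

Lemma mgf_tilt s : fin (t + s) -> mgf mu w s = phi (t + s) / phi t.
Proof. by move=> h; rewrite /mgf Ew_tilt ?expM// mulrC. Qed.

(** Jensen's inequality, through the tangent of [expR] at [s * v]: the logarithm of [phi] lies above
    its tangent at [t]. *)
Lemma tangent s : intw mu w (fun z => z) -> fin (t + s) ->
  phi t * expR (s * Ew mu w (fun z => z)) <= phi (t + s).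
Proof.
move=> iz fs; set v := Ew mu w _.
have : expR (s * v) <= mgf mu w s.
  have i1 : intw mu w (fun z => expR (s * v) * (1 - s * v) + expR (s * v) * s * z).
    by apply: intwD; [exact: (intw_cst weight_tilt)|exact: intwZ].
  have -> : expR (s * v) = Ew mu w (fun z => expR (s * v) * (1 - s * v) + expR (s * v) * s * z).
    rewrite EwD//; [|exact: (intw_cst weight_tilt)|exact: intwZ].
    by rewrite (Ew_cst weight_tilt) EwZ// -/v; ring.
  apply: (le_Ew weight_tilt) => //; first exact: intw_tilt_exp.
  move=> z; rewrite (_ : _ + _ = expR (s * v) * (1 + s * (z - v))); last by ring.
  rewrite (_ : s * z = s * v + s * (z - v)); last by ring.
  by rewrite expRD ler_wpM2l ?expR_ge0// expR_ge1Dx.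
by rewrite (mgf_tilt fs) (ler_pdivlMr _ _ p0) mulrC.
Qed.

Section Moments.
Variable h : R.
Hypotheses (h0 : 0 < h) (fp : fin (t + h)) (fm : fin (t - h)).

(** Cubing [y <= expR y] at [y = h * |z| / 3] gives the constant [27 / h ^+ 3]. *)
Lemma intw_tilt_cube : intw mu w (fun z => `|z| ^+ 3).
Proof.
have i1 : intw mu w (fun z => (27 / h ^+ 3) * (expR (h * z) + expR (- h * z))).
  by apply/intwZ/intwD; apply: intw_tilt_exp.
apply: (intw_le weight_tilt _ i1).
  by apply: measurable_funX; exact: (measurableT_comp (@normr_measurable R setT)).
move=> z; rewrite ger0_norm ?exprn_ge0//.
have a0 : 0 <= `|z| by [].
have e1 : (h * `|z| / 3) ^+ 3 <= expR (h * `|z|).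
  rewrite [leRHS](_ : _ = expR (h * `|z| / 3) ^+ 3); last first.
    by rewrite -expRM_natl; congr expR; rewrite -(mulr_natl _ 3); field.
  apply: lerXn2r; rewrite ?nnegrE ?expR_ge0// ?divr_ge0 ?mulr_ge0 ?(ltW h0)//.
  by apply: le_trans (expR_ge1Dx _); rewrite lerDr.
have e2 : expR (h * `|z|) <= expR (h * z) + expR (- h * z).
  have := expR_ge0 (h * z); have := expR_ge0 (- h * z).
  by case: (ger0P z) => _; rewrite ?mulNr ?mulrN => *; lra.
apply: le_trans (ler_wpM2l _ (le_trans e1 e2)); last by rewrite divr_ge0// exprn_ge0// ltW.
by rewrite le_eqVlt; apply/orP; left; apply/eqP; field; rewrite gt_eqF.
Qed.

Lemma intw_tilt_id : intw mu w (fun z => z).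
Proof.
apply: (intw_le weight_tilt _ (intwD (intw_cst weight_tilt 1) intw_tilt_cube)) => //.
move=> z; have [z1|z1] := leP `|z| 1.
  by rewrite (le_trans z1)// lerDl exprn_ge0.
by rewrite -[leLHS]expr1 (le_trans (ler_weXn2l (ltW z1) _ : _ <= `|z| ^+ 3))// lerDr.
Qed.

Lemma intw_tilt_sqr c : intw mu w (fun z => (z - c) ^+ 2).
Proof.
have i2 : intw mu w (fun z => z ^+ 2).
  apply: (intw_le weight_tilt _ (intwD (intw_cst weight_tilt 1) intw_tilt_cube)).
    exact: measurable_funX.
  move=> z; rewrite normrX; have [z1|z1] := leP `|z| 1.
    by apply: (@le_trans _ _ 1); rewrite ?lerDl ?exprn_ge0// exprn_ile1.
  by rewrite (le_trans (ler_weXn2l (ltW z1) _ : _ <= `|z| ^+ 3))// lerDr.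
rewrite (_ : (fun z => _) = (fun z => (z ^+ 2 + (- 2 * c) * z) + c ^+ 2)).
  apply: intwD; last exact: (intw_cst weight_tilt).
  by apply: intwD => //; apply: intwZ; exact: intw_tilt_id.
by apply/funext => z; ring.
Qed.

Lemma variance_tilt_gt0 c : (0 < mu (~` [set c]))%E ->
  0 < Ew mu w (fun z => (z - c) ^+ 2).
Proof.
move=> m0; apply: (@Ew_gt0 _ mu w weight_tilt (~` [set c])) => //.
- exact: measurableC.
- exact: intw_tilt_sqr.
- by move=> z; exact: sqr_ge0.
- by move=> z /= /eqP zc; rewrite exprn_even_gt0//= subr_eq0.
Qed.

(* The tilted expectation of [t z - 1 + expR (- t z) >= 0] is [t] times the mean. *)
Lemma mean_tilt_gt0 : phi t = 1 -> 0 < t -> (0 < mu `]0%R, +oo[%classic)%E ->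
  0 < Ew mu w (fun z => z).
Proof.
move=> p1 t0 m0.
have f0 : fin 0.
  rewrite (_ : (fun z => _) = (fun=> 1)); first exact: (intw_cst (weight_one mu)).
  by apply/funext => z; rewrite mul0r expR0.
have phi0 : phi 0 = 1.
  rewrite /mgf -[RHS](Ew_cst (weight_one mu)); apply: eq_Ew => z.
  by rewrite mul0r expR0.
have ie : intw mu w (fun z => expR (- t * z)) by apply: intw_tilt_exp; rewrite subrr.
have i1 : intw mu w (fun z => t * z - 1).
  apply: intwB; first by apply: intwZ; exact: intw_tilt_id.
  exact: (intw_cst weight_tilt).
have : 0 < Ew mu w (fun z => (t * z - 1) + expR (- t * z)).
  apply: (@Ew_gt0 _ mu w weight_tilt `]0%R, +oo[%classic) => //.
  - exact: intwD.
  - by move=> z; have := expR_ge1Dx (- t * z); lra.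
  - move=> z /=; rewrite in_itv/= andbT => z0.
    have := @expR_gt1Dx _ (- t * z); rewrite mulf_neq0 ?oppr_eq0 ?gt_eqF//.
    by move=> /(_ isT); lra.
rewrite EwD// EwB; [|by apply: intwZ; exact: intw_tilt_id|exact: (intw_cst weight_tilt)].
rewrite (Ew_cst weight_tilt) EwZ; last exact: intw_tilt_id.
rewrite -/(mgf mu w (- t)) mgf_tilt subrr// phi0 p1 divr1.
by rewrite subrK pmulr_rgt0.
Qed.

End Moments.
End At.

Section Interior.
Variables t e : R.
Hypothesis e0 : (0 : R) < e.
Hypothesis fe : forall s : R, `|s| < e -> fin (t + s).
Hypothesis de : forall s : R, `|s| < e -> derivable phi (t + s) 1.
Notation v := (Ew mu (tilt t) (fun z => z)).

Lemma fin_center : fin t.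
Proof. by rewrite -[t]addr0; apply: fe; rewrite normr0. Qed.

Let fp : fin (t + e / 2). Proof. by apply: fe; rewrite ger0_norm; have := e0; lra. Qed.
Let fm : fin (t - e / 2). Proof. by apply: fe; rewrite normrN ger0_norm; have := e0; lra. Qed.
Let eh0 : 0 < e / 2. Proof. by have := e0; lra. Qed.

Lemma int_center : intw mu (tilt t) (fun z => z).
Proof. exact: (intw_tilt_id fin_center eh0 fp fm). Qed.

(** By [tangent], [phi] minus its exponential tangent is minimal at [t], where its derivative must
    vanish. This avoids differentiating under the integral. *)
Lemma is_derive_mgf : is_derive t (1 : R) phi (phi t * v).
Proof.
pose D (s : R) : R := phi s - phi t * expR ((s - t) * v).
have dE (s : R) : is_derive s (1 : R) (fun s => phi t * expR ((s - t) * v)) (phi t * (v * expR ((s - t) * v))).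
  by apply: is_derive_eq; rewrite /GRing.scale/=; ring.
have dphi (s : R) : s \in `]t - e, t + e[ -> derivable phi s 1.
  rewrite in_itv/= => /andP[s1 s2]; rewrite -[s](subrKC t); apply: de.
  by rewrite ltr_norml; apply/andP; split; lra.
have dD (s : R) : s \in `]t - e, t + e[ -> derivable D s 1.
  by move=> hs; apply: derivableB; [exact: dphi|exact: (@ex_derive _ _ _ _ _ _ _ (dE s))].
have tin : t \in `]t - e, t + e[ by have := e0; rewrite in_itv/= => ?; apply/andP; split; lra.
have Dt : D t = 0 by rewrite /D subrr mul0r expR0 mulr1 subrr.
have h1 : t - e <= t + e by have := e0; lra.
have h2 := derive1_at_min h1 dD tin.
have h3 : is_derive t (1 : R) D 0.
  apply: h2 => s; rewrite in_itv/= => /andP[s1 s2]; rewrite Dt /D subr_ge0.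
  have := @tangent t fin_center (s - t) int_center; rewrite subrKC; apply.
  rewrite -[X in fin X](subrKC t); apply: fe.
  by rewrite ltr_norml; apply/andP; split; lra.
have := is_deriveD h3 (dE t).
rewrite subrr mul0r expR0 mulr1 add0r (_ : D + _ = phi) => [//|].
by apply/funext => s; exact: subrK.
Qed.

(** First-order converse of [tangent]: differentiability bounds [phi (t + h)] by
    [phi t * (1 + h * v + |h| * k)] for small [h]. *)
Lemma chernoff_upper (k : R) : 0 < k -> exists2 r : R, 0 < r & forall h : R,
  `|h| < r -> fin (t + h) /\ phi (t + h) <= phi t * expR (h * v + `|h| * k).
Proof.
move=> k0; have p0 := phi_gt0 fin_center.
have [dphi vphi] := is_derive_mgf.
have pk : 0 < phi t * k by rewrite mulr_gt0.
pose F (h : R) : R := h^-1 * (phi (h + t) - phi t).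
have : F h @[h --> (0 : R)^'] --> phi t * v.
  rewrite -vphi; move: dphi; rewrite /derivable /derive.
  set G := (fun h => _); have -> : G = F by apply/funext => h; rewrite /G /F/= [h%:A]mulr1.
  exact.
move=> /cvgr_dist_lt /(_ _ pk).
move=> /nbhs_ballP[r /= r0 hr].
exists (Num.min r e); first by rewrite lt_min r0.
move=> h; rewrite lt_min => /andP[h1 h2]; split; first exact: fe.
have [->|hn0] := eqVneq h 0; first by rewrite addr0 normr0 !mul0r addr0 expR0 mulr1.
have := hr h; rewrite /ball/= sub0r normrN => /(_ h1 hn0).
rewrite /F => hh.
have : `|h| * `|phi t * v - h^-1 * (phi (h + t) - phi t)| <= `|h| * (phi t * k).
  by rewrite ler_wpM2l// ltW.
rewrite -normrM mulrBr (mulrA h h^-1) mulfV// mul1r => {}hh.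
have h4 : phi (t + h) - phi t <= h * (phi t * v) + `|h| * (phi t * k).
  by move: hh; rewrite distrC [h + t]addrC => /ler_normlW; rewrite lerBlDl.
apply: (@le_trans _ _ (phi t * (1 + (h * v + `|h| * k)))); last first.
  by rewrite ler_pM2l// expR_ge1Dx.
rewrite (_ : _ * _ = phi t + (h * (phi t * v) + `|h| * (phi t * k))); last by ring.
by rewrite -lerBlDl.
Qed.

End Interior.
End Tilting.

(** * Chernoff bounds and change of measure for hitting probabilities *)

Section Exponents.
Context (R : realType) (mu : probability R R).
Notation phi := (mgf mu one).
Notation fin t := (intw mu one (fun z => expR (t * z))).
Notation le0 := (fun u : R => (u <= 0)%R%:R : R).
Notation q n := (iter n (killop mu one) le0).
Let W1 := weight_one mu.

Lemma hit_itv n u : 0 <= q n u <= 1.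
Proof.
apply: (iterL_itv W1); first exact: bmeas_le0.
by move=> z; case: (z <= 0); rewrite ?lexx ?ler01.
Qed.

Lemma iterK_shift (w : R -> R) n f a u :
  iter n (stepop mu w) (fun v => f (v - a)) u = iter n (stepop mu w) f (u - a).
Proof.
elim: n u => //= n ih u; apply: eq_Ew => z; rewrite ih.
by congr (iter _ _ _ _); ring.
Qed.

Section At.
Variable t : R.
Hypothesis ft : fin t.

Let p0 := phi_gt0 ft.

Lemma hit_le_supermartingale (M : R) n u : 0 <= t -> 1 <= M -> phi t <= M ->
  q n u <= M ^+ n * expR (- t * u).
Proof.
move=> t0 M1 pM; elim: n u => [|n ih] u.
  rewrite expr0 mul1r /=; case: (leP u 0) => u0; rewrite ?mulr0n ?expR_ge0// mulr1n.
  by rewrite -expR0 ler_expR mulNr oppr_ge0 mulr_ge0_le0.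
rewrite iterS {1}/killop; case: (leP u 0) => u0.
  rewrite iterL_le0// u0 mulr1n -[leLHS]mul1r ler_pM//; first exact: exprn_ege1.
  by rewrite -expR0 ler_expR mulNr oppr_ge0 mulr_ge0_le0.
apply: (le_trans (K_le_exp W1 (b := - t) (c := M ^+ n) _ _ _ _)).
- exact: (bmeas_iterL W1 n (@bmeas_le0 R)).
- by rewrite opprK.
- exact: ih.
- rewrite opprK exprSr -!mulrA ler_wpM2l ?exprn_ge0//; first lra.
  by rewrite ler_wpM2r// expR_ge0.
Qed.

(** Markov property at time [m]: a later hit starts from some [v > 0], where its probability is at
    most [expR (- t * v)], and the walk must have survived [m] steps. *)
Lemma hit_sub_le m n u : 0 <= t -> phi t <= 1 -> (m <= n)%N ->
  q n u - q m u <= phi t ^+ m * expR (- t * u).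
Proof.
move=> t0 p1 mn; have bq k := bmeas_iterL W1 k (@bmeas_le0 R).
have -> : q n u - q m u = iter m (killop mu one) (fun v => q (n - m)%N v - le0 v) u.
  have -> : (fun v => q (n - m)%N v - le0 v) = (fun v => q (n - m)%N v + (-1) * le0 v).
    by apply/funext => v; rewrite mulN1r.
  rewrite (iterLD W1); [|exact: bq|exact/bmeasZ/bmeas_le0].
  by rewrite (iterLZ W1) ?mulN1r -?iterD ?subnKC//; exact: bmeas_le0.
have := @iterL_le_exp _ _ _ W1 m (fun v => q (n - m)%N v - le0 v) (- t) 1 u ler01.
rewrite opprK mul1r; apply=> //.
- by apply: bmeasB; [exact: bq|exact: bmeas_le0].
- move=> v; rewrite mul1r; have := @hit_le_supermartingale 1 (n - m)%N v t0 (lexx _) p1.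
  by rewrite expr1n mul1r; apply: le_trans; rewrite gerBl ler0n.
- by move=> v v0; rewrite iterL_le0// subrr.
Qed.

Lemma Ew_tilt_exp f u : bmeas f ->
  Ew mu (tilt mu t) (fun z => expR (t * (u - z)) * f (u - z)) =
  (phi t)^-1 * (expR (t * u) * stepop mu one f u).
Proof.
move=> bf; have ib := intw_bmeas W1 (bmeas_refl u bf).
have e : (fun z => expR (t * (u - z)) * f (u - z) * expR (t * z)) =
    (fun z => expR (t * u) * f (u - z)).
  by apply/funext => z; rewrite mulrAC -expRD; congr (expR _ * _); ring.
rewrite Ew_tilt// e; last exact: intwZ.
by rewrite EwZ.
Qed.

Lemma iterK_tilt f n u : bmeas f ->
  iter n (stepop mu (tilt mu t)) (fun v => expR (t * v) * f v) u =
  (phi t) ^- n * (expR (t * u) * iter n (stepop mu one) f u).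
Proof.
move=> bf; elim: n u => [|n ih] u; first by rewrite expr0 invr1 mul1r.
have bn := bmeas_iterK W1 n bf.
rewrite iterS {1}/stepop; under eq_Ew do rewrite ih.
have -> : (fun z => (phi t) ^- n * (expR (t * (u - z)) * iter n (stepop mu one) f (u - z))) =
  (fun z => (expR (t * (u - z)) * (phi t ^- n * iter n (stepop mu one) f (u - z)))).
  by apply/funext => z; rewrite mulrCA.
rewrite (@Ew_tilt_exp (fun v => phi t ^- n * iter n (stepop mu one) f v)); last exact: bmeasZ.
by rewrite (KZ W1)// [in RHS]iterS exprS invfM; ring.
Qed.

(** The stopped walk makes a random number of steps, so the normalising powers of [phi t] disappear
    only because [phi t = 1]. *)
Lemma cramern_tilt n u : phi t = 1 ->
  cramern mu (tilt mu t) t n u = expR (t * u) * q n u.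
Proof.
move=> p1; elim: n u => [|n ih] u; first by rewrite /cramern /cramer0 mulrC.
rewrite /cramern iterS {1}/killop; case: (leP u 0) => u0.
  by rewrite -/(cramern _ _ _ _) cramern_le0// iterL_le0// u0 mulr1.
rewrite [q n.+1]iterS [in RHS]/killop leNgt u0/=.
rewrite -/(cramern mu (tilt mu t) t n) {1}/stepop; under eq_Ew do rewrite ih.
by rewrite Ew_tilt_exp ?p1 ?invr1 ?mul1r//; exact: (bmeas_iterL W1 n (@bmeas_le0 R)).
Qed.

Lemma iterK_le_hit n u : iter n (stepop mu one) le0 u <= q n u.
Proof.
have b0 := @bmeas_le0 R.
elim: n u => // n ih u; case: (leP u 0) => u0.
  rewrite (iterL_le0 mu one)// u0.
  have h (z : R) : 0 <= le0 z <= 1 by case: (z <= 0); rewrite ?lexx ?ler01.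
  by have /andP[] := iterK_itv W1 n.+1 u b0 h.
rewrite 2!iterS /killop ifN -?ltNge//.
by apply: (le_K W1); [exact: (bmeas_iterK W1)|exact: (bmeas_iterL W1)|].
Qed.

End At.
End Exponents.

(** * The deadline *)

Section Deadline.
Context (R : realType).
Variables (v : R) (B : R -> R).
Hypothesis v0 : (0 : R) < v.
Hypothesis hB : forall e : R, 0 < e ->
  \forall x \near +oo, `|x - v * B x| <= e * Num.sqrt (B x).

Definition steps (N : nat) (x : R) : nat := Num.truncn (B x / N%:R).
Notation m := steps.

(** A bound on [B x] from above would bound [v * B x + Num.sqrt (B x)], hence [x]. Taking [M' >= 1]
    ensures that the square root of [M'] is at most [M']. *)
Lemma deadline_ge (M : R) : \forall x \near +oo, M <= B x.
Proof.
pose M' := Num.max M 1.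
near=> x.
have hx : v * M' + M' < x by near: x; apply: nbhs_pinfty_gt; exact: num_real.
have h : `|x - v * B x| <= 1 * Num.sqrt (B x) by near: x; exact: hB.
have [//|lt] := leP M (B x); exfalso.
have M1 : 1 <= M' by rewrite le_max lexx orbT.
have MM : M <= M' by rewrite le_max lexx.
have s0 : 0 <= M' by lra.
have sB : Num.sqrt (B x) <= M'.
  rewrite -[leRHS]ger0_norm// -sqrtr_sqr ler_wsqrtr//.
  by rewrite (le_trans (_ : B x <= M')) ?expr2 ?ler_peMr//; lra.
have vB : v * B x <= v * M' by rewrite ler_pM2l//; lra.
move: h; rewrite mul1r => /ler_normlW h; lra.
Unshelve. all: by end_near. Qed.

Lemma deadline_linear (e : R) : 0 < e -> \forall x \near +oo, `|x - v * B x| <= e * B x.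
Proof.
move=> e0; near=> x.
have h : `|x - v * B x| <= e * Num.sqrt (B x) by near: x; exact: hB.
have b1 : 1 <= B x by near: x; exact: deadline_ge.
rewrite (le_trans h)// ler_pM2l//.
rewrite -[leRHS]ger0_norm; last lra.
by rewrite -sqrtr_sqr ler_wsqrtr// expr2 ler_peMr//; lra.
Unshelve. all: by end_near. Qed.

Lemma steps_itv N x : 0 <= B x -> (m N x)%:R <= B x / N%:R < (m N x)%:R + 1.
Proof.
move=> b0; have h : 0 <= B x / N%:R by rewrite divr_ge0.
by rewrite natr1 truncn_le h truncnS_gt.
Qed.

(** Every exponent is measured on the scale [B x], with [x] close to [v * B x] and [m N x] to
    [B x / N]: a negative slope drives it to [-oo]. *)
Lemma linear_exponent (a b c M : R) N : (0 < N)%N -> a * v + b / N%:R + c < 0 ->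
  \forall x \near +oo, a * x + b * (m N x)%:R + c * (m 1%N x)%:R <= M.
Proof.
move=> N0; set s := (X in X < 0) => s0.
(* Replacing [x] by [v * B x] costs at most half of the slope; the other half beats the rounding
   errors and [M]. *)
pose e := - s / (2 * (`|a| + 1)).
have a1 : 0 < `|a| + 1 by rewrite ltr_wpDl.
have e0 : 0 < e by rewrite divr_gt0 ?mulr_gt0//; lra.
near=> x.
have b0 : 0 <= B x by near: x; exact: deadline_ge.
have bM : 2 * (`|b| + `|c| + `|M|) / - s <= B x by near: x; exact: deadline_ge.
have hl : `|x - v * B x| <= e * B x by near: x; exact: deadline_linear.
have [u1 u2] := andP (steps_itv N b0); have := steps_itv 1 b0.
rewrite divr1 => /andP[w1 w2].
have q1 : a * x <= a * v * B x + `|a| * (e * B x).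
  rewrite -lerBlDl (_ : _ - _ = a * (x - v * B x)); last by ring.
  by rewrite (le_trans (ler_norm _))// normrM ler_wpM2l.
have q2 : b * (m N x)%:R <= b / N%:R * B x + `|b|.
  rewrite -lerBlDl (_ : _ - _ = b * ((m N x)%:R - B x / N%:R)); last by ring.
  rewrite (le_trans (ler_norm _))// normrM ler_piMr// ler_norml; apply/andP; split; lra.
have q3 : c * (m 1%N x)%:R <= c * B x + `|c|.
  rewrite -lerBlDl (_ : _ - _ = c * ((m 1%N x)%:R - B x)); last by ring.
  rewrite (le_trans (ler_norm _))// normrM ler_piMr// ler_norml; apply/andP; split; lra.
have q4 : `|a| * (e * B x) <= - s / 2 * B x.
  rewrite mulrA ler_wpM2r// (_ : - s / 2 = (`|a| + 1) * e); last first.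
    by rewrite /e; field; rewrite gt_eqF.
  by rewrite ler_pM2r// lerDl.
have q5 : `|b| + `|c| + `|M| <= - s / 2 * B x.
  move: bM; rewrite ler_pdivrMr; last lra.
  by move=> h; rewrite (_ : - s / 2 * B x = (B x * - s) / 2); [lra|ring].
have q6 : s * B x = a * v * B x + b / N%:R * B x + c * B x by rewrite /s; ring.
have q7 : - s / 2 * B x = - (s * B x) / 2 by ring.
have := ler_norm (- M); rewrite normrN.
rewrite q7 in q4 q5; lra.
Unshelve. all: by end_near. Qed.

Lemma exp_exponent (a b c e : R) N : (0 < N)%N -> a * v + b / N%:R + c < 0 -> 0 < e ->
  \forall x \near +oo, expR (a * x + b * (m N x)%:R + c * (m 1%N x)%:R) <= e.
Proof.
move=> N0 s0 e0; have := linear_exponent (ln e) N0 s0.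
apply: filterS => x h; rewrite -[leRHS]lnK ?posrE//.
by rewrite ler_expR.
Qed.

Lemma steps_ge N (n : nat) : (0 < N)%N -> \forall x \near +oo, (n <= m N x)%N.
Proof.
move=> N0; near=> x.
have h : n%:R * N%:R <= B x by near: x; exact: deadline_ge.
by rewrite /steps truncn_ge_nat ?divr_ge0 ?ler_pdivlMr ?ltr0n// (le_trans _ h)// -natrM.
Unshelve. all: by end_near. Qed.

(** Here the precision [o(sqrt (B x))] of the deadline is used in full: it must be negligible
    against the fluctuations of the walk. The shift [C] and the truncation cost only a constant. *)
Lemma steps_central N (C e : R) : (0 < N)%N -> 0 < e ->
  \forall x \near +oo,
    `|(x - C) - (m N x)%:R * (N%:R * v)| <= e * Num.sqrt (m N x)%:R.
Proof.
move=> N0 e0.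
have Np : 0 < N%:R :> R by rewrite ltr0n.
pose s2 := Num.sqrt (2 * N%:R : R).
have s20 : 0 < s2 by rewrite sqrtr_gt0 mulr_gt0.
pose e1 := e / 2 / s2.
have e10 : 0 < e1 by rewrite !divr_gt0.
pose C1 := `|C| + N%:R * v.
have C10 : 0 <= C1 by rewrite addr_ge0// mulr_ge0// ltW.
near=> x.
have h : `|x - v * B x| <= e1 * Num.sqrt (B x) by near: x; exact: hB.
have b0 : 0 <= B x by near: x; exact: deadline_ge.
have m1 : (1 <= m N x)%N by near: x; exact: steps_ge.
have m2 : ((Num.truncn ((2 * C1 / e) ^+ 2)).+1 <= m N x)%N by near: x; exact: steps_ge.
have [u1 u2] := andP (steps_itv N b0).
set k := (m N x)%:R : R.
have k1 : 1 <= k by rewrite /k ler1n.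
have hB2 : B x <= 2 * N%:R * k.
  move: u2; rewrite ltr_pdivrMr// => /ltW u2; apply: (le_trans u2).
  rewrite -/k (_ : 2 * N%:R * k = (k + k) * N%:R); last by ring.
  by rewrite ler_pM2r// lerD2l.
have r1 : e1 * Num.sqrt (B x) <= e / 2 * Num.sqrt k.
  apply: (@le_trans _ _ (e1 * (s2 * Num.sqrt k))).
    by rewrite ler_pM2l// /s2 -sqrtrM ?mulr_ge0// ler_wsqrtr.
  by rewrite mulrA /e1 divfK// gt_eqF.
have r2 : C1 <= e / 2 * Num.sqrt k.
  have : 2 * C1 / e <= Num.sqrt k.
    rewrite -[leLHS]ger0_norm ?divr_ge0 ?mulr_ge0 ?(ltW e0)// -sqrtr_sqr ler_wsqrtr//.
    apply: (@le_trans _ _ (Num.truncn ((2 * C1 / e) ^+ 2)).+1%:R).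
      exact/ltW/truncnS_gt.
    by rewrite /k ler_nat.
  by rewrite ler_pdivrMr// => ?; lra.
have r3 : `|v * B x - k * (N%:R * v)| <= N%:R * v.
  rewrite (_ : _ - _ = (N%:R * v) * (B x / N%:R - k)); last by field; rewrite gt_eqF.
  rewrite normrM gtr0_norm ?mulr_gt0// ler_piMr ?mulr_ge0 ?(ltW v0)//.
  by rewrite ler_norml; apply/andP; split; rewrite -/k in u1 u2; lra.
rewrite (_ : _ - _ = (x - v * B x) + (v * B x - k * (N%:R * v)) + (- C)); last by ring.
apply: (le_trans (ler_normD _ _)); rewrite normrN.
have := ler_normD (x - v * B x) (v * B x - k * (N%:R * v)).
rewrite /C1 in r2; lra.
Unshelve. all: by end_near. Qed.

End Deadline.

(** * Racing particles against the deadline *)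

Section Race.
Context (R : realType) (mu : probability R R).
Notation phi := (mgf mu one).
Notation fin t := (intw mu one (fun z => expR (t * z))).
Notation le0 := (fun u : R => (u <= 0)%R%:R : R).
Notation q n := (iter n (killop mu one) le0).
Let W1 := weight_one mu.
Notation mean t := (Ew mu (tilt mu t) (fun z => z)).

Definition regular (t : R) := exists e : R, [/\ 0 < e,
  (forall s : R, `|s| < e -> fin (t + s)) &
  (forall s : R, `|s| < e -> derivable phi (t + s) 1)].

Lemma regular_fin t : regular t -> fin t.
Proof. by move=> [e [e0 fe _]]; exact: fin_center e0 fe. Qed.

Lemma regular_id t : regular t -> intw mu (tilt mu t) (fun z => z).
Proof. by move=> [e [e0 fe _]]; exact: int_center e0 fe. Qed.

Lemma regular_cube t : regular t -> intw mu (tilt mu t) (fun z => `|z| ^+ 3).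
Proof.
move=> rt; have ft := regular_fin rt; have [e [e0 fe _]] := rt.
apply: (@intw_tilt_cube _ _ _ ft (e / 2)); first lra.
  by apply: fe; rewrite ger0_norm; lra.
by apply: fe; rewrite normrN ger0_norm; lra.
Qed.

Lemma regular_variance t c : regular t -> (0 < mu (~` [set c]))%E ->
  0 < Ew mu (tilt mu t) (fun z => (z - c) ^+ 2).
Proof.
move=> rt; have ft := regular_fin rt; have [e [e0 fe _]] := rt.
apply: (@variance_tilt_gt0 _ _ _ ft (e / 2)); first lra.
  by apply: fe; rewrite ger0_norm; lra.
by apply: fe; rewrite normrN ger0_norm; lra.
Qed.

Lemma regular_mean_gt0 t : regular t -> phi t = 1 -> 0 < t ->
  (0 < mu `]0%R, +oo[%classic)%E -> 0 < mean t.
Proof.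
move=> rt; have ft := regular_fin rt; have [e [e0 fe _]] := rt.
apply: (@mean_tilt_gt0 _ _ _ ft (e / 2)); first lra.
  by apply: fe; rewrite ger0_norm; lra.
by apply: fe; rewrite normrN ger0_norm; lra.
Qed.

Lemma regular_chernoff t (k : R) : regular t -> 0 < k -> exists2 r : R, 0 < r & forall h : R,
  `|h| < r -> fin (t + h) /\ phi (t + h) <= phi t * expR (h * mean t + `|h| * k).
Proof. by move=> [e [e0 fe de]]; exact: chernoff_upper e0 fe de k. Qed.

Hypothesis nondegenerate : forall c, (0 < mu (~` [set c]))%E.

Variables (v : R) (B : R -> R).
Hypothesis v0 : (0 : R) < v.
Hypothesis hB : forall e : R, 0 < e ->
  \forall x \near +oo, `|x - v * B x| <= e * Num.sqrt (B x).
Notation m := (steps B).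

Lemma median_at_deadline t (N : nat) (C e : R) : regular t -> (0 < N)%N ->
  mean t = N%:R * v -> 0 < e ->
  \forall x \near +oo, `|iter (m N x) (stepop mu (tilt mu t)) le0 (x - C) - 1 / 2| <= e.
Proof.
move=> rt N0 vt e0; have ft := regular_fin rt.
have [d d0 [n0 hn]] := central_limit_median (weight_tilt ft) (regular_id rt)
  (regular_cube rt) (regular_variance rt (nondegenerate _)) e0.
near=> x; apply: hn; first by near: x; exact: (steps_ge v0 hB).
by rewrite vt; near: x; exact: (steps_central v0 hB).
Unshelve. all: by end_near. Qed.

(** * The tilt at the zero of [psi] *)

Section Subcritical.
Variable t : R.
Hypotheses (t0 : (0 : R) < t) (rt : regular t) (pt : phi t = 1) (vt0 : 0 < mean t).
Notation g := (cramer mu (tilt mu t) t).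
Notation G := (cramern mu (tilt mu t) t).

Let ft := regular_fin rt.
Let W := weight_tilt ft.

Lemma cramer_right : exists a : R, [/\ 0 < a,
  intw mu (tilt mu t) (fun z => expR (a * z)) & 1 < mgf mu (tilt mu t) a].
Proof.
have [e [e0 fe _]] := rt.
have fa : fin (t + e / 2) by apply: fe; rewrite ger0_norm; lra.
exists (e / 2); split; [lra|exact: intw_tilt_exp|].
rewrite mgf_tilt// pt divr1 (lt_le_trans _ (tangent ft (regular_id rt) fa))//.
by rewrite pt mul1r expR_gt1 mulr_gt0//; lra.
Qed.

Lemma cramer_left : exists b : R, [/\ 0 < b,
  intw mu (tilt mu t) (fun z => expR (- b * z)) & mgf mu (tilt mu t) (- b) < 1].
Proof.
have k0 : 0 < mean t / 2 by have := vt0; lra.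
have [r r0 hr] := regular_chernoff rt k0.
have [fb pb] : fin (t + - (r / 2)) /\
    phi (t + - (r / 2)) <= phi t * expR (- (r / 2) * mean t + `|- (r / 2)| * (mean t / 2)).
  by apply: hr; rewrite normrN ger0_norm; lra.
exists (r / 2); split; [lra|exact: intw_tilt_exp|].
rewrite mgf_tilt// pt divr1 (le_lt_trans pb)// pt mul1r expR_lt1.
rewrite normrN ger0_norm; last lra.
rewrite (_ : _ + _ = - (r / 4 * mean t)); last by field.
by rewrite oppr_lt0 mulr_gt0//; lra.
Qed.

Lemma cramer_gt0 : exists2 c : R, 0 < c & forall u : R, 0 < u -> c <= g u.
Proof.
have [a [a0 ia ma]] := cramer_right; have [b [b0 ib mb]] := cramer_left.
exact: (cramer_lb W t0 b0 ib mb a0 ia ma).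
Qed.

(** The limit of [q n x] in [n]: the probability that the untilted walk ever reaches [x]. *)
Definition ruin (x : R) : R := expR (- t * x) * g x.

Lemma hitE n x : q n x = expR (- t * x) * G n x.
Proof.
by rewrite cramern_tilt// mulrA -expRD mulNr addNr expR0 mul1r.
Qed.

Lemma hit_le_ruin n x : q n x <= ruin x.
Proof. by rewrite hitE ler_wpM2l ?expR_ge0//; exact: (cramern_le W t0). Qed.

Lemma ruin_le x : ruin x <= expR (- t * x).
Proof.
by rewrite /ruin ler_piMr ?expR_ge0//; have /andP[] := cramer_itv W t0 x.
Qed.

Lemma ruin_gt0 x : 0 < x -> 0 < ruin x.
Proof.
move=> x0; have [c c0 hc] := cramer_gt0.
by rewrite mulr_gt0 ?expR_gt0// (lt_le_trans c0 (hc _ x0)).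
Qed.

(* Chernoff's bound with an exponent just below [t] makes hits after the deadline rare. *)
Lemma hit_fast (N : nat) (e : R) : (0 < N)%N -> N%:R * v < mean t -> 0 < e ->
  \forall x \near +oo, (1 - e) * ruin x <= q (m N x) x.
Proof.
move=> N0 Nv e0; have [c c0 hc] := cramer_gt0.
have Np : (0 : R) < N%:R by rewrite ltr0n.
have Nvp : 0 < N%:R * v by rewrite mulr_gt0.
(* Half of the gap pays the first-order error, so the rate per step becomes the midpoint of [mean t]
   and [N%:R * v]. *)
have k0 : 0 < (mean t - N%:R * v) / 2 by lra.
have [r r0 hr] := regular_chernoff rt k0.
(* [h < r] permits the Chernoff bound, and [h <= t] keeps the exponent [t - h] nonnegative. *)
pose h : R := Num.min r t / 2.
have [hr2 ht2 h0] : [/\ h <= r / 2, h <= t / 2 & 0 < h].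
  split; rewrite /h.
  - by rewrite ler_pM2r// ge_min lexx.
  - by rewrite ler_pM2r// ge_min lexx orbT.
  - by rewrite divr_gt0// lt_min r0 t0.
have [fh ph] : fin (t + - h) /\ phi (t + - h) <= expR (- h * (mean t + N%:R * v) / 2).
  have [|f p] := hr (- h); first by rewrite normrN gtr0_norm//; lra.
  split=> //; apply: (le_trans p); rewrite pt mul1r ler_expR normrN gtr0_norm//.
  by rewrite le_eqVlt; apply/orP; left; apply/eqP; field.
have ph1 : phi (t + - h) <= 1.
  rewrite (le_trans ph)// expR_le1 mulNr mulNr oppr_le0.
  by rewrite divr_ge0// mulr_ge0 ?(ltW h0)//; have := vt0; lra.
have th0 : 0 <= t + - h by have := t0; lra.
have s0 : h * v + (- h * (mean t + N%:R * v) / 2) / N%:R + 0 < 0.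
  rewrite (_ : _ + _ = - h * (mean t - N%:R * v) / 2 / N%:R); last by field; rewrite gt_eqF.
  by rewrite mulNr !mulNr oppr_lt0 !divr_gt0// mulr_gt0//; lra.
near=> x.
have x0 : 0 < x by near: x; apply: nbhs_pinfty_gt; exact: num_real.
have hx : expR (h * x + (- h * (mean t + N%:R * v) / 2) * (m N x)%:R + 0 * (m 1%N x)%:R) <= e * c.
  by near: x; apply: (exp_exponent v0 hB) => //; rewrite mulr_gt0.
set k := m N x.
have hk : g x - G k x <= e * c.
  rewrite lerBlDr; apply: (@ler_cvg_to _ \oo _ _ (fun n => G n x) (fun=> e * c + G k x)).
  - exact: cramer_cvg.
  - exact: cvg_cst.
  near=> n.
  have kn : (k <= n)%N by near: n; exact: nbhs_infty_ge.
  rewrite -lerBlDr (le_trans _ hx)// mul0r addr0.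
  rewrite !cramern_tilt// -mulrBr.
  apply: (le_trans (ler_wpM2l (expR_ge0 _) (hit_sub_le fh x th0 ph1 kn))).
  rewrite mulrCA -expRD (_ : t * x + _ = h * x); last by ring.
  rewrite mulrC expRD expRM_natr ler_wpM2l ?expR_ge0//.
  by rewrite lerXn2r ?nnegrE ?expR_ge0 ?(mgf_ge0 W1).
rewrite hitE /ruin mulrCA ler_wpM2l ?expR_ge0//.
have := hc _ x0 => cg; have : e * c <= e * g x by rewrite ler_pM2l.
lra.
Unshelve. all: by end_near. Qed.

(** Mirror image of [hit_fast]: an exponent just above [t] makes hits before the deadline rare
    compared with [ruin x], since [g] is bounded below. *)
Lemma hit_slow (N : nat) (e : R) : (0 < N)%N -> mean t < N%:R * v -> 0 < e ->
  \forall x \near +oo, q (m N x) x <= e * ruin x.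
Proof.
move=> N0 Nv e0; have [c c0 hc] := cramer_gt0.
have Np : (0 : R) < N%:R by rewrite ltr0n.
have k0 : 0 < (N%:R * v - mean t) / 2 by lra.
have [r r0 hr] := regular_chernoff rt k0.
pose h := r / 2.
have h0 : 0 < h by rewrite /h; lra.
have [fh ph] : fin (t + h) /\ phi (t + h) <= expR (h * (mean t + N%:R * v) / 2).
  have [|f p] := hr h; first by rewrite gtr0_norm// /h; lra.
  split=> //; apply: (le_trans p); rewrite pt mul1r ler_expR gtr0_norm//.
  by rewrite le_eqVlt; apply/orP; left; apply/eqP; field.
have M1 : 1 <= expR (h * (mean t + N%:R * v) / 2).
  rewrite leNgt expR_lt1 -leNgt divr_ge0// mulr_ge0 ?(ltW h0)//.
  by have := vt0; lra.
have th0 : 0 <= t + h by have := t0; lra.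
have s0 : - h * v + (h * (mean t + N%:R * v) / 2) / N%:R + 0 < 0.
  rewrite (_ : _ + _ = - h * (N%:R * v - mean t) / 2 / N%:R); last by field; rewrite gt_eqF.
  by rewrite mulNr !mulNr oppr_lt0 !divr_gt0// mulr_gt0//; lra.
near=> x.
have x0 : 0 < x by near: x; apply: nbhs_pinfty_gt; exact: num_real.
have hx : expR (- h * x + (h * (mean t + N%:R * v) / 2) * (m N x)%:R + 0 * (m 1%N x)%:R) <= e * c.
  by near: x; apply: (exp_exponent v0 hB) => //; rewrite mulr_gt0.
apply: (le_trans (hit_le_supermartingale fh (m N x) x th0 M1 ph)).
rewrite -expRM_natr -expRD (_ : _ + _ = - t * x + (- h * x +
  (h * (mean t + N%:R * v) / 2) * (m N x)%:R + 0 * (m 1%N x)%:R)); last by ring.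
rewrite expRD /ruin mulrCA ler_wpM2l ?expR_ge0// (le_trans hx)// ler_pM2l//.
exact: hc.
Unshelve. all: by end_near. Qed.

(** The error is shared in three: decorrelation, return above [A] after a hit, and the central limit
    estimate at [x - (H + A)], where the fixed shift does not affect the median. *)
Lemma hit_critical (N : nat) (e : R) : (0 < N)%N -> mean t = N%:R * v -> 0 < e ->
  \forall x \near +oo, q (m N x) x <= (1 / 2 + e) * ruin x.
Proof.
move=> N0 Nv e0; have [c c0 hc] := cramer_gt0.
have [a [a0 ia ma]] := cramer_right; have [b [b0 ib mb]] := cramer_left.
have e3 : 0 < e / 3 by lra.
have ec : 0 < e / 3 * c by rewrite mulr_gt0.
have [H H0 hH] := decorrelation W t0 b0 ib mb a0 ia ma ec.
(* Chosen so that climbing back above [A] after a hit has probability at most [e / 3]. *)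
pose A : R := - ln (e / 3) / b.
have hA : expR (- (b * A)) = e / 3.
  by rewrite /A mulrCA divff ?gt_eqF// mulr1 opprK lnK.
near=> x.
have x0 : 0 < x by near: x; apply: nbhs_pinfty_gt; exact: num_real.
have xH : H < x by near: x; apply: nbhs_pinfty_gt; exact: num_real.
have hm : `|iter (m N x) (stepop mu (tilt mu t)) le0 (x - (H + A)) - 1 / 2| <= e / 3.
  by near: x; exact: median_at_deadline.
have h1 := hH x xH (m N x).
have := hit_le_end W (ltW b0) ib (ltW mb) (m N x) A (x - H).
rewrite hA.
have -> : iter (m N x) (stepop mu (tilt mu t)) (fun v : R => (v <= A)%R%:R) (x - H) =
    iter (m N x) (stepop mu (tilt mu t)) le0 (x - (H + A)).
  have -> : (fun v : R => (v <= A)%R%:R) = (fun v : R => (v - A <= 0)%R%:R : R).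
    by apply/funext => u; rewrite subr_le0.
  by rewrite (iterK_shift mu (tilt mu t) _ le0) opprD addrA.
move=> h2.
have /andP[g0 g1] := cramer_itv W t0 x.
rewrite hitE /ruin mulrCA ler_wpM2l ?expR_ge0//.
have cg := hc _ x0.
have e3c : e / 3 * c <= e / 3 * g x by rewrite ler_pM2l.
have h3 : iter (m N x) (killop mu (tilt mu t)) le0 (x - H) <= 1 / 2 + e / 3 + e / 3.
  by move: hm => /ler_normlW; lra.
have := ler_wpM2l g0 h3.
lra.
Unshelve. all: by end_near. Qed.

End Subcritical.

(** * Deadlines too short for the optimal tilt *)

Section Supercritical.
Variable l : R.
Hypotheses (l0 : (0 : R) < l) (rl : regular l) (vl : mean l = v).
Let fl := regular_fin rl.
Let W := weight_tilt fl.
Let pl0 := phi_gt0 fl.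

(* Under the tilt by [l] the walk is above [x] at the deadline with probability
   about 1/2, and then it overshoots [x] by less than [eta] times the number of
   steps. *)
Lemma hit_ge (eta : R) : 0 < eta -> \forall x \near +oo,
  1 / 4 * (phi l ^+ m 1%N x * expR (- l * x - l * eta * (m 1%N x)%:R)) <= q (m 1%N x) x.
Proof.
move=> eta0; have k0 : 0 < eta / 2 by lra.
have [r r0 hr] := regular_chernoff rl k0.
pose a : R := r / 2; have a0 : 0 < a by rewrite /a; lra.
have [fa pa] : fin (l + a) /\ phi (l + a) <= phi l * expR (a * mean l + `|a| * (eta / 2)).
  by apply: hr; rewrite gtr0_norm// /a; lra.
have ma : mgf mu (tilt mu l) a <= expR (a * (v + eta / 2)).
  rewrite mgf_tilt// ler_pdivrMr// mulrC (le_trans pa)// ler_pM2l// vl gtr0_norm//.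
  by rewrite ler_expR mulrDr.
have bf : bmeas (fun u : R => expR (l * u) * le0 u).
  have := bmeas_cramer0 l0; rewrite /cramer0.
  by congr bmeas; apply/funext => u; rewrite mulrC.
have N1 : (0 < 1)%N by [].
(* Overshooting by [eta * k] in [k] steps exceeds the tilted mean by [eta] per step; half of it pays
   the Chernoff error. *)
have s0 : - a * v + (a * (v - eta / 2)) / 1%:R + 0 < 0.
  by rewrite divr1 (_ : _ + _ = - (a * eta / 2)); [rewrite oppr_lt0 divr_gt0// mulr_gt0|ring].
(* The median error and the large overshoots lose 1/8 each, which leaves 1/4. *)
have e8 : (0 : R) < 1 / 8 by lra.
have v1 : mean l = 1%:R * v by rewrite mul1r.
near=> x.
have hx : expR (- a * x + a * (v - eta / 2) * (m 1%N x)%:R + 0 * (m 1%N x)%:R) <= 1 / 8.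
  by near: x; exact: (exp_exponent v0 hB).
have hm : `|iter (m 1%N x) (stepop mu (tilt mu l)) le0 (x - 0) - 1 / 2| <= 1 / 8.
  by near: x; exact: median_at_deadline.
rewrite subr0 in hm.
set k := m 1%N x in hx hm *.
pose A := eta * k%:R.
have bA : bmeas (fun u : R => (u <= - A)%R%:R : R).
  by apply: bmeas_ind; exact: measurable_fun_ler.
have low : expR (- (l * A)) * (iter k (stepop mu (tilt mu l)) le0 x -
     iter k (stepop mu (tilt mu l)) (fun u : R => (u <= - A)%R%:R) x) <=
    iter k (stepop mu (tilt mu l)) (fun u => expR (l * u) * le0 u) x.
  have b0 := @bmeas_le0 R.
  rewrite -[- iter _ _ _ _]mulN1r -(iterKZ W)// -(iterKD W)//; last exact: bmeasZ.
  have b1 : bmeas (fun u : R => le0 u + -1 * (u <= - A)%R%:R).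
    by apply: bmeasD => //; exact: bmeasZ.
  rewrite -(iterKZ W)//; apply: (le_iterK W) => //; first exact: bmeasZ.
  move=> u; have A0 : 0 <= A by rewrite /A mulr_ge0// ltW.
  case: (leP u (- A)) => uA.
    have u0 : u <= 0 by lra.
    by rewrite u0 !mulr1n mulr1 subrr mulr0 mulr1 expR_ge0.
  rewrite mulr0 addr0 ler_wpM2r//.
  by rewrite ler_expR -mulrN ler_pM2l// ltW.
have up : iter k (stepop mu (tilt mu l)) (fun u : R => (u <= - A)%R%:R) x <= 1 / 8.
  apply: le_trans hx.
  have ib : intw mu (tilt mu l) (fun z => expR (- (- a) * z)) by rewrite opprK; exact: intw_tilt_exp.
  have hf (u : R) : (u <= - A)%R%:R <= expR (- (a * A)) * expR (- a * u).
    case: (leP u (- A)) => uA; last by rewrite mulr_ge0 ?expR_ge0.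
    rewrite -expRD leNgt expR_lt1 -leNgt.
    by rewrite (_ : _ + _ = a * (- A - u)); [rewrite mulr_ge0 ?(ltW a0)// subr_ge0|ring].
  apply: (le_trans (iterK_le_exp W k x bA ib hf)).
  rewrite opprK mul0r addr0.
  apply: (@le_trans _ _ (expR (- (a * A)) * expR (a * (v + eta / 2)) ^+ k * expR (- a * x))).
    rewrite ler_wpM2r ?expR_ge0// ler_wpM2l ?expR_ge0//.
    by rewrite lerXn2r ?nnegrE ?expR_ge0 ?(mgf_ge0 W).
  rewrite -expRM_natr -!expRD ler_expR le_eqVlt; apply/orP; left; apply/eqP.
  by rewrite /A; field.
apply: le_trans (iterK_le_hit mu k x).
have := iterK_tilt mu l k x (@bmeas_le0 R) => E.
have -> : iter k (stepop mu one) le0 x = phi l ^+ k * (expR (- l * x) *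
    iter k (stepop mu (tilt mu l)) (fun u => expR (l * u) * le0 u) x).
  rewrite E [RHS]mulrCA mulVKf ?expf_neq0 ?gt_eqF//.
  by rewrite mulrA -expRD mulNr addNr expR0 mul1r.
rewrite mulrCA ler_wpM2l ?exprn_ge0 ?(ltW pl0)//.
rewrite expRD mulrCA ler_wpM2l ?expR_ge0// (le_trans _ low)// mulrC.
rewrite (_ : - (l * eta * k%:R) = - (l * A)); last by rewrite /A mulrA.
rewrite ler_wpM2l ?expR_ge0//.
by move: hm; rewrite distrC => /ler_normlW; lra.
Unshelve. all: by end_near. Qed.

Variable t : R.
Hypotheses (t0 : (0 : R) < t) (rt : regular t) (pt : phi t = 1) (vt0 : 0 < mean t).
Hypothesis vtv : mean t <= v.

(* The deadline is too short for the optimal tilt [t]: beating the single particle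
   requires an exponent [s] with a smaller rate, which is [l] itself when
   [phi l > 1] and otherwise lies just above [t]. *)
Lemma many_slow (N : nat) (e : R) : (1 < N)%N -> 0 < e ->
  \forall x \near +oo, q (m N x) x <= e * q (m 1%N x) x.
Proof.
move=> N1 e0; have N0 : (0 < N)%N by exact: ltnW.
have Np : (0 : R) < N%:R by rewrite ltr0n.
have N2 : (2 : R) <= N%:R by rewrite (ler_nat _ 2 N).
suff [s [M [eta [fs s0 eta0 M1 [pM]]]]] : exists s M eta : R, [/\ fin s, 0 <= s, 0 < eta,
    0 <= M & phi s <= expR M /\
    (l - s) * v + M / N%:R + (l * eta - ln (phi l)) < 0].
  move=> rate; have e4 : 0 < e * (1 / 4) by lra.
  near=> x.
  have lo := near (hit_ge eta0) x.
  have hx : expR ((l - s) * x + M * (m N x)%:R + (l * eta - ln (phi l)) * (m 1%N x)%:R) <= e * (1 / 4).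
    by near: x; exact: (exp_exponent v0 hB).
  have {}lo : 1 / 4 * (phi l ^+ m 1%N x * expR (- l * x - l * eta * (m 1%N x)%:R)) <= q (m 1%N x) x.
    by near: x; exact: hit_ge.
  have eM : 1 <= expR M by rewrite leNgt expR_lt1 -leNgt.
  apply: (le_trans (hit_le_supermartingale fs (m N x) x s0 eM pM)).
  apply: (le_trans _ (ler_wpM2l (ltW e0) lo)).
  rewrite mulrA; apply: (le_trans _ (ler_wpM2r _ hx)); last first.
    by rewrite mulr_ge0 ?expR_ge0// exprn_ge0// ltW.
  rewrite -[X in X ^+ m 1%N x](lnK (x := phi l)) ?posrE//.
  rewrite -!expRM_natr -!expRD ler_expR le_eqVlt; apply/orP; left; apply/eqP; ring.
have [p1|p1] := ltP 1 (phi l).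
  have ps : 0 < ln (phi l) by rewrite ln_gt0.
  (* The slope is at most [(1/2 + 1/4 - 1) * ln (phi l)], the 1/2 coming from [N >= 2]. *)
  exists l, (ln (phi l)), (ln (phi l) / (4 * l)); split=> //.
  - exact: ltW.
  - by rewrite divr_gt0// mulr_gt0.
  - exact: ltW.
  split; first by rewrite lnK ?posrE.
  rewrite subrr mul0r add0r.
  have -> : l * (ln (phi l) / (4 * l)) = ln (phi l) / 4 by field; rewrite gt_eqF.
  have : ln (phi l) / N%:R <= ln (phi l) / 2 by rewrite ler_pM2l// lef_pV2 ?posrE.
  lra.
(* Convexity at [t]: as [phi l <= 1], it forces [l <= t], and it bounds [- ln (phi l)] by
   [(t - l) * mean t], hence by [(t - l) * v]. *)
have lt : (l - t) * mean t <= ln (phi l).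
  have := @tangent _ _ t (regular_fin rt) (l - t) (regular_id rt).
  rewrite subrKC pt mul1r => /(_ fl) h.
  by rewrite -[leLHS]expRK ler_ln ?posrE ?expR_gt0.
have lt0 : l <= t.
  rewrite -subr_le0 -(pmulr_lle0 _ vt0) (le_trans lt)//.
  exact: ln_le0.
have k0 : 0 < v / 2 by have := v0; lra.
have [r r0 hr] := regular_chernoff rt k0.
pose h : R := r / 2; have h0 : 0 < h by rewrite /h; lra.
have [fh ph] : fin (t + h) /\ phi (t + h) <= phi t * expR (h * mean t + `|h| * (v / 2)).
  by apply: hr; rewrite gtr0_norm// /h; lra.
(* With [N >= 2] the contributions of [h] add up to at most [(- 1 + 3/4 + 1/8) * h * v], which is
   negative. *)
exists (t + h), (h * (3 / 2) * v), (h * v / (8 * l)); split=> //.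
- by have := t0; lra.
- by rewrite divr_gt0 ?mulr_gt0.
- by rewrite !mulr_ge0 ?(ltW h0) ?(ltW v0)//; lra.
split.
  apply: (le_trans ph); rewrite pt mul1r ler_expR gtr0_norm//.
  have : h * mean t <= h * v by rewrite ler_pM2l.
  lra.
have -> : l * (h * v / (8 * l)) = h * v / 8 by field; rewrite gt_eqF.
have : h * (3 / 2) * v / N%:R <= h * (3 / 2) * v / 2.
  rewrite ler_wpM2l ?lef_pV2 ?posrE//.
  by rewrite !mulr_ge0 ?(ltW h0) ?(ltW v0)//; lra.
have : (t - l) * mean t <= (t - l) * v by rewrite ler_wpM2l// subr_ge0.
have : 0 < h * v by rewrite mulr_gt0.
lra.
Unshelve. all: by end_near. Qed.

End Supercritical.
End Race.

(** * Asymptotic optimality *)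

Section Bernoulli.
Context (R : realType).
Implicit Types p : R.

Lemma any_success_le p N : 0 <= p <= 1 -> 1 - (1 - p) ^+ N <= N%:R * p.
Proof.
move=> /andP[p0 p1]; elim: N => [|N ih]; first by rewrite expr0 subrr mul0r.
rewrite exprS -natr1.
have : p * (1 - p) ^+ N <= p * 1.
  by rewrite ler_wpM2l// exprn_ile1// ?subr_ge0// gerBl.
have -> : (1 - p) * (1 - p) ^+ N = (1 - p) ^+ N - p * (1 - p) ^+ N by ring.
by rewrite mulrDl mul1r mulr1; lra.
Qed.

(** A weak form of the second Bonferroni inequality. *)
Lemma any_success_ge p N : 0 <= p <= 1 ->
  N%:R * p * (1 - N%:R * p) <= 1 - (1 - p) ^+ N.
Proof.
move=> /andP[p0 p1]; elim: N => [|N ih]; first by rewrite expr0 subrr !mul0r.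
rewrite exprS -natr1; set n := N%:R : R.
have n0 : 0 <= n by exact: ler0n.
have : (1 - p) * (1 - p) ^+ N <= (1 - p) * (1 - n * p * (1 - n * p)).
  by rewrite ler_wpM2l ?subr_ge0//; move: ih; rewrite -/n; lra.
have : 0 <= n * p ^+ 2 by rewrite mulr_ge0// sqr_ge0.
have : 0 <= p ^+ 2 by exact: sqr_ge0.
have : 0 <= n ^+ 2 * p ^+ 3 by rewrite mulr_ge0 ?exprn_ge0.
have -> : (1 - p) * (1 - n * p * (1 - n * p)) = 1 - p - n * p + n * p ^+ 2 +
   n ^+ 2 * p ^+ 2 - n ^+ 2 * p ^+ 3 by ring.
have -> : (n + 1) * p * (1 - (n + 1) * p) = n * p + p - n ^+ 2 * p ^+ 2 - 2 * (n * p ^+ 2) - p ^+ 2 by ring.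
lra.
Qed.

End Bernoulli.

Lemma limf_esup_le (R : realType) (f : R -> R) (c : R) :
  (forall e : R, 0 < e -> \forall x \near +oo, f x <= c + e) ->
  (limf_esup (EFin \o f) (pinfty_nbhs R) <= c%:E)%E.
Proof.
move=> h; apply/lee_addgt0Pr => e e0.
apply: (@le_trans _ _ (ereal_sup ((EFin \o f) @` [set x | f x <= c + e]))).
  by apply: ereal_inf_lbound; exists [set x | f x <= c + e] => //; exact: h.
by apply: ge_ereal_sup => _ [x /= fx <-]; rewrite -EFinD lee_fin.
Qed.

Section Optimality.
Context (R : realType) (mu : probability R R).
Notation phi := (mgf mu one).
Notation le0 := (fun u : R => (u <= 0)%R%:R : R).
Notation q n := (iter n (killop mu one) le0).
Notation mean t := (Ew mu (tilt mu t) (fun z => z)).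
Hypothesis nondegenerate : forall c, (0 < mu (~` [set c]))%E.
Variables (v : R) (B : R -> R).
Hypothesis v0 : (0 : R) < v.
Hypothesis hB : forall e : R, 0 < e ->
  \forall x \near +oo, `|x - v * B x| <= e * Num.sqrt (B x).
Notation m := (steps B).

Definition win (N : nat) (x : R) : R := 1 - (1 - q (m N x) x) ^+ N.

Variable RN : nat -> R -> R.
Hypothesis hRN : forall N, (0 < N)%N ->
  \forall x \near +oo, RN N x = win N x / q (m 1%N x) x.

Lemma win_le N x : win N x <= N%:R * q (m N x) x.
Proof. by apply: any_success_le; exact: hit_itv. Qed.

Variable t : R.
Hypotheses (t0 : (0 : R) < t) (rt : regular mu t) (pt : phi t = 1) (vt0 : 0 < mean t).
Notation rho := (ruin mu t).

Section Fast.
Hypothesis vtv : v < mean t.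

Lemma ratio_le (N : nat) (c e : R) : (0 < N)%N -> 0 <= c -> 0 < e ->
  (\forall x \near +oo, win N x <= c * rho x) -> \forall x \near +oo, RN N x <= c + e.
Proof.
move=> N0 c0 e0 hw.
have ce0 : 0 < c + e by rewrite ltr_wpDl.
(* The relative loss for which [c / (1 - e / (c + e))] is exactly [c + e]. *)
have d0 : 0 < e / (c + e) by rewrite divr_gt0.
have v1 : 1%:R * v < mean t by rewrite mul1r.
near=> x.
have x0 : 0 < x by near: x; apply: nbhs_pinfty_gt; exact: num_real.
have -> : RN N x = win N x / q (m 1%N x) x by near: x; exact: hRN.
have w : win N x <= c * rho x by near: x.
have lo : (1 - e / (c + e)) * rho x <= q (m 1%N x) x.
  by near: x; exact: (hit_fast v0 hB t0 rt pt vt0).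
have r0 := ruin_gt0 t0 rt pt vt0 x0.
have d1 : (1 - e / (c + e)) = c / (c + e) by field; rewrite gt_eqF.
rewrite d1 in lo.
(* For [c = 0] the lower bound [lo] is void; a nonpositive numerator over a nonnegative denominator
   suffices, even when the latter is 0. *)
have [c00|cN0] := eqVneq c 0.
  rewrite c00 mul0r in w; rewrite (@le_trans _ _ 0)//; last by rewrite c00 add0r ltW.
  by rewrite mulr_le0_ge0// invr_ge0; have /andP[] := hit_itv mu (m 1%N x) x.
have cp : 0 < c by rewrite lt_def cN0.
have q0 : 0 < q (m 1%N x) x by rewrite (lt_le_trans _ lo)// mulr_gt0// divr_gt0.
rewrite ler_pdivrMr// (le_trans w)//.
have := ler_wpM2l (ltW ce0) lo; rewrite mulrA (mulrC (c + e)) divfK ?gt_eqF//.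
Unshelve. all: by end_near. Qed.

Lemma ratio_fast (N : nat) (e : R) : (0 < N)%N -> N%:R * v < mean t -> 0 < e ->
  \forall x \near +oo, RN N x <= N%:R + e.
Proof.
move=> N0 Nv e0; apply: ratio_le => //; near=> x.
by rewrite (le_trans (win_le _ _))// ler_wpM2l//; exact: hit_le_ruin.
Unshelve. all: by end_near. Qed.

Lemma ratio_slow (N : nat) (e : R) : (0 < N)%N -> mean t < N%:R * v -> 0 < e ->
  \forall x \near +oo, RN N x <= e.
Proof.
move=> N0 Nv e0; have Np : (0 : R) < N%:R by rewrite ltr0n.
have e2 : 0 < e / 2 by lra.
have := @ratio_le N (e / 2) (e / 2) N0 (ltW e2) e2.
rewrite -splitr; apply; near=> x.
rewrite (le_trans (win_le _ _))// (_ : e / 2 = N%:R * (e / 2 / N%:R)); last first.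
  by field; rewrite gt_eqF.
rewrite -mulrA ler_wpM2l//; near: x.
by apply: (hit_slow v0 hB t0 rt pt vt0) => //; rewrite divr_gt0.
Unshelve. all: by end_near. Qed.

Lemma ratio_critical (N : nat) (e : R) : (0 < N)%N -> mean t = N%:R * v -> 0 < e ->
  \forall x \near +oo, RN N x <= N%:R / 2 + e.
Proof.
move=> N0 Nv e0; have Np : (0 : R) < N%:R by rewrite ltr0n.
have e2 : 0 < e / 2 by lra.
have c0 : 0 <= N%:R / 2 + e / 2 by rewrite addr_ge0 ?divr_ge0// ltW.
have := @ratio_le N (N%:R / 2 + e / 2) (e / 2) N0 c0 e2.
rewrite -addrA -splitr; apply; near=> x.
rewrite (le_trans (win_le _ _))//.
rewrite (_ : N%:R / 2 + e / 2 = N%:R * (1 / 2 + e / 2 / N%:R)); last first.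
  by field; rewrite gt_eqF.
rewrite -[leRHS]mulrA ler_wpM2l//; near: x.
by apply: (hit_critical nondegenerate v0 hB t0 rt pt vt0) => //; rewrite divr_gt0.
Unshelve. all: by end_near. Qed.

Lemma ratio_ge (N : nat) (e : R) : (0 < N)%N -> N%:R * v < mean t -> 0 < e ->
  \forall x \near +oo, N%:R - e <= RN N x.
Proof.
move=> N0 Nv e0; have Np : (0 : R) < N%:R by rewrite ltr0n.
(* One factor [1 - d] is lost to the deadline and one to coincident successes; [N * (1 - d) ^+ 2] is
   then at least [N - e]. *)
pose d : R := Num.min (e / (2 * N%:R)) (1 / 2).
have [d0 d1 d2] : [/\ 0 < d, d <= e / (2 * N%:R) & d <= 1 / 2].
  split; rewrite /d.
  - by rewrite lt_min divr_gt0 ?mulr_gt0//; lra.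
  - by rewrite ge_min lexx.
  - by rewrite ge_min lexx orbT.
have v1 : 1%:R * v < mean t by rewrite mul1r.
have dN : 0 < d / N%:R by rewrite divr_gt0.
have s0 : - t * v + 0 / N%:R + 0 < 0 by rewrite mul0r !addr0 mulNr oppr_lt0 mulr_gt0.
near=> x.
have x0 : 0 < x by near: x; apply: nbhs_pinfty_gt; exact: num_real.
have -> : RN N x = win N x / q (m 1%N x) x by near: x; exact: hRN.
have lo1 : (1 - d) * rho x <= q (m 1%N x) x.
  by near: x; exact: (hit_fast v0 hB t0 rt pt vt0).
have loN : (1 - d) * rho x <= q (m N x) x.
  by near: x; exact: (hit_fast v0 hB t0 rt pt vt0).
have ex : expR (- t * x + 0 * (m N x)%:R + 0 * (m 1%N x)%:R) <= d / N%:R.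
  by near: x; exact: (exp_exponent v0 hB).
rewrite !mul0r !addr0 in ex.
have r0 := ruin_gt0 t0 rt pt vt0 x0.
have up1 := hit_le_ruin t0 rt pt (m 1%N x) x.
have upN := hit_le_ruin t0 rt pt (m N x) x.
have re := ruin_le t0 rt x.
have q0 : 0 < q (m 1%N x) x by rewrite (lt_le_trans _ lo1)// mulr_gt0//; lra.
rewrite ler_pdivlMr//.
have /andP[p0 p1] := hit_itv mu (m N x) x.
apply: (le_trans _ (any_success_ge _ (hit_itv mu (m N x) x))).
set p := q (m N x) x in loN upN p0 p1 *; set p' := q (m 1%N x) x in lo1 up1 q0 *.
have Npd : N%:R * p <= d.
  rewrite mulrC -ler_pdivlMr//; lra.
apply: (@le_trans _ _ (N%:R * ((1 - d) * rho x) * (1 - d))); last first.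
  apply: ler_pM.
  - by rewrite mulr_ge0// mulr_ge0 ?(ltW r0)//; lra.
  - by lra.
  - by rewrite ler_pM2l.
  - by lra.
have [neg|pos] := leP (N%:R - e) 0.
  apply: (@le_trans _ _ 0); first by rewrite mulr_le0_ge0// ltW.
  have d3 : 0 <= 1 - d by lra.
  by rewrite mulr_ge0// mulr_ge0// mulr_ge0// ltW.
apply: (@le_trans _ _ ((N%:R - e) * rho x)); first by rewrite ler_wpM2l// ltW.
rewrite (_ : N%:R * _ * _ = N%:R * (1 - d) ^+ 2 * rho x); last by ring.
rewrite ler_wpM2r ?(ltW r0)//.
have : d * (2 * N%:R) <= e by rewrite -ler_pdivlMr ?mulr_gt0.
have : 0 <= N%:R * d ^+ 2 by rewrite mulr_ge0// sqr_ge0.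
rewrite (_ : N%:R * (1 - d) ^+ 2 = N%:R - d * (2 * N%:R) + N%:R * d ^+ 2); last by ring.
lra.
Unshelve. all: by end_near. Qed.

Lemma optimal_fast (n : nat) : (0 < n)%N -> n%:R * v < mean t -> mean t <= n.+1%:R * v ->
  asymptotically_optimal RN n.
Proof.
move=> n0 nv nv1.
have cv : RN n x @[x --> +oo%R] --> (n%:R : R).
  apply/cvgrPdist_le => e e0; near=> x.
  have : n%:R - e <= RN n x by near: x; exact: ratio_ge.
  have : RN n x <= n%:R + e by near: x; exact: ratio_fast.
  by rewrite ler_norml => ? ?; apply/andP; split; lra.
split=> //; first by apply/cvg_ex; exists (n%:R : R).
move=> N N0; rewrite (cvg_lim _ cv)//.
have n1 : (1 : R) <= n%:R by rewrite ler1n.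
have Np : (0 : R) < N%:R by rewrite ltr0n.
have [lt|gt|eq] := ltgtP (N%:R * v) (mean t).
- apply: (@le_trans _ _ (N%:R)%:E); last first.
    rewrite lee_fin ler_nat -ltnS -(ltr_nat R) -(ltr_pM2r v0).
    exact: lt_le_trans lt nv1.
  by apply: limf_esup_le => e e0; exact: ratio_fast.
- apply: (@le_trans _ _ 0%:E); last by rewrite lee_fin.
  by apply: limf_esup_le => e e0; rewrite add0r; exact: ratio_slow.
- apply: (@le_trans _ _ (N%:R / 2)%:E).
    by apply: limf_esup_le => e e0; exact: ratio_critical.
  (* Here the factor 1/2 saves the optimality of [n]: [N <= n + 1 <= 2 * n]. *)
  have : N%:R <= n.+1%:R :> R by rewrite -(ler_pM2r v0) eq.
  by rewrite lee_fin -natr1; lra.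
Unshelve. all: by end_near. Qed.

End Fast.

Section Slow.
Variable l : R.
Hypotheses (l0 : (0 : R) < l) (rl : regular mu l) (vl : mean l = v).
Hypothesis vtv : mean t <= v.

Lemma optimal_slow : asymptotically_optimal RN 1%N.
Proof.
have q0 : \forall x \near +oo, 0 < q (m 1%N x) x.
  near=> x.
  have : 1 / 4 * (phi l ^+ m 1%N x * expR (- l * x - l * 1 * (m 1%N x)%:R)) <= q (m 1%N x) x.
    by near: x; apply: (hit_ge nondegenerate v0 hB l0 rl vl).
  apply: lt_le_trans; rewrite mulr_gt0 ?mulr_gt0 ?expR_gt0 ?exprn_gt0//.
  exact/phi_gt0/regular_fin.
have R1 : \forall x \near +oo, RN 1%N x = 1.
  near=> x.
  have -> : RN 1%N x = win 1 x / q (m 1%N x) x by near: x; exact: hRN.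
  have qx : 0 < q (m 1%N x) x by near: x.
  by rewrite /win expr1 subKr divff// gt_eqF.
have cv : RN 1%N x @[x --> +oo%R] --> (1 : R).
  by apply/cvgrPdist_le => e e0; apply: filterS R1 => x ->; rewrite subrr normr0 ltW.
split=> //; first by apply/cvg_ex; exists (1 : R).
move=> N N0; rewrite (cvg_lim _ cv)//; apply: limf_esup_le => e e0.
move: N0; rewrite leq_eqVlt => /predU1P[<-|N1].
  by apply: filterS R1 => x ->; rewrite lerDl ltW.
have N0 : (0 < N)%N by exact: ltnW.
have Np : (0 : R) < N%:R by rewrite ltr0n.
have Ni : (0 : R) < 1 / N%:R by rewrite divr_gt0.
near=> x.
have -> : RN N x = win N x / q (m 1%N x) x by near: x; exact: hRN.
have qx : 0 < q (m 1%N x) x by near: x.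
have qN : q (m N x) x <= 1 / N%:R * q (m 1%N x) x.
  by near: x; exact: (many_slow nondegenerate v0 hB l0 rl vl t0 rt pt vt0 vtv).
rewrite (@le_trans _ _ 1)//; last by rewrite lerDl ltW.
rewrite ler_pdivrMr// mul1r (le_trans (win_le _ _))//.
by rewrite -ler_pdivlMl// -div1r.
Unshelve. all: by end_near. Qed.

End Slow.
End Optimality.

(** * Translation of the moment generating function and of the particle system *)

Section LaplaceTransform.
Context (R : realType) (d : measure_display) (T : measurableType d)
  (P : probability T R) (X : {RV P >-> R}).
Notation mu := (distribution P X).
Notation fin t := (intw mu one (fun z => expR (t * z))).

Let mexp (t : R) : measurable_fun setT (fun z : R => expR (t * z)).
Proof.
apply: measurableT_comp; first exact: measurable_expR.
exact: measurable_funM.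
Qed.

Lemma mmt_gen_distribution (t : R) :
  ('M_P X t = \int[mu]_z (expR (t * z))%:E)%E.
Proof.
rewrite ge0_integral_distribution//.
- rewrite /mmt_gen_fun unlock; apply: eq_integral => w _ /=.
  by rewrite mulrC.
- by apply/measurable_EFinP; exact: mexp.
Qed.

Lemma LambdaP (t : R) : Lambda P X t -> fin t.
Proof.
rewrite /Lambda/= mmt_gen_distribution => h; apply/integrableP; split.
  apply/measurable_EFinP; apply: measurable_funM; first exact: mexp.
  exact: measurable_cst.
rewrite (eq_integral (fun z => (expR (t * z))%:E))//.
by move=> z _ /=; rewrite mulr1 ger0_norm// expR_ge0.
Qed.

Lemma phiE : phi P X = mgf mu one.
Proof.
apply/funext => t; rewrite /phi mmt_gen_distribution /mgf /Ew /Rintegral.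
by congr fine; apply: eq_integral => z _; rewrite mulr1.
Qed.

Lemma Lambda_plus_regular t : (forall l, Lambda_plus P X l -> derivable (phi P X) l 1) ->
  Lambda_plus P X t -> 0 < t /\ regular mu t.
Proof.
rewrite phiE => dphi [t0 it]; split; first by move: t0; rewrite /= in_itv/= andbT.
have o : open (Lambda_plus P X).
  by apply: openI; [exact: interval_open|exact: open_interior].
have : nbhs t (Lambda_plus P X) by apply: open_nbhs_nbhs; split.
move=> /nbhs_ballP[e /= e0 he]; exists e; split=> // s se.
  have h : ball t e (t + s) by rewrite /ball/= opprD addrA subrr sub0r normrN.
  by have [_ /interior_subset/LambdaP] := he _ h.
by apply/dphi/he; rewrite /ball/= opprD addrA subrr sub0r normrN.
Qed.

Lemma derive1_psi t : regular mu t ->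
  derive1 (psi P X) t = Ew mu (tilt mu t) (fun z => z).
Proof.
move=> rt; have p0 := phi_gt0 (regular_fin rt); have [e [e0 fe de]] := rt.
have d1 := is_derive_mgf e0 fe de; have d2 := is_derive1_ln p0.
rewrite derive1E.
have := @is_derive1_comp _ (@ln R) (mgf mu one) t _ _ d2 d1.
rewrite (_ : @ln R \o _ = psi P X); last by rewrite /psi phiE.
by move=> [_ ->]; rewrite mulKf// gt_eqF.
Qed.

End LaplaceTransform.

Section Particles.
Context (R : realType) (d : measure_display) (T : measurableType d)
  (P : probability T R).

(** The complement asks all [N] times to exceed [s], and its probability factors by independence. *)
Lemma prob_first_time (N : nat) (Y : 'I_N -> {RV P >-> \bar R}) (H : T -> \bar R) (s p : R) :
  iid_copies P (fun k => Y k : T -> \bar R) H ->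
  P [set w | (H w <= s%:E)%E] = p%:E ->
  P [set w | (first_time (fun k => Y k : T -> \bar R) w <= s%:E)%E] = (1 - (1 - p) ^+ N)%:E.
Proof.
move=> [ind law] Hp.
pose A : set (\bar R) := `]s%:E, +oo%E]%classic.
have mA : measurable A by exact: emeasurable_itv.
have mY k (C : set (\bar R)) : measurable C -> measurable ((Y k : T -> \bar R) @^-1` C).
  by move=> mC; rewrite -[X in measurable X]setTI; exact: (measurable_funPT (Y k)).
have PA k : P ((Y k : T -> \bar R) @^-1` A) = (1 - p)%:E.
  have mB : measurable (~` A) by exact: measurableC.
  have e1 : P ((Y k : T -> \bar R) @^-1` (~` A)) = p%:E.
    rewrite law// -Hp; congr (P _); apply/seteqP; split=> w /=; rewrite /A /= in_itv/= leey andbT.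
      by move=> /negP; rewrite -leNgt.
    by move=> h; apply/negP; rewrite -leNgt.
  rewrite -[A]setCK preimage_setC (@probability_setC _ _ _ P _ (mY k _ mB)).
  by rewrite e1.
have E : [set w | (first_time (fun k => Y k : T -> \bar R) w <= s%:E)%E] =
    ~` (\bigcap_(k in [set` enum 'I_N]) ((Y k : T -> \bar R) @^-1` A)).
  apply/seteqP; split=> w /=.
    move=> h hc; move: h; rewrite /first_time leNgt => /negP; apply.
    apply/bigmin_gtP; split; first exact: ltry.
    by move=> k _; have := hc k; rewrite /= mem_enum /A /= in_itv/= leey andbT; exact.
  move=> hc; rewrite leNgt; apply/negP => /bigmin_gtP[_ h]; apply: hc => k _.
  by rewrite /A /= in_itv/= leey andbT; exact: h.
have mI : measurable (\bigcap_(k in [set` enum 'I_N]) ((Y k : T -> \bar R) @^-1` A)).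
  by apply: fin_bigcap_measurable => // k _; exact: mY.
rewrite E probability_setC// ind ?enum_uniq//.
rewrite (eq_bigr (fun=> (1 - p)%:E)); last by move=> k _; exact: PA.
by rewrite prodEFin big_const_seq count_predT size_enum_ord iter_mulr_1.
Qed.

End Particles.

(** For an integer [N], [N < w / v] is equivalent to [N < ceil (w / v)]; the strict inequality makes
    the formula right also when [w / v] is an integer. *)
Lemma max_multiple_lt (R : realType) (v w : R) : 0 < v -> v < w -> exists n : nat,
  [/\ (0 < n)%N, forall N : nat, (N%:R * v < w) = (N <= n)%N &
      n%:Z = Num.ceil (w / v) - 1].
Proof.
move=> v0 vw; set c := Num.ceil _.
have c1 : 1 < c by rewrite ceil_gt_int ltr_pdivlMr// mul1r.
have ltc (N : nat) : (N%:R * v < w) = (N%:Z < c) by rewrite ceil_gt_int ltr_pdivlMr.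
have nE : `|c - 1|%N%:Z = c - 1 by rewrite gez0_abs//; lia.
exists `|c - 1|%N; split=> //; first lia.
by move=> N; rewrite ltc; lia.
Qed.

Theorem corollary1 (R : realType) (d : measure_display) (T : measurableType d)
    (P : probability T R)
    (X : {RV P >-> R}) (Xs : nat -> {RV P >-> R})
    (hXs : iid_copies P (fun i => Xs i : T -> R) X)
    (hXcst : ~ exists c : R, P [set w | X w = c] = 1%E)
    (hXpos : (0 < P [set w | (0 < X w)%R])%E)
    (hXneg : (0 < P [set w | (X w < 0)%R])%E)
    (tau : forall N : nat, R -> 'I_N -> {RV P >-> \bar R})
    (htau : forall (N : nat) (x : R), (1 <= N)%N ->
       iid_copies P (fun k : 'I_N => tau N x k : T -> \bar R)
         (hitting_time (walk (fun i => Xs i : T -> R)) x))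
    (hLambda : Lambda_plus P X !=set0)
    (hphi1 : forall l, Lambda_plus P X l -> derivable (phi P X) l 1)
    (hphi2 : forall l, Lambda_plus P X l -> derivable (derive1 (phi P X)) l 1)
    (lstar : R) (hlstar : Lambda_plus P X lstar)
    (hpsi0 : psi P X lstar = 0)
    (l : R) (hl : Lambda_plus P X l)
    (hpsi'pos : 0 < derive1 (psi P X) l)
    (B : R -> R) (hB : Lset P X l B) :
  let psi' := derive1 (psi P X) in
  let RN := prob_ratio P (walk (fun i => Xs i : T -> R))
              (fun N x (k : 'I_N) => tau N x k : T -> \bar R) B in
  (psi' l < psi' lstar ->
     exists Nstar : nat,
       let S := [set N : nat | (1 <= N)%N /\ N%:R * psi' l < psi' lstar] in
       [/\ S Nstar /\ ubound S Nstar,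
           Nstar%:Z = Num.ceil (psi' lstar / psi' l) - 1 &
           asymptotically_optimal RN Nstar])
  /\ (~ psi' l < psi' lstar -> asymptotically_optimal RN 1).
Proof.
move=> psi' RN.
pose mu := distribution P X.
have [l0 rl] := Lambda_plus_regular hphi1 hl.
have [t0 rt] := Lambda_plus_regular hphi1 hlstar.
pose v := psi' l.
have v0 : (0 : R) < v by [].
have vl : Ew mu (tilt mu l) (fun z => z) = v := esym (derive1_psi rl).
have vt : Ew mu (tilt mu lstar) (fun z => z) = psi' lstar := esym (derive1_psi rt).
(* [ln] also vanishes on nonpositive numbers, so the positivity of [phi] enters here. *)
have pt : mgf mu one lstar = 1.
  have p0 := phi_gt0 (regular_fin rt).
  by move: hpsi0; rewrite /psi phiE -/mu => /eqP; rewrite ln_eq0// => /eqP.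
have pos : (0 < mu `]0%R, +oo[%classic)%E.
  rewrite (_ : mu _ = P [set w | (0 < X w)%R])//.
  rewrite /mu /distribution /pushforward; congr (P _).
  by apply/seteqP; split=> w /=; rewrite in_itv/= andbT.
have nondeg (c : R) : (0 < mu (~` [set c]))%E.
  rewrite lt_def measure_ge0 andbT; apply/eqP => m0; apply: hXcst; exists c.
  have mc : measurable [set c] by exact: measurable_set1.
  have /esym/eqP := etrans (esym m0) (probability_setC (distribution P X) mc).
  rewrite sube_eq// add0e => /eqP e.
  exact: esym e.
have vt0 : 0 < Ew mu (tilt mu lstar) (fun z => z) by exact: regular_mean_gt0.
have hB' (e : R) : 0 < e -> \forall x \near +oo, `|x - v * B x| <= e * Num.sqrt (B x).
  move=> e0; move: hB => /eqoP /(_ e e0).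
  apply: filterS => x /=.
  by rewrite (ger0_norm (sqrtr_ge0 _)).
(* Only for large [x]: the formula for the hitting probability requires a nonnegative deadline. *)
have hRN (N : nat) : (0 < N)%N -> \forall x \near +oo,
    RN N x = win mu B N x / iter (steps B 1 x) (killop mu one) (fun u : R => (u <= 0)%R%:R) x.
  move=> N0; near=> x.
  have B0 : 0 <= B x by near: x; exact: (deadline_ge v0 hB').
  rewrite /RN /prob_ratio.
  rewrite (prob_first_time (htau N x N0) (prob_hitting_time hXs x (divr_ge0 B0 (ler0n _ N)))).
  by rewrite (prob_hitting_time hXs x B0) /win /steps divr1.
split=> [lt|nlt]; last first.
  apply: (optimal_slow nondeg v0 hB' hRN t0 rt pt vt0 l0 rl vl).
  by rewrite vt leNgt; apply/negP.
have [n [n0 ltn nE]] := @max_multiple_lt R v (psi' lstar) v0 lt.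
have lt1 : v < Ew mu (tilt mu lstar) (fun z => z) by rewrite vt.
have ln : n%:R * v < Ew mu (tilt mu lstar) (fun z => z) by rewrite vt ltn.
have ln1 : Ew mu (tilt mu lstar) (fun z => z) <= n.+1%:R * v.
  by rewrite vt leNgt ltn ltnn.
have opt := optimal_fast nondeg v0 hB' hRN t0 rt pt vt0 lt1 n0 ln ln1.
exists n => S; split; [split|exact: nE|exact: opt].
  by split; [exact: n0|rewrite (ltn n)].
by move=> N [_ hN]; rewrite leEnat -ltn.
Unshelve. all: by end_near. Qed.
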